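(* Any cone structure $\mathcal C$ on a manifold $M$ of dimension $n\ge2$ is the cone structure of a (smooth) Lorentz-Finsler metric $L$ defined on all $TM$; that is, there is a positively 2-homogeneous function $L:TM\to\mathbb R$, smooth on $TM\setminus\mathbf 0$ and with non-degenerate fundamental tensor of index $n-1$ at every $v\in TM\setminus\mathbf 0$, such that $L>0$ on the cone domain $A$ of $\mathcal C$ and $L=0$ on $\mathcal C$ (so the restriction of $L$ to $\bar A=A\cup\mathcal C$ is a Lorentz-Finsler metric with cone structure $\mathcal C$).
   Context: ''Smooth'' means $C^\infty$; $\mathbf 0$ is the zero section of $TM$. The fundamental tensor of $L$ at $v\in T_pM$ is $g_v(u,w)=\frac12\frac{\partial^2}{\partial r\partial s}L(v+ru+sw)|_{r=s=0}$, $u,w\in T_pM$; index $n-1$ means signature $(+,-,\dots,-)$. Cone: let $V$ be a real vector space of dimension $n\ge2$. A (strong) cone in $V$ is a nonempty smooth hypersurface $\mathcal C_0$ embedded in $V\setminus\{0\}$ such that: (i) $v\in\mathcal C_0,\ \lambda>0\Rightarrow\lambda v\in\mathcal C_0$; (ii) $v\in\mathcal C_0\Rightarrow -v\notin\mathcal C_0$; (iii) $\mathcal C_0$ is the boundary in $V\setminus\{0\}$ of an open subset $A_0\subset V\setminus\{0\}$ (its interior) which is convex; (iv) the second fundamental form of $\mathcal C_0$ as an affine hypersurface of $V$, with respect to a transverse direction pointing into $A_0$ (sign such that boundaries of convex sets have positive semi-definite form), is positive semi-definite with radical at each $v\in\mathcal C_0$ spanned by $v$. Cone structure: an embedded hypersurface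 $\mathcal C$ of $TM$ such that for each $p\in M$, $\mathcal C_p:=\mathcal C\cap T_pM$ is a cone in $T_pM$, with interior $A_p$, and $T_v(T_pM)+T_v\mathcal C=T_v(TM)$ for $v\in\mathcal C_p$. Its cone domain is $A=\bigcup_pA_p$. *)

(* Defs.v *)
From HB Require Import structures.
From mathcomp Require Import all_boot all_order all_algebra.
From mathcomp Require Import all_classical all_reals all_analysis.
Set Implicit Arguments.
Unset Strict Implicit.
Unset Printing Implicit Defensive.
Import Order.TTheory GRing.Theory Num.Theory.
Import numFieldNormedType.Exports.
Local Open Scope classical_set_scope.
Local Open Scope ring_scope.

(* Throughout, V and W stand for finite-dimensional normed spaces; they are    *)
(* only instantiated with R, 'rV[R]_n and 'rV[R]_n * 'rV[R]_n.                 *)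

(* C^k on an open set U, by iterated directional derivatives.  In finite       *)
(* dimension this is the usual notion: existence and continuity of all partial *)
(* derivatives of order at most k.  Values of f outside U are irrelevant.      *)
Fixpoint Ck_on (R : realType) (V W : normedModType R) (k : nat)
    (U : set V) (f : V -> W) : Prop :=
  (forall x, U x -> {for x, continuous f}) /\
  if k is k'.+1 then
    (forall x v, U x -> derivable f x v) /\
    (forall v, Ck_on k' U (fun x => 'D_v f x))
  else True.

Definition smooth_on (R : realType) (V W : normedModType R)
    (U : set V) (f : V -> W) : Prop :=
  forall k, Ck_on k U f.

Definition diffeo (R : realType) (V W : normedModType R)
    (N : set V) (N' : set W) (f : V -> W) (g : W -> V) : Prop :=
  [/\ open N /\ open N',
      (forall x, N x -> N' (f x)) /\ (forall y, N' y -> N (g y)),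
      (forall x, N x -> g (f x) = x) /\ (forall y, N' y -> f (g y) = y),
      smooth_on N f & smooth_on N' g].

(* Slice charts: near each of its points, S is carried by a local              *)
(* diffeomorphism of V onto a piece of the hyperplane ker l.                   *)
Definition embedded_hypersurface (R : realType) (V : normedModType R)
    (S : set V) : Prop :=
  forall x, S x ->
    exists (N N' : set V) (f g : V -> V) (l : {scalar V}),
      [/\ N x, diffeo N N' f g, exists u, l u <> 0
        & forall y, N y -> (S y <-> l (f y) = 0)].

(* T_x S, as the set of velocities at x of the smooth curves lying in S. *)
Definition tangent_at (R : realType) (V : normedModType R)
    (S : set V) (x : V) : set V :=
  [set u | exists (e : R) (c : R -> V),
    [/\ 0 < e, smooth_on (ball (0 : R) e) c,
        forall t, ball (0 : R) e t -> S (c t), c 0 = x & derive1 c 0 = u]].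

(* h is the second fundamental form of S at v with respect to xi, given by the *)
(* affine Gauss formula D_u X = (tangent part) + h(u, X_v) xi, for the flat    *)
(* connection D of V and all vector fields X tangent along S near v.  Only the *)
(* values of h on T_v S are determined.  With xi on the convex side, boundaries*)
(* of convex sets have a positive semi-definite h.                             *)
Definition is_second_fundamental_form (R : realType) (V : normedModType R)
    (S : set V) (v xi : V) (h : V -> V -> R) : Prop :=
  forall (N : set V) (X : V -> V), open N -> N v -> smooth_on N X ->
    (forall y, N y -> S y -> tangent_at S y (X y)) ->
    forall u, tangent_at S v u ->
      tangent_at S v ('D_u X v - h u (X v) *: xi).

Definition transverse_into (R : realType) (V : normedModType R)
    (S A0 : set V) (v xi : V) : Prop :=
  ~ tangent_at S v xi /\
  exists2 e : R, 0 < e & forall t, 0 < t < e -> A0 (v + t *: xi).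

(* C0 is a (strong) cone of V with interior A0.  The boundary is relative to   *)
(* V minus the origin.                                                         *)
Definition is_cone (R : realType) (V : normedModType R)
    (C0 A0 : set V) : Prop :=
  [/\ C0 !=set0 /\ ~ C0 0,
      embedded_hypersurface C0,
      (forall v (a : R), C0 v -> 0 < a -> C0 (a *: v)) /\
      (forall v, C0 v -> ~ C0 (- v)),
      [/\ open A0, ~ A0 0, convex_set (A0 : set (convex_lmodType V))
        & C0 = (closure A0 `\` A0^°) `\ 0]
    & forall v, C0 v -> exists xi h,
        [/\ transverse_into C0 A0 v xi,
            is_second_fundamental_form C0 v xi h,
            forall u, tangent_at C0 v u -> 0 <= h u u
          & forall u,
              (tangent_at C0 v u /\
               (forall w, tangent_at C0 v w -> h u w = 0)) <->
              exists a : R, u = a *: v]].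

(* A chart is a homeomorphism cmap : cdom -> ccod with inverse cinv, both      *)
(* extended by arbitrary values.                                               *)
Record chart (R : realType) (n : nat) (M : topologicalType) := Chart {
  cdom : set M ;
  ccod : set 'rV[R]_n ;
  cmap : M -> 'rV[R]_n ;
  cinv : 'rV[R]_n -> M ;
  cdom_open : open cdom ;
  ccod_open : open ccod ;
  cmap_cod : forall p, cdom p -> ccod (cmap p) ;
  cinv_dom : forall x, ccod x -> cdom (cinv x) ;
  cmapK : forall p, cdom p -> cinv (cmap p) = p ;
  cinvK : forall x, ccod x -> cmap (cinv x) = x ;
  cmap_continuous : forall p, cdom p -> {for p, continuous cmap} ;
  cinv_continuous : forall x, ccod x -> {for x, continuous cinv} }.

(* A smooth atlas, together with the choice of a preferred chart around each   *)
(* point; the latter only serves to fix a model of the tangent bundle.         *)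
Record smooth_atlas (R : realType) (n : nat) (M : topologicalType) :=
  SmoothAtlas {
    atlas : set (chart R n M) ;
    chart_at : M -> chart R n M ;
    chart_at_atlas : forall p, atlas (chart_at p) ;
    chart_at_dom : forall p, cdom (chart_at p) p ;
    atlas_smooth : forall c c', atlas c -> atlas c' ->
      smooth_on (ccod c `&` cinv c @^-1` cdom c') (cmap c' \o cinv c) }.

(* TM.  A tangent vector v at p is given by its coordinates in the preferred   *)
(* chart at p, so each T_p M is a copy of 'rV[R]_n.  No topology is put on the *)
(* pairs (p, v): p |-> chart_at p may jump, and smoothness on TM is always     *)
(* expressed in the charts induced by those of M, below.                       *)
Record tangent_bundle (R : realType) (n : nat) (M : topologicalType)
    (A : smooth_atlas R n M) := Tangent {
  foot : M ;
  tvec : 'rV[R]_n }.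

Definition at_point (R : realType) (n : nat) (M : topologicalType)
    (A : smooth_atlas R n M) (p : M) (v : 'rV[R]_n) : tangent_bundle A :=
  Tangent A p v.

(* Inverse of the chart of TM induced by c: the pair (x, w) is sent to the     *)
(* vector at cinv c x whose coordinates in the chart c are w.                  *)
Definition bundle_inv (R : realType) (n : nat) (M : topologicalType)
    (A : smooth_atlas R n M) (c : chart R n M)
    (z : 'rV[R]_n * 'rV[R]_n) : tangent_bundle A :=
  let p := cinv c z.1 in
  at_point A p ('d (cmap (chart_at A p) \o cinv c) (z.1) (z.2)).

Definition in_chart (R : realType) (n : nat) (M : topologicalType)
    (A : smooth_atlas R n M) (C : set (tangent_bundle A)) (c : chart R n M)
    : set ('rV[R]_n * 'rV[R]_n) :=
  [set z | ccod c z.1 /\ C (bundle_inv A c z)].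

Definition fibre (R : realType) (n : nat) (M : topologicalType)
    (A : smooth_atlas R n M) (C : set (tangent_bundle A)) (p : M)
    : set 'rV[R]_n :=
  [set v | C (at_point A p v)].

(* The last clause is T_v(T_p M) + T_v C = T_v(TM), read in the charts of TM,  *)
(* where T_v(T_p M) consists of the pairs (0, w).                              *)
Definition cone_structure (R : realType) (n : nat) (M : topologicalType)
    (A : smooth_atlas R n M) (C : set (tangent_bundle A)) : Prop :=
  [/\ forall c, atlas A c -> embedded_hypersurface (in_chart C c),
      forall p, exists A0, is_cone (fibre C p) A0
    & forall c z, atlas A c -> in_chart C c z ->
        forall y : 'rV[R]_n * 'rV[R]_n,
          exists (w : 'rV[R]_n) (y' : 'rV[R]_n * 'rV[R]_n),
            tangent_at (in_chart C c) z y' /\ y = (0, w) + y'].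

(* The union of the interiors A_p; the interior of a cone is unique. *)
Definition cone_domain (R : realType) (n : nat) (M : topologicalType)
    (A : smooth_atlas R n M) (C : set (tangent_bundle A))
    : set (tangent_bundle A) :=
  [set v | exists2 A0, is_cone (fibre C (foot v)) A0 & A0 (tvec v)].

Definition smooth_off_zero (R : realType) (n : nat) (M : topologicalType)
    (A : smooth_atlas R n M) (L : tangent_bundle A -> R) : Prop :=
  forall c, atlas A c ->
    smooth_on [set z : 'rV[R]_n * 'rV[R]_n | ccod c z.1 /\ z.2 <> 0]
      (fun z => L (bundle_inv A c z)).

Definition pos_homogeneous2 (R : realType) (n : nat) (M : topologicalType)
    (A : smooth_atlas R n M) (L : tangent_bundle A -> R) : Prop :=
  forall p v (a : R), 0 < a ->
    L (at_point A p (a *: v)) = a ^+ 2 * L (at_point A p v).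

Definition fundamental_tensor (R : realType) (n : nat) (M : topologicalType)
    (A : smooth_atlas R n M) (L : tangent_bundle A -> R) (p : M)
    (v u w : 'rV[R]_n) : R :=
  2^-1 * derive1 (fun r : R =>
           derive1 (fun s : R => L (at_point A p (v + r *: u + s *: w))) 0) 0.

(* Signature (+, -, ..., -): the rows of e form an orthonormal basis for g.    *)
Definition index_n_minus_1 (R : realType) (n : nat)
    (g : 'rV[R]_n -> 'rV[R]_n -> R) : Prop :=
  exists2 e : 'M[R]_n, e \in unitmx &
    forall i j : 'I_n, g (row i e) (row j e) =
      if i != j then 0 else if (i : nat) == 0%N then 1 else -1.

(* Main.v *)
Require Import Defs.
From HB Require Import structures.
From mathcomp Require Import all_boot all_order all_algebra.
From mathcomp Require Import all_classical all_reals all_analysis.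
From mathcomp Require Import ring lra.
Import Order.TTheory GRing.Theory Num.Theory.
Import numFieldNormedType.Exports.
Local Open Scope classical_set_scope.
Local Open Scope ring_scope.
Set Implicit Arguments.
Unset Strict Implicit.
Unset Printing Implicit Defensive.

(* Fix a smooth vector field T in the interiors of the cones.  A line v + R T
   that misses the origin meets the cone C_p in exactly one point v + tau(v) T;
   tau is smooth by the implicit function theorem, and the condition on the second
   fundamental form makes its Hessian positive definite modulo v and T.  Fix also
   linear forms om on the fibres, depending smoothly on p, with om(T) = 1 and om > 0
   on the closed cones.  Then F = tau + om is invariant under translation by T and
   positive off the axis R T, with om = F on C_p and om > F on A_p, and F^2 is
   strictly convex on ker om.  So om^2 - F^2 has the required properties, except
   that it is not smooth along the axis.  There F^2 is replaced by a quadratic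
   form: with w = q + om^2/16, where 4 q <= F^2 and q is positive definite on
   ker om, and with a smooth convex m such that m(s) = s for s >= 2 and m is
   constant for s <= 1, put L = om^2 - w m(F^2 / w).  The Hessian of w m(F^2 / w)
   is still positive on ker om, so that of L has index n - 1.
   Each of T, om, q is subject to convex conditions on every fibre, so it may be
   built locally and glued by bump functions. *)

(** * Smooth maps between finite-dimensional normed spaces *)

(** A 2-homogeneous function that is smooth at the origin is a quadratic form. The restriction of
    [F^2] to [ker om] is in general not one, so near the axis it has to be replaced by a quadratic
    form, while near the cones it must not be touched. The constants arrange this: on the cones
    [F = om], so [w <= 5 om^2 / 16] and [F^2 / w >= 16 / 5 > 2], where [m] is the identity; and
    [L > 0] wherever [F^2 / w <= 3]. The bound on [q] forces it to vanish on the axis, so the term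
    [om^2 / 16] is what keeps [w] positive there and the quotient [F^2 / w] meaningful.

    Index n - 1 follows from negativity of the Hessian on one hyperplane, here [ker om], along which
    [om] is constant, and from one positive vector; so only the convexity of the subtracted term
    matters.

    A cone structure is only a hypersurface transverse to the fibres. That the interiors vary openly
    with the base point and that [tau] is continuous must be deduced: transverse crossings persist
    on nearby lines, and convexity of each fibre does the rest. *)

Section Line.
Context {R : realType} {V W : normedModType R}.

Lemma is_derive_line (f : V -> W) x v (t : R) :
  derivable f (x + t *: v) v ->
  is_derive t 1 (fun s : R => f (x + s *: v)) ('D_v f (x + t *: v)).
Proof.
move=> df.
have E : (fun h : R => h^-1 *: (f (x + (h *: (1:R) + t) *: v) - f (x + t *: v)))
       = (fun h : R => h^-1 *: (f (h *: v + (x + t *: v)) - f (x + t *: v))).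
  apply/funext => h; rewrite [_%:A]mulr1 scalerDl; congr (_ *: (f _ - _)).
  by rewrite addrCA.
split.
  by rewrite /derivable /= E; exact: df.
by rewrite /derive /= E.
Qed.

End Line.

Lemma mvt_dir {R : realType} {V : normedModType R} (f : V -> R) x v (h : R) :
  (forall t : R, `|t| <= `|h| -> derivable f (x + t *: v) v) ->
  exists2 t, `|t| <= `|h| & f (x + h *: v) - f x = h * 'D_v f (x + t *: v).
Proof.
move=> df; pose g (s : R) := f (x + s *: v).
have dg (t : R) : `|t| <= `|h| -> is_derive t 1 g ('D_v f (x + t *: v)).
  by move=> /df /is_derive_line.
have cg a b : (forall t, t \in `[a, b] -> `|t| <= `|h|) -> {within `[a, b], continuous g}.
  move=> ab; apply: derivable_within_continuous => t /ab /dg tg.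
  exact: ex_derive.
have [h0|h0] := leP 0 h.
- have H t : t \in `[0, h] -> `|t| <= `|h|.
    by rewrite in_itv /= => /andP[t0 th]; rewrite !ger0_norm.
  have [t|t tI E] := @MVT_segment _ g (fun t => 'D_v f (x + t *: v)) _ _ h0 _ (cg _ _ H).
    by move=> /subset_itv_oo_cc /H /dg.
  exists t; first exact: H.
  by move: E; rewrite /g scale0r addr0 subr0 mulrC.
- have H t : t \in `[h, 0] -> `|t| <= `|h|.
    by rewrite in_itv /= => /andP[t0 th]; rewrite !ler0_norm ?lerN2// ltW.
  have [t|t tI E] := @MVT_segment _ g (fun t => 'D_v f (x + t *: v)) _ _ (ltW h0) _ (cg _ _ H).
    by move=> /subset_itv_oo_cc /H /dg.
  exists t; first exact: H.
  move: E; rewrite /g scale0r addr0 sub0r mulrN => E.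
  by rewrite -[LHS]opprB E opprK mulrC.
Qed.

(* [b] and [c] are a finite basis and its coordinate forms. *)
Definition findim (R : realType) (V : normedModType R) :=
  exists (k : nat) (b : nat -> V) (c : nat -> V -> R),
    [/\ forall i a u v, c i (a *: u + v) = a * c i u + c i v,
        forall i, continuous (c i)
      & forall v, v = \sum_(i < k) c i v *: b i].

Lemma cvg_sum_ord {R : realType} {V : normedModType R} {T : Type}
    (F : set_system T) {FF : Filter F} k (f : nat -> T -> V) (a : nat -> V) :
  (forall i, f i x @[x --> F] --> a i) ->
  (\sum_(i < k) f i x) @[x --> F] --> \sum_(i < k) a i.
Proof.
move=> fa; elim: k => [|k IH].
  rewrite big_ord0 (_ : (fun x => _) = cst 0); first exact: cvg_cst.
  by apply/funext => x; rewrite big_ord0.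
rewrite big_ord_recr /= (_ : (fun x => _) =
  (fun x => \sum_(i < k) f i x) \+ f k); first exact: cvgD.
by apply/funext => x; rewrite big_ord_recr.
Qed.

Section C1.
Context {R : realType} {V : normedModType R}.

(** The increment is made along one basis vector at a time. The mean value theorem turns each move
    into a directional derivative at a point near [x], which differs from the one at [x] by at most
    [e]. *)
Lemma C1_telescope (f : V -> R) x (b : nat -> V) :
  (\forall y \near x, forall v, derivable f y v) ->
  (forall v, {for x, continuous (fun y => 'D_v f y)}) ->
  forall k e, 0 < e -> exists2 d, 0 < d & forall (a : nat -> R) y,
    `|y - x| < d -> (forall i, (i < k)%N -> `|a i| < d) ->
    `|f (y + \sum_(i < k) a i *: b i) - f y - \sum_(i < k) a i * 'D_(b i) f x|
       <= e * \sum_(i < k) `|a i|.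
Proof.
move=> df cf; elim=> [|k IH] e e0.
  by exists 1 => // a y _ _; rewrite !big_ord0 addr0 subrr subr0 normr0 mulr0.
have [d1 d10 H1] := IH _ e0.
have : \forall y \near x, (forall v, derivable f y v) /\
    `|'D_(b k) f x - 'D_(b k) f y| < e.
  by apply: filterI => //; have /cvgrPdist_lt := cf (b k); apply.
move=> /nbhs_normP[r /= r0 Hr].
(* Of the radius [r], the displacement of [y] uses [r / s] and the moves along the basis at most
   [r / s] times the sum of the norms; the term 1 in [s] makes the total [r]. *)
pose s := 1 + \sum_(i < k.+1) `|b i|.
have s0 : 0 < s by rewrite ltr_pwDl// sumr_ge0.
exists (Num.min d1 (r / s)); first by rewrite lt_min d10 divr_gt0.
move=> a y; rewrite lt_min => /andP[yx1 yxr] ai.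
have ai1 i : (i < k)%N -> `|a i| < d1.
  by move=> ik; have := ai i (ltnW ik); rewrite lt_min => /andP[].
have air i : (i < k.+1)%N -> `|a i| <= r / s.
  by move=> ik; apply/ltW; have := ai i ik; rewrite lt_min => /andP[].
have {}H1 := H1 a y yx1 ai1.
set y' := y + \sum_(i < k) a i *: b i in H1.
have near_t (t : R) : `|t| <= `|a k| -> `|x - (y' + t *: b k)| < r.
  move=> ta; rewrite distrC /y'.
  have -> : y + \sum_(i < k) a i *: b i + t *: b k - x
     = (y - x) + (\sum_(i < k) a i *: b i + t *: b k) by rewrite -(addrA y) addrAC.
  apply: le_lt_trans (ler_normD _ _) _.
  have -> : r = r / s + (r / s) * \sum_(i < k.+1) `|b i|.
    by rewrite -[X in X + _]mulr1 -mulrDr -/s divfK// gt_eqF.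
  apply: ltr_leD => //.
  rewrite big_ord_recr mulrDr /=; apply: le_trans (ler_normD _ _) _; apply: lerD.
    apply: le_trans (ler_norm_sum _ _ _) _; rewrite mulr_sumr; apply: ler_sum => i _.
    by rewrite normrZ ler_wpM2r// air// ltnW// ltnS.
  by rewrite normrZ ler_wpM2r// (le_trans ta)// air.
have [|t ta Et] := @mvt_dir R V f y' (b k) (a k).
  by move=> t ta; have /near_t/Hr[] := ta.
rewrite big_ord_recr /= addrA -/y' !big_ord_recr /= mulrDr.
have -> : f (y' + a k *: b k) - f y -
   (\sum_(i < k) a i * 'D_(b i) f x + a k * 'D_(b k) f x) =
  (f y' - f y - \sum_(i < k) a i * 'D_(b i) f x) +
  (f (y' + a k *: b k) - f y' - a k * 'D_(b k) f x) by ring.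
apply: le_trans (ler_normD _ _) (lerD H1 _).
rewrite Et -mulrBr normrM mulrC ler_wpM2r//.
by have /near_t/Hr[_] := ta; rewrite distrC => /ltW.
Qed.

Lemma lin_form_lipschitz (c : V -> R) :
  (forall a u v, c (a *: u + v) = a * c u + c v) -> continuous c ->
  exists2 k, 0 < k & forall v, `|c v| <= k * `|v|.
Proof.
move=> lc cc; have lc' : linear_for *%R c by [].
pose L : {linear V -> R^o} := HB.pack c (GRing.isLinear.Build R V R^o _ c lc').
by have [k k0 H] := @linear_lipschitz _ _ _ L cc; exists k.
Qed.

(** [Ck_on] speaks of directional derivatives only, whereas the chain rule requires Frechet
    differentiability; continuity of the derivatives bridges the two. *)
Lemma C1_differentiable (f : V -> R) x : findim V ->
  (\forall y \near x, forall v, derivable f y v) ->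
  (forall v, {for x, continuous (fun y => 'D_v f y)}) ->
  differentiable f x.
Proof.
move=> [k [b [c [lc cc cE]]]] df cf.
pose dl h := \sum_(i < k) c i h * 'D_(b i) f x.
have ldl : linear_for *%R dl.
  move=> a u v; rewrite /dl mulr_sumr -big_split /=; apply: eq_bigr => i _.
  by rewrite lc mulrDl mulrA.
pose L : {linear V -> R^o} := HB.pack dl (GRing.isLinear.Build R V R^o _ dl ldl).
have cL : continuous L.
  move=> y; rewrite /L /= /dl.
  apply: (@cvg_sum_ord _ R^o _ _ _ k (fun i z => c i z * 'D_(b i) f x)
    (fun i => c i y * 'D_(b i) f x)) => i.
  by apply: cvgMl; exact: cc.
have lips : exists2 K, 0 < K & forall h, \sum_(i < k) `|c i h| <= K * `|h|.
  clear -lc cc; elim: k => [|k [K K0 HK]].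
    by exists 1 => // h; rewrite big_ord0 mul1r.
  have [K' K'0 HK'] := lin_form_lipschitz (lc k) (cc k).
  exists (K + K'); first by rewrite addr_gt0.
  by move=> h; rewrite big_ord_recr /= mulrDl lerD.
have [K K0 HK] := lips.
have oE : f \o shift x = cst (f x) + L +o_ (0 : V) id.
  apply/eqaddoP => e e0.
  have [d d0 Hd] := @C1_telescope f x b df cf k (e / K) (divr_gt0 e0 K0).
  near=> h.
  have -> : ((f \o shift x) - (cst (f x) + L)) h
    = f (x + \sum_(i < k) c i h *: b i) - f x - dl h.
    by rewrite -cE !fctE /= /shift /= opprD addrA (addrC h).
  have := Hd (fun i => c i h) x; rewrite subrr normr0 => /(_ d0) H.
  apply: le_trans (H _) _.
    move=> i ik; apply: (@le_lt_trans _ _ (\sum_(i < k) `|c i h|)).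
      by rewrite (bigD1 (Ordinal ik)) //= lerDl sumr_ge0.
    apply: le_lt_trans (HK _) _; rewrite mulrC -ltr_pdivlMr//.
    near: h; apply/nbhs_normP; exists (d / K); first by rewrite /= divr_gt0.
    by move=> y; rewrite /= sub0r normrN.
  rewrite mulrAC ler_pdivrMr// -mulrA [_ * K]mulrC.
  by rewrite ler_wpM2l// ltW.
have dL := diff_unique cL oE.
by apply/diff_locallyP; split; rewrite dL.
Unshelve. all: by end_near. Qed.

End C1.

Lemma near_eq_differentiable {R : realType} {V W : normedModType R}
    (f g : V -> W) x :
  (\forall y \near x, f y = g y) -> differentiable f x -> differentiable g x.
Proof.
move=> fg df.
have oE : g \o shift x = cst (g x) + 'd f x +o_ (0 : V) id.
  apply/eqaddoP => e e0.
  have /eqaddoP/(_ e e0) := diff_locally df.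
  have fg0 : \forall h \near (0 : V), f (h + x) = g (h + x).
    by move: fg; rewrite (near_shift 0)/= ; apply: filterS => h; rewrite subr0.
  apply: filterS2 fg0 => h E; rewrite !fctE /= /shift /= E.
  by rewrite (nbhs_singleton fg).
have dE := diff_unique (diff_continuous df) oE.
apply/diff_locallyP; split; rewrite dE //.
exact: diff_continuous.
Qed.

Lemma continuous_near_eq {T U : topologicalType} (f g : T -> U) x :
  (\forall y \near x, f y = g y) -> {for x, continuous f} -> {for x, continuous g}.
Proof.
move=> fg cf; change (g z @[z --> x] --> g x); rewrite -(nbhs_singleton fg).
by apply: cvg_trans cf; apply: near_eq_cvg; apply: filterS fg => z ->.
Qed.

Lemma diff_scale {R : realType} {V W : normedModType R} (a : V -> R)
    (f : V -> W) x v :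
  differentiable a x -> differentiable f x ->
  differentiable (fun y => a y *: f y) x /\
  'd (fun y => a y *: f y) x v = a x *: 'd f x v + 'd a x v *: f x.
Proof.
move=> da df.
have lb : bilinear_for
    (GRing.Scale.Law.clone _ _ *:%R _) (GRing.Scale.Law.clone _ _ *:%R _)
    (fun (a : R^o) (w : W) => a *: w).
  split=> [u'|u] b y z /=; first by rewrite scalerDl scalerA.
  by rewrite scalerDr !scalerA mulrC.
pose B : {bilinear R^o -> W -> W} := HB.pack (fun (a : R^o) (w : W) => a *: w)
  (bilinear_isBilinear.Build R R^o W W _ _ (fun (a : R^o) (w : W) => a *: w) lb).
have Bc : continuous (fun p : R^o * W => B p.1 p.2).
  by move=> p; apply: scale_continuous.
have E : (fun y => a y *: f y) = (fun p => B p.1 p.2) \o (fun y => (a y : R^o, f y)) by [].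
have dp : differentiable (fun y => (a y : R^o, f y)) x by exact: differentiable_pair.
have db : differentiable (fun p : R^o * W => B p.1 p.2) (a x : R^o, f x).
  exact: differentiable_bilin.
rewrite E; split; first exact: differentiable_comp.
rewrite diff_comp // /comp (diff_pair da df).
by rewrite (@diff_bilin _ _ _ _ B (a x, f x) Bc).
Qed.

(* Unlike [Ck_on], this local notion builds in Frechet differentiability. *)
Fixpoint Cn (R : realType) (V W : normedModType R) (k : nat) (f : V -> W) (x : V)
    : Prop :=
  match k with
  | 0 => \forall y \near x, {for y, continuous f}
  | k'.+1 => (\forall y \near x, differentiable f y) /\
             forall v, Cn k' (fun y => 'D_v f y) x
  end.

Definition sm (R : realType) (V W : normedModType R) (f : V -> W) (x : V) :=
  forall k, Cn k f x.

Section Cn_theory.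
Context {R : realType}.
Implicit Types V W Z : normedModType R.

Lemma Cn_ext V W k (f g : V -> W) x :
  (\forall y \near x, f y = g y) -> Cn k f x -> Cn k g x.
Proof.
elim: k f g => [|k IH] f g fg /=.
  move: fg => /near_join; apply: filterS2 => y; exact: continuous_near_eq.
have /near_join fg' := fg.
move=> [df cf]; split.
  by apply: filterS2 fg' df => y; exact: near_eq_differentiable.
move=> v; apply: IH (cf v); apply: filterS fg' => y fgy.
exact: near_eq_derive.
Qed.

Lemma CnS V W k (f : V -> W) x : Cn k.+1 f x -> Cn k f x.
Proof.
elim: k f => [|k IH] f.
  by move=> [df _]; apply: filterS df => y; exact: differentiable_continuous.
by move=> [df cf]; split => // v; apply: IH; exact: cf.
Qed.

Lemma sm_ext V W (f g : V -> W) x :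
  (\forall y \near x, f y = g y) -> sm f x -> sm g x.
Proof. by move=> fg sf k; exact: Cn_ext (sf k). Qed.

Lemma sm_D V W (f : V -> W) x v : sm f x -> sm (fun y => 'D_v f y) x.
Proof. by move=> sf k; have [_] := sf k.+1; exact. Qed.

Lemma sm_diff_near V W (f : V -> W) x : sm f x ->
  \forall y \near x, differentiable f y.
Proof. by move=> sf; have [] := sf 1%N. Qed.

Lemma sm_diff V W (f : V -> W) x : sm f x -> differentiable f x.
Proof. by move=> /sm_diff_near /nbhs_singleton. Qed.

Lemma sm_cont V W (f : V -> W) x : sm f x -> {for x, continuous f}.
Proof. by move=> /sm_diff /differentiable_continuous. Qed.

Lemma Cn_cst V W k (w : W) (x : V) : Cn k (fun=> w) x.
Proof.
elim: k w => [|k IH] w /=; first by near=> y; exact: cst_continuous.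
split; first by near=> y; exact: differentiable_cst.
move=> v; have := IH 0; apply: Cn_ext; near=> y.
by rewrite (derive_cst w).
Unshelve. all: by end_near. Qed.

Lemma Cn_D V W k (f g : V -> W) x : Cn k f x -> Cn k g x ->
  Cn k (fun y => f y + g y) x.
Proof.
elim: k f g => [|k IH] f g /=.
  by apply: filterS2 => y cf cg; apply: continuousD.
move=> [df cf] [dg cg]; split.
  by apply: filterS2 df dg => y; exact: differentiableD.
move=> v; have := IH _ _ (cf v) (cg v); apply: Cn_ext.
apply: filterS2 df dg => y dfy dgy.
by rewrite -deriveD //; apply: diff_derivable.
Qed.

Lemma Cn_scale V W k (a : V -> R) (f : V -> W) x : Cn k a x -> Cn k f x ->
  Cn k (fun y => a y *: f y) x.
Proof.
elim: k a f => [|k IH] a f.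
  by apply: filterS2 => y ca cf; apply: continuousZ.
move=> Ca Cf; have [da ca] := Ca; have [df cf] := Cf; split.
  by apply: filterS2 da df => y da df; have [] := diff_scale 0 da df.
move=> v.
have := Cn_D (IH _ _ (CnS Ca) (cf v)) (IH _ _ (ca v) (CnS Cf)).
apply: Cn_ext; apply: filterS2 da df => y da df.
have [d E] := diff_scale v da df.
by rewrite !deriveE // E.
Qed.

Lemma Cn_sum V W k n (f : nat -> V -> W) x : (forall i, (i < n)%N -> Cn k (f i) x) ->
  Cn k (fun y => \sum_(i < n) f i y) x.
Proof.
elim: n => [|n IH] cf.
  by have := Cn_cst k (0 : W) x; apply: Cn_ext; near=> y; rewrite big_ord0.
have := Cn_D (IH (fun i ilt => cf i (ltnW ilt))) (cf n (ltnSn n)).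
by apply: Cn_ext; near=> y; rewrite big_ord_recr.
Unshelve. all: by end_near. Qed.

Lemma sm_lin V W (f : V -> W) x : (forall a u v, f (a *: u + v) = a *: f u + f v) ->
  continuous f -> sm f x.
Proof.
move=> lf cf; have lf' : linear f by [].
pose L : {linear V -> W} := HB.pack f (GRing.isLinear.Build R V W _ f lf').
have dL y : differentiable L y by exact: linear_differentiable.
case => [|k]; first by near=> y; exact: cf.
split; first by near=> y; exact: dL.
move=> v; have := Cn_cst k (f v) x; apply: Cn_ext; near=> y.
by rewrite deriveE; [rewrite (@diff_lin _ _ _ L)|exact: dL].
Unshelve. all: by end_near. Qed.

(** In the chain rule the direction ['D_v f y] varies with [y]. Expanding it in a basis leaves
    derivatives of [g] in fixed directions, to which the induction hypothesis applies. *)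
Lemma Cn_comp V W Z k (g : W -> Z) (f : V -> W) x : findim W ->
  Cn k f x -> Cn k g (f x) -> Cn k (g \o f) x.
Proof.
move=> [d [b [c [lc cc cE]]]].
elim: k Z f g => [|k IH] Z f g.
  move=> cf cg; have cfx := nbhs_singleton cf.
  have {}cg := cfx _ cg; near=> y.
  by apply: continuous_comp; [near: y|near: y].
move=> Cf Cg; have [df cf] := Cf; have [dg cg] := Cg.
have cfx := differentiable_continuous (nbhs_singleton df).
have {}dg := cfx _ dg; split.
  by apply: filterS2 df dg => y dfy dgy; exact: differentiable_comp.
move=> v.
have Csum : Cn k (fun y => \sum_(i < d) c i ('D_v f y) *: 'D_(b i) g (f y)) x.
  apply: (@Cn_sum _ _ _ _ (fun i y => c i ('D_v f y) *: 'D_(b i) g (f y))) => i _.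
  apply: Cn_scale; last by apply: (IH Z _ (fun y => 'D_(b i) g y)); [exact: CnS|exact: cg].
  apply: (IH R^o _ (c i)); first exact: cf.
  by apply: (@sm_lin W R^o (c i)); [exact: lc|exact: cc].
apply: Cn_ext Csum; apply: filterS2 df dg => y dfy dgy.
rewrite !deriveE //; last exact: differentiable_comp.
rewrite (diff_comp dfy dgy) /= [in RHS](cE ('d f y v)) linear_sum; apply: eq_bigr => i _.
by rewrite linearZ /= deriveE.
Unshelve. all: by end_near. Qed.

Lemma Cn_pair V W Z k (f : V -> W) (g : V -> Z) x : Cn k f x -> Cn k g x ->
  Cn k (fun y => (f y, g y)) x.
Proof.
elim: k f g => [|k IH] f g /=.
  by apply: filterS2 => y cf cg; apply: cvg_pair.
move=> [df cf] [dg cg]; split.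
  by apply: filterS2 df dg => y; exact: differentiable_pair.
move=> v; have := IH _ _ (cf v) (cg v); apply: Cn_ext.
apply: filterS2 df dg => y dfy dgy.
by rewrite !deriveE ?diff_pair //; exact: differentiable_pair.
Qed.

Lemma sm_cst V W (w : W) (x : V) : sm (fun=> w) x.
Proof. by move=> k; exact: Cn_cst. Qed.

Lemma sm_add V W (f g : V -> W) x : sm f x -> sm g x -> sm (fun y => f y + g y) x.
Proof. by move=> sf sg k; exact: Cn_D. Qed.

Lemma sm_scale V W (a : V -> R) (f : V -> W) x : sm a x -> sm f x ->
  sm (fun y => a y *: f y) x.
Proof. by move=> sf sg k; exact: Cn_scale. Qed.

Lemma sm_mul V (a f : V -> R) x : sm a x -> sm f x -> sm (fun y => a y * f y) x.
Proof. exact: (@sm_scale V R^o). Qed.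

Lemma sm_opp V W (f : V -> W) x : sm f x -> sm (fun y => - f y) x.
Proof.
move=> sf; have := sm_scale (sm_cst (-1 : R) x) sf; apply: sm_ext.
by near=> y; rewrite scaleN1r.
Unshelve. all: by end_near. Qed.

Lemma sm_sub V W (f g : V -> W) x : sm f x -> sm g x -> sm (fun y => f y - g y) x.
Proof. by move=> sf sg; apply: sm_add => //; exact: sm_opp. Qed.

Lemma sm_sum V W n (f : nat -> V -> W) x : (forall i, (i < n)%N -> sm (f i) x) ->
  sm (fun y => \sum_(i < n) f i y) x.
Proof. by move=> sf k; apply: Cn_sum => i ilt; exact: sf. Qed.

Lemma sm_comp V W Z (g : W -> Z) (f : V -> W) x : findim W ->
  sm f x -> sm g (f x) -> sm (fun y => g (f y)) x.
Proof. by move=> W0 sf sg k; exact: Cn_comp. Qed.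

Lemma sm_pair V W Z (f : V -> W) (g : V -> Z) x : sm f x -> sm g x ->
  sm (fun y => (f y, g y)) x.
Proof. by move=> sf sg k; exact: Cn_pair. Qed.

Lemma sm_id V (x : V) : sm (fun y => y) x.
Proof. by apply: sm_lin => // y; exact: cvg_id. Qed.

Lemma sm_fst V W (x : V * W) : sm (fun y => y.1) x.
Proof. by apply: (@sm_lin (V * W)%type V fst) => // y; exact: cvg_fst. Qed.

Lemma sm_snd V W (x : V * W) : sm (fun y => y.2) x.
Proof. by apply: (@sm_lin (V * W)%type W snd) => // y; exact: cvg_snd. Qed.

Lemma findimR : findim (R : normedModType R).
Proof.
exists 1%N, (fun=> 1), (fun=> id); split=> // [i|v]; first by move=> y; exact: cvg_id.
by rewrite big_ord1 [_ *: _]mulr1.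
Qed.

Lemma findim_rV n : findim 'rV[R]_n.
Proof.
exists n, (fun i => if insub i is Some j then delta_mx 0 (j : 'I_n) else 0).
exists (fun i (v : 'rV[R]_n) => if insub i is Some j then v 0 (j : 'I_n) else 0); split.
- move=> i a u v; case: insubP => [j _ _|_]; first by rewrite !mxE.
  by rewrite mulr0 addr0.
- move=> i; case: insubP => [j _ _|_]; first exact: coord_continuous.
  exact: cst_continuous.
- move=> v; rewrite {1}(row_sum_delta v); apply: eq_bigr => i _.
  by rewrite valK.
Qed.

Lemma sum_pairE (V W : zmodType) k (F : nat -> V) (G : nat -> W) :
  \sum_(i < k) (F i, G i) = (\sum_(i < k) F i, \sum_(i < k) G i).
Proof.
elim: k => [|k IH]; first by rewrite !big_ord0.
by rewrite !big_ord_recr /= IH.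
Qed.

Lemma scale_pairE (V W : lmodType R) (a : R) (u : V) (w : W) :
  a *: (u, w) = (a *: u, a *: w).
Proof. by []. Qed.

Lemma findim_prod V W : findim V -> findim W -> findim (V * W)%type.
Proof.
move=> [k1 [b1 [c1 [l1 cc1 E1]]]] [k2 [b2 [c2 [l2 cc2 E2]]]].
exists (k1 + k2)%N.
exists (fun i => if (i < k1)%N then (b1 i, 0) else (0, b2 (i - k1)%N)).
exists (fun i v => if (i < k1)%N then c1 i v.1 else c2 (i - k1)%N v.2); split.
- by move=> i a u v; case: (i < k1)%N; [exact: l1|exact: l2].
- move=> i; case: (i < k1)%N => y.
    by apply: continuous_comp; [exact: cvg_fst|exact: cc1].
  by apply: continuous_comp; [exact: cvg_snd|exact: cc2].
- move=> [v w]; rewrite [RHS]big_split_ord /=.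
  under eq_bigr do rewrite ltn_ord.
  under [X in _ + X]eq_bigr do rewrite ltnNge leq_addr /= addKn.
  transitivity ((\sum_(i < k1) c1 i v *: b1 i, \sum_(i < k2) c2 i w *: b2 i)).
    by rewrite -E1 -E2.
  rewrite -[LHS]/(_, _).
  under [X in _ = X + _]eq_bigr do
    rewrite scale_pairE scaler0.
  under [X in _ = _ + X]eq_bigr do
    rewrite scale_pairE scaler0.
  transitivity ((\sum_(i < k1) c1 i v *: b1 i, \sum_(i < k1) (0 : W)) +
                (\sum_(i < k2) (0 : V), \sum_(i < k2) c2 i w *: b2 i)).
    by rewrite !big1_eq -[RHS]/(_ + _, _ + _) addr0 add0r.
  congr (_ + _); apply/esym.
    exact: (sum_pairE k1 (fun i => c1 i v *: b1 i) (fun=> 0)).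
  exact: (sum_pairE k2 (fun=> 0) (fun i => c2 i w *: b2 i)).
Qed.

(** For derivatives whose point and direction both move, such as the differential of a transition
    map applied to a tangent vector. *)
Lemma sm_diff2 V W Z (f : W -> Z) (p q : V -> W) x : findim W ->
  sm p x -> sm q x -> sm f (p x) -> sm (fun y => 'D_(q y) f (p y)) x.
Proof.
move=> W0 sp sq sf; have [d [b [c [lc cc cE]]]] := W0.
have S : sm (fun y => \sum_(i < d) c i (q y) *: 'D_(b i) f (p y)) x.
  apply: (@sm_sum _ _ _ (fun i y => c i (q y) *: 'D_(b i) f (p y))) => i _.
  apply: sm_scale; last by apply: (@sm_comp _ _ _ (fun z => 'D_(b i) f z) p x W0 sp); exact: (sm_D _ sf).
  apply: (@sm_comp _ _ R^o (c i) q x W0 sq).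
  by apply: (@sm_lin W R^o (c i)); [exact: lc|exact: cc].
apply: sm_ext S.
have dn : \forall y \near x, differentiable f (p y) := sm_cont sp (sm_diff_near sf).
apply: filterS dn => y dy.
rewrite deriveE // [in RHS](cE (q y)) linear_sum; apply: eq_bigr => i _.
by rewrite linearZ /= deriveE.
Qed.

Lemma sm_inv (x : R) : x != 0 -> sm (fun y : R => y^-1) x.
Proof.
move=> x0 k; have ne : \forall y \near x, y != 0.
  have := @cvgr_neq0 R R R (nbhs x) _ id x (@cvg_id _ (nbhs x)) x0; exact.
elim: k => [|k IH] /=.
  by apply: filterS ne => y y0; exact: inv_continuous y0.
split; first by apply: filterS ne => y y0; exact: differentiable_Rinv.
move=> v.
have := Cn_scale (Cn_cst k (- v) x) (Cn_scale (W := R^o) IH IH); apply: Cn_ext.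
apply: filterS ne => y y0.
rewrite deriveE; last exact: differentiable_Rinv.
rewrite diff_Rinv // -[LHS]/(- v * (y^-1 * y^-1)).
by rewrite -invfM -expr2 /= -[RHS]/(- _ * _) mulNr mulNr mulrC.
Qed.

Lemma sm_div V (f g : V -> R) x : sm f x -> sm g x -> g x != 0 ->
  sm (fun y => f y / g y) x.
Proof.
move=> sf sg g0; apply: sm_mul => //.
by apply: (sm_comp (g := fun y : R => y^-1)) => //; [exact: findimR|exact: sm_inv].
Qed.

Lemma sm_exp2 V (f : V -> R) x : sm f x -> sm (fun y => f y ^+ 2) x.
Proof. by move=> sf; exact: sm_mul. Qed.

End Cn_theory.

(** * Equivalence of the two notions of smoothness, and symmetry of second derivatives *)

Section Bridge.
Context {R : realType}.
Implicit Types V W Z : normedModType R.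

(** Only the derivative along [v] is known to exist, so the chain rule is applied on the line
    through [x], where derivability is differentiability. *)
Lemma derive_lin_comp V W (c : W -> R) (f : V -> W) x v :
  (forall a u w, c (a *: u + w) = a * c u + c w) -> continuous c ->
  derivable f x v -> is_derive x v (fun y => c (f y)) (c ('D_v f x)).
Proof.
move=> lc cc df; have lc' : linear_for *%R c by [].
pose L : {linear W -> R^o} := HB.pack c (GRing.isLinear.Build R W R^o _ c lc').
have df0 : derivable f (x + 0 *: v) v by rewrite scale0r addr0.
have dl := is_derive_line df0.
have d1 : differentiable (fun s : R => f (x + s *: v)) 0.
  exact/derivable1_diffP.
have dL y : differentiable L y by exact: linear_differentiable.
have d2 : differentiable (L \o (fun s : R => f (x + s *: v))) 0.
  exact: differentiable_comp.
have dcf : derivable (fun y => c (f y)) x v.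
  apply/derivable1P/derivable1_diffP; apply: near_eq_differentiable d2.
  by near=> s; rewrite /= addrC.
split => //.
have dcf0 : derivable (fun y => c (f y)) (x + 0 *: v) v by rewrite scale0r addr0.
have dl2 := is_derive_line dcf0.
rewrite scale0r addr0 in dl2; rewrite -(@derive_val _ _ _ _ _ _ _ dl2).
rewrite deriveE // (diff_comp d1) //= (@diff_lin _ _ _ L) // -deriveE //.
by rewrite (@derive_val _ _ _ _ _ _ _ dl) scale0r addr0.
Unshelve. all: by end_near. Qed.

Lemma C1_differentiable_vec V W (f : V -> W) x : findim V -> findim W ->
  (\forall y \near x, forall v, derivable f y v) ->
  (forall v, {for x, continuous (fun y => 'D_v f y)}) ->
  differentiable f x.
Proof.
move=> V0 [d [b [c [lc cc cE]]]] df cf.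
have dc i y v : derivable f y v ->
    is_derive y v (fun z => c i (f z)) (c i ('D_v f y)) by exact: derive_lin_comp.
have dcf i : differentiable (fun z => c i (f z)) x.
  apply: C1_differentiable => //.
    by apply: filterS df => y dfy v; have [] := dc i y v (dfy v).
  move=> v; have cfx : {for x, continuous (fun y => c i ('D_v f y))}.
    by apply: continuous_comp; [exact: cf|exact: cc].
  have E : \forall y \near x, c i ('D_v f y) = 'D_v (fun z => c i (f z)) y.
    by apply: filterS df => y dfy; rewrite (@derive_val _ _ _ _ _ _ _ (dc i y v (dfy v))).
  exact: continuous_near_eq E cfx.
have ds : differentiable (\sum_(i < d) (fun z => c i (f z) *: b i)) x.
  apply: differentiable_sum => i.
  by apply: (@differentiableZl _ _ _ (fun z => c i (f z)) (b i)).
apply: near_eq_differentiable ds; near=> y.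
by rewrite fct_sumE -cE.
Unshelve. all: by end_near. Qed.

Lemma smooth_on_sm V W (U : set V) (f : V -> W) x : findim V -> findim W ->
  open U -> smooth_on U f -> U x -> sm f x.
Proof.
(* One order is given up: Frechet differentiability uses the continuity of the next derivatives. *)
move=> V0 W0 oU sf Ux k; move: {sf} (sf k.+1) => sf.
elim: k f sf => [|k IH] f [cf [df sf]].
  by near=> y; apply: cf; near: y; exact: open_nbhs_nbhs.
split.
  near=> y; have Uy : U y by near: y; exact: open_nbhs_nbhs.
  apply: C1_differentiable_vec => //.
    by near=> z; move=> v; apply: df; near: z; exact: open_nbhs_nbhs.
  by move=> v; have [cv _] := sf v; exact: cv.
by move=> v; apply: IH; exact: sf.
Unshelve. all: by end_near. Qed.

Lemma sm_smooth_on V W (U : set V) (f : V -> W) :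
  (forall x, U x -> sm f x) -> smooth_on U f.
Proof.
move=> sf k; elim: k f sf => [|k IH] f sf.
  by split=> // x Ux; apply: sm_cont; exact: sf.
split; first by move=> x Ux; apply: sm_cont; exact: sf.
split; first by move=> x v Ux; apply/diff_derivable/sm_diff; exact: sf.
by move=> v; apply: IH => x Ux; apply: sm_D; exact: sf.
Qed.

Lemma derive_chain V W Z (g : W -> Z) (f : V -> W) x v :
  differentiable f x -> differentiable g (f x) ->
  'D_v (fun y => g (f y)) x = 'D_('D_v f x) g (f x).
Proof.
move=> df dg; rewrite deriveE; last exact: (differentiable_comp df dg).
by rewrite (diff_comp df dg) /= -deriveE // -deriveE.
Qed.

Lemma deriveDv V W (f : V -> W) x u v : differentiable f x ->
  'D_(u + v) f x = 'D_u f x + 'D_v f x.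
Proof. by move=> df; rewrite !deriveE // linearD. Qed.

Lemma deriveZv V W (f : V -> W) x (a : R) v : differentiable f x ->
  'D_(a *: v) f x = a *: 'D_v f x.
Proof. by move=> df; rewrite !deriveE // linearZ. Qed.

Lemma derive_shiftE V W (f : V -> W) w x u :
  derivable f (x + w) u -> is_derive x u (fun y => f (y + w)) ('D_u f (x + w)).
Proof.
move=> df.
have E : (fun h : R => h^-1 *: (f (h *: u + x + w) - f (x + w)))
       = (fun h : R => h^-1 *: (f (h *: u + (x + w)) - f (x + w))).
  by apply/funext => h; rewrite addrA.
by split; rewrite /derivable /derive /= E.
Qed.

(** The mean value theorem twice: along [u] for the increment of [f] by [h *: v], then along [v] for
    ['D_u f]. *)
Lemma second_difference V (f : V -> R) x u v (r h : R) :
  (forall y, `|y - x| < r -> derivable f y u /\ derivable (fun y => 'D_u f y) y v) ->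
  `|h| * (`|u| + `|v|) < r ->
  exists2 p, `|p - x| < r &
   f (x + h *: u + h *: v) - f (x + h *: u) - (f (x + h *: v) - f x)
   = h * (h * 'D_v (fun y => 'D_u f y) p).
Proof.
move=> df hr.
have small (s t : R) : `|s| <= `|h| -> `|t| <= `|h| -> `|x + s *: u + t *: v - x| < r.
  move=> sh th; rewrite -(addrA x) addrAC subrr add0r.
  apply: le_lt_trans (ler_normD _ _) _; apply: le_lt_trans hr.
  by rewrite !normrZ mulrDr lerD // ler_wpM2r.
have small0 (s : R) : `|s| <= `|h| -> `|x + s *: u - x| < r.
  by move=> sh; have := small s 0 sh; rewrite scale0r addr0 normr0; apply.
have dg (s : R) : `|s| <= `|h| ->
   is_derive (x + s *: u) u (fun y => f (y + h *: v) - f y)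
   ('D_u f (x + s *: u + h *: v) - 'D_u f (x + s *: u)).
  move=> sh; apply: is_deriveB; last first.
    by apply: derivableP; have [] := df _ (small0 s sh).
  by apply: derive_shiftE; have [] := df _ (small s h sh (lexx _)).
have [s sh ->] := @mvt_dir R V (fun y => f (y + h *: v) - f y) x u h
  (fun s sh => @ex_derive _ _ _ _ _ _ _ (dg s sh)).
rewrite (@derive_val _ _ _ _ _ _ _ (dg s sh)).
have [t th ->] := @mvt_dir R V (fun y => 'D_u f y) (x + s *: u) v h
  (fun t th => proj2 (df _ (small s t sh th))).
by exists (x + s *: u + t *: v) => //; exact: small.
Qed.

(** The second difference is symmetric in [u] and [v], so the two mixed derivatives agree at some
    pair of points near [x]; if they differed at [x], continuity would keep them apart. *)
Lemma derive_sym V (f : V -> R) x u v : sm f x ->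
  'D_v (fun y => 'D_u f y) x = 'D_u (fun y => 'D_v f y) x.
Proof.
move=> sf; apply/eqP; apply: contrapT => /negP AB.
set A := 'D_v _ x in AB; set B := 'D_u _ x in AB.
pose e := `|A - B| / 2.
have e0 : 0 < e by rewrite divr_gt0 // normr_gt0 subr_eq0.
have cA := sm_cont (sm_D v (sm_D u sf)).
have cB := sm_cont (sm_D u (sm_D v sf)).
have : \forall y \near x, [/\ (derivable f y u /\ derivable (fun y => 'D_u f y) y v),
   (derivable f y v /\ derivable (fun y => 'D_v f y) y u),
   `|A - 'D_v (fun y => 'D_u f y) y| < e & `|B - 'D_u (fun y => 'D_v f y) y| < e].
  have d0 := sm_diff_near sf.
  have d1 := sm_diff_near (sm_D u sf).
  have d2 := sm_diff_near (sm_D v sf).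
  have /cvgrPdist_lt/(_ _ e0) d3 := cA; have /cvgrPdist_lt/(_ _ e0) d4 := cB.
  apply: filterS (filterI (filterI d0 (filterI d1 d2)) (filterI d3 d4)).
  move=> y [[a [b c]] [ge1 ge2]].
  exact: (And4 (conj (@diff_derivable _ _ _ _ _ u a) (@diff_derivable _ _ _ _ _ v b))
               (conj (@diff_derivable _ _ _ _ _ v a) (@diff_derivable _ _ _ _ _ u c)) ge1 ge2).
move=> /nbhs_normP[r /= r0 Hr].
(* Small enough for the parallelogram spanned by [h *: u] and [h *: v] at [x] to lie in the ball of
   radius [r]. *)
pose h := r / 2 / (`|u| + `|v| + 1).
have s0 : 0 < `|u| + `|v| + 1 by rewrite ltr_wpDl // addr_ge0.
have h0 : 0 < h by rewrite !divr_gt0.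
have hr : `|h| * (`|u| + `|v|) < r.
  rewrite gtr0_norm // /h mulrAC ltr_pdivrMr //.
  have : 0 <= `|u| + `|v| by rewrite addr_ge0.
  by move: r0; clear; nra.
have [p px Ep] := @second_difference V f x u v r h
  (fun y yx => let: And4 a _ _ _ := Hr y (eq_ind _ (fun t => t < r) yx _ (distrC _ _)) in a) hr.
have hr' : `|h| * (`|v| + `|u|) < r by rewrite [_ + `|u|]addrC.
have [q qx Eq] := @second_difference V f x v u r h
  (fun y yx => let: And4 _ a _ _ := Hr y (eq_ind _ (fun t => t < r) yx _ (distrC _ _)) in a) hr'.
have pq : 'D_v (fun y => 'D_u f y) p = 'D_u (fun y => 'D_v f y) q.
  have hn0 : h != 0 by rewrite gt_eqF.
  have H : h * (h * 'D_v (fun y => 'D_u f y) p) = h * (h * 'D_u (fun y => 'D_v f y) q).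
    apply: etrans (esym Ep) (etrans _ Eq).
    by rewrite (addrAC x (h *: v)); ring.
  exact: (mulfI hn0 (mulfI hn0 H)).
have [_ _ H1 _] : _ := Hr p (eq_ind _ (fun t => t < r) px _ (distrC _ _)).
have [_ _ _ H2] : _ := Hr q (eq_ind _ (fun t => t < r) qx _ (distrC _ _)).
rewrite pq in H1.
have := ler_distD ('D_u (fun y => 'D_v f y) q) A B.
rewrite distrC in H2 => /le_lt_trans /(_ (ltrD H1 H2)).
by rewrite /e -splitr ltxx.
Unshelve. all: by end_near. Qed.

End Bridge.

(** * Regularity of implicit functions *)

Section ImplicitFunction.
Context {R : realType} {V : normedModType R}.

(** A continuous solution [tau] is given, since its existence will come from the geometry of the
    cones; only regularity is at stake. The first-order expansion of [psi] bounds the error in [tau]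
    by a small multiple of [|h| + |D|], where [D] is the increment of [tau]. *)
Lemma ift_differentiable (psi : V * R -> R) (tau : V -> R) x :
  differentiable psi (x, tau x) -> 'D_((0 : V), (1 : R)) psi (x, tau x) != 0 ->
  {for x, continuous tau} -> (\forall y \near x, psi (y, tau y) = 0) ->
  differentiable tau x /\ forall v, 'D_v tau x =
    - ('D_(v, 0 : R) psi (x, tau x) / 'D_((0 : V), (1 : R)) psi (x, tau x)).
Proof.
move=> dp; set a := 'D__ psi _ => a0 ct z0.
pose z := (x, tau x); pose l v := - ('d psi z (v, 0 : R) / a).
have ll : linear_for *%R l.
  move=> c u v; rewrite /l.
  have -> : (c *: u + v, 0 : R) = c *: (u, 0 : R) + (v, 0 : R).
    by rewrite -[RHS]/(_ + _, _ + _) addr0 /= scaler0.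
  by rewrite linearP /= -[_ *: _]/(_ * _) mulrDl opprD mulrN mulrA.
pose L : {linear V -> R^o} := HB.pack l (GRing.isLinear.Build R V R^o _ l ll).
have cL : continuous L.
  move=> v; rewrite /L /= /l; apply: cvgN; apply: cvgMl.
  apply: continuous_comp; last exact: diff_continuous.
  exact: (sm_cont (sm_pair (sm_id v) (sm_cst (0 : R) v))).
have [K K0 HK] := linear_lipschitz cL.
have aE : a = 'd psi z (0, 1) by rewrite /a deriveE.
have oE : tau \o shift x = cst (tau x) + L +o_ (0 : V) id.
  apply/eqaddoP => e e0.
  (* The bound 1/2 lets the multiple of [|D|] be absorbed, whence [|D| <= (2 K + 1) |h|]; the other
     bound then makes the error at most [e |h|]. *)
  pose th := Num.min (2^-1) (e / (2 * K + 2)).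
  have K2 : 0 < 2 * K + 2 by rewrite addr_gt0 // mulr_gt0.
  have th0 : 0 < th by rewrite lt_min invr_gt0 ltr0n divr_gt0.
  have th1 : th <= 2^-1 by rewrite ge_min lexx.
  have th2 : th * (2 * K + 2) <= e by rewrite -ler_pdivlMr // ge_min lexx orbT.
  have na : 0 < `|a| by rewrite normr_gt0.
  have /eqaddoP/(_ _ (mulr_gt0 th0 na)) := diff_locally dp.
  move=> /nbhs_normP[r /= r0 Hr].
  have n1 : \forall h \near (0 : V), `|h| < r.
    by apply/nbhs_normP; exists r => // h; rewrite /= sub0r normrN.
  have sh : h + x @[h --> (0 : V)] --> x.
    by rewrite -[X in _ --> X]add0r; apply: cvgD; [exact: cvg_id|exact: cvg_cst].
  have n2 : \forall h \near (0 : V), `|tau x - tau (h + x)| < r.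
    have /cvgrPdist_lt/(_ _ r0) := cvg_comp _ _ sh ct; exact.
  have n3 : \forall h \near (0 : V), psi (h + x, tau (h + x)) = 0 by exact: (sh _ z0).
  near=> h.
  pose D := tau (h + x) - tau x.
  have Dk : `|0 - (h, D)| < r.
    rewrite sub0r normrN prod_normE /= gt_max; apply/andP; split.
      exact: (near n1 h).
    by rewrite /D distrC; exact: (near n2 h).
  have := Hr _ Dk; rewrite !fctE /= /shift /=.
  have -> : (h, D) + (x, tau x) = (h + x, tau (h + x)).
    by rewrite -[LHS]/(_ + _, _ + _) /D subrK.
  rewrite (near n3 h) // (nbhs_singleton z0). rewrite !add0r normrN.
  have -> : 'd psi (x, tau x) (h, D) = (- l h + D) * a.
    have -> : (h, D) = (h, 0 : R) + D *: (0, 1).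
      by rewrite -[RHS]/(_ + _, _ + _) /= scaler0 addr0 add0r [_ *: _]mulr1.
    rewrite linearD linearZ /= -/z -aE -[_ *: a]/(D * _) [RHS]mulrDl; congr (_ + _).
    by rewrite /l opprK divfK.
  rewrite normrM [leRHS]mulrAC (ler_pM2r na) prod_normE /= => H.
  have H1 : Num.max `|h| `|D| <= `|h| + `|D|.
    by rewrite ge_max lerDl lerDr !normr_ge0.
  have H2 : `|- l h + D| <= th * (`|h| + `|D|).
    by apply: le_trans H _; rewrite ler_wpM2l // ltW.
  have H3 : `|D| <= `|l h| + `|- l h + D|.
    by have := ler_normD (l h) (- l h + D); rewrite addrA subrr add0r.
  have H4 := HK h; rewrite -[L h]/(l h) in H4.
  have -> : tau (h + x) - (tau x + l h) = - l h + D by rewrite /D; ring.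
  have h0 : 0 <= `|h| by []. have D0 : 0 <= `|D| by [].
  have H5 : `|D| <= (2 * K + 1) * `|h|.
    move: H2 H3 H4 th1 th0 h0 D0; clear; nra.
  have H6 : `|h| + `|D| <= (2 * K + 2) * `|h| by move: H5; clear; lra.
  apply: le_trans H2 _; apply: le_trans (_ : th * ((2 * K + 2) * `|h|) <= _).
    by rewrite ler_wpM2l // ltW.
  by rewrite mulrA ler_wpM2r.
have dE := diff_unique cL oE.
have dt : differentiable tau x by apply/diff_locallyP; split; rewrite dE.
split => // v; rewrite deriveE // dE /= /l.
by rewrite [X in _ = - (X / _)]deriveE.
Unshelve. all: by end_near. Qed.

(** Bootstrapping: the formula for ['D_v tau] involves only [tau] and derivatives of [psi], so each
    order of regularity of [tau] yields the next. *)
Lemma ift_smooth (psi : V * R -> R) (tau : V -> R) x : findim V ->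
  sm psi (x, tau x) -> 'D_((0 : V), (1 : R)) psi (x, tau x) != 0 ->
  (\forall y \near x, {for y, continuous tau}) ->
  (\forall y \near x, psi (y, tau y) = 0) ->
  sm tau x.
Proof.
move=> V0 sp a0 ct z0.
have VR : findim (V * R)%type by apply: findim_prod => //; exact: findimR.
have cp : (fun y => (y, tau y)) @ x --> (x, tau x).
  apply: (@cvg_pair _ _ _ (nbhs x) (nbhs x) (nbhs (tau x))); first exact: cvg_id.
  exact: nbhs_singleton ct.
have dp : \forall y \near x, differentiable psi (y, tau y) := cp _ (sm_diff_near sp).
have da : \forall y \near x, 'D_((0 : V), (1 : R)) psi (y, tau y) != 0.
  have := cvg_comp _ _ cp (sm_cont (sm_D ((0 : V), (1 : R)) sp)).
  by move=> /(@cvgr_neq0 R R V (nbhs x) _ _ _); apply.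
have H : \forall y \near x, differentiable tau y /\ forall v, 'D_v tau y =
    - ('D_(v, 0 : R) psi (y, tau y) / 'D_((0 : V), (1 : R)) psi (y, tau y)).
  have /near_join z0' := z0.
  near=> y; apply: ift_differentiable.
  - by near: y.
  - by near: y.
  - by near: y.
  - by near: y.
elim=> [|k IH]; first exact: ct.
split; first by apply: filterS H => y [].
move=> v; have Cp := Cn_pair IH (Cn_cst k 0 x).
have Cxt : Cn k (fun y => (y, tau y)) x by apply: Cn_pair => //; exact: sm_id.
have CD w : Cn k (fun y => 'D_w psi (y, tau y)) x.
  by apply: (@Cn_comp _ _ _ _ k (fun z => 'D_w psi z) _ x VR Cxt); exact: sm_D.
have := Cn_scale (W := R^o) (Cn_cst k (-1 : R) x) (Cn_scale (W := R^o) (CD (v, 0))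
  (@Cn_comp _ _ _ _ k (fun z : R => z^-1) _ x (findimR (R := R)) (CD (0, 1)) (sm_inv a0 k))).
apply: Cn_ext; apply: filterS H => y [_ ->].
by rewrite scaleN1r.
Unshelve. all: by end_near. Qed.

End ImplicitFunction.

(** * A smooth convex profile *)

Section Profile.
Context {R : realType}.

Lemma mvt_global (f df : R -> R) (a b : R) : (forall x : R, is_derive x 1 f (df x)) -> a <= b ->
  exists2 c, a <= c <= b & f b - f a = df c * (b - a).
Proof.
move=> fdf ab.
have [c cI E] : exists2 c, c \in `[a, b]%R & f b - f a = df c * (b - a).
  apply: MVT_segment => //.
  by apply: derivable_within_continuous => x _; have [] := fdf x.
by exists c => //; move: cI; rewrite in_itv.
Qed.

Lemma nondecreasing_derive_ge0 (f : R -> R) (x : R) :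
  {homo f : u v / u <= v} -> derivable f x 1 -> 0 <= 'D_1 f x.
Proof.
move=> fm df; rewrite /derive; apply: limr_ge => //.
near=> h; rewrite [_%:A]mulr1.
have [h0|h0] := leP 0 h.
  by rewrite -[_ *: _]/(_ * _) mulr_ge0 ?invr_ge0 // subr_ge0 fm // lerDr.
rewrite -[_ *: _]/(_ * _) -mulrNN mulr_ge0 ?oppr_ge0 ?invr_le0 ?(ltW h0) //.
by rewrite subr_le0 fm // gerDr ltW.
Unshelve. all: by end_near. Qed.

(** The powers of [s^-1] make the family stable under differentiation; [flat 0] is the usual
    function that is flat at the origin. *)
Definition flat (k : nat) (s : R) : R :=
  if 0 < s then s^-1 ^+ k * expR (- s^-1) else 0.

Lemma flat_ge0 k (s : R) : 0 <= flat k s.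
Proof.
rewrite /flat; case: ifP => // s0.
by rewrite mulr_ge0 ?expR_ge0 // exprn_ge0 // invr_ge0 ltW.
Qed.

Lemma flat_gt0 k s : 0 < s -> 0 < flat k s.
Proof.
by move=> s0; rewrite /flat s0 mulr_gt0 ?expR_gt0 // exprn_gt0 // invr_gt0.
Qed.

(** The exponential at [s^-1] dominates the term of degree [k.+1] of its series, one more than the
    power in [flat k]; this leaves a factor [s]. *)
Lemma flat_le k s : flat k s <= k.+1`!%:R * `|s|.
Proof.
rewrite /flat; case: ifP => [s0|_]; last by rewrite mulr_ge0.
rewrite (gtr0_norm s0) expRN ler_pdivrMr ?expR_gt0 //.
have y0 : 0 <= s^-1 by rewrite invr_ge0 ltW.
have := expR_ge1Dxn k y0; set E := expR _ => H.
have f0 : 0 < k.+1`!%:R :> R by rewrite ltr0n fact_gt0.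
have H2 : s^-1 ^+ k.+1 <= k.+1`!%:R * E.
  rewrite mulrC -ler_pdivrMr //; apply: le_trans H.
  by rewrite lerDr.
have -> : s^-1 ^+ k = s * s^-1 ^+ k.+1.
  by rewrite exprS mulrA divff ?mul1r ?gt_eqF.
by rewrite -mulrA mulrCA ler_pM2l.
Qed.

Lemma flat_is_derive k (s : R) :
  is_derive s 1 (flat k) (flat k.+2 s - k%:R * flat k.+1 s).
Proof.
have [s0|s0|->] := ltgtP s 0.
- have E : \forall y \near s, 0 = flat k y.
    have n : \forall y \near s, y < 0 by apply: (@cvgr_lt R R (nbhs s) _ id s cvg_id).
    by apply: filterS n => y y0; rewrite /flat ltNge (ltW y0).
  rewrite /flat !ltNge (ltW s0) /= mulr0 subr0.
  by apply: (@near_eq_is_derive _ R R (cst 0)) => //; exact: is_derive_cst.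
- have E : \forall y \near s, y^-1 ^+ k * expR (- y^-1) = flat k y.
    have n : \forall y \near s, 0 < y by apply: (@cvgr_gt R R (nbhs s) _ id s cvg_id).
    by apply: filterS n => y y0; rewrite /flat y0.
  apply: near_eq_is_derive E _.
  have dinv : is_derive s 1 (fun y : R => y^-1) (- s^-1 ^+ 2).
    have dI : differentiable (GRing.inv : R -> R) s.
      by apply: differentiable_Rinv; rewrite gt_eqF.
    split; first exact: diff_derivable.
    rewrite deriveE // diff_Rinv ?gt_eqF //.
    by rewrite -[LHS]/(_ * _) mulr1 exprVn.
  have dX := @is_deriveX R R (fun y : R => y^-1) k s 1 _ dinv.
  have dN := @is_deriveN R R R (fun y : R => y^-1) s 1 _ dinv.
  have dE : is_derive s 1 (fun y : R => expR (- y^-1)) (s^-1 ^+ 2 * expR (- s^-1)).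
    have := @is_derive1_comp R expR (fun y : R => - y^-1) s _ _ (is_derive_expR (- s^-1)) dN.
    by rewrite opprK mulrC.
  have EX : (fun y : R => y^-1) ^+ k = (fun y => y^-1 ^+ k).
    by apply/funext => y; rewrite exprfctE.
  rewrite EX in dX; have dM := is_deriveM dX dE.
  have EM : (fun y : R => y^-1 ^+ k) * (fun y => expR (- y^-1))
    = (fun y => y^-1 ^+ k * expR (- y^-1)) by [].
  rewrite EM in dM; apply: (is_derive_eq dM).
  rewrite /flat s0 -![_ *: _]/(_ * _).
  case: k {dX EX dM EM} => [|k] /=.
    by rewrite !expr0 mul0r !mul0r !mulr0 addr0 subr0 mul1r.
  by rewrite !exprS; ring.
- rewrite /flat ltxx mulr0 subr0.
  have H : (fun h : R => h^-1 *: (flat k (h *: 1 + 0) - flat k 0)) @ 0^' --> (0 : R).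
    apply/cvgr0Pnorm_lt => e e0.
    have F0 : 0 < k.+2`!%:R :> R by rewrite ltr0n fact_gt0.
    have n1 : \forall h \near (0:R)^', `|h| < e / k.+2`!%:R.
      apply: cvg_within; apply/nbhs_normP; exists (e / k.+2`!%:R); first by rewrite /= divr_gt0.
      by move=> h /=; rewrite sub0r normrN.
    apply: filterS n1 => h hn.
    (* The difference quotient of [flat k] at 0 is [flat k.+1], which tends to 0. *)
    have -> : h^-1 *: (flat k (h *: 1 + 0) - flat k 0) = flat k.+1 h.
      rewrite [_%:A]mulr1 addr0 /flat ltxx subr0 -[_ *: _]/(_ * _).
      by case: ifP => _; rewrite ?mulr0 // mulrA exprS.
    rewrite ger0_norm ?flat_ge0 //; apply: le_lt_trans (flat_le _ _) _.
    by rewrite mulrC -ltr_pdivlMr.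
  split; first by apply/cvg_ex; exists 0; exact: H.
  by apply/cvg_lim => //; exact: H.
Unshelve. all: by end_near. Qed.

Lemma sm_flat k (s : R) : sm (flat k) s.
Proof.
have df k' y : differentiable (flat k') y.
  by apply/derivable1_diffP; have [] := flat_is_derive k' y.
move=> j; elim: j k => [|j IH] k.
  by near=> y; exact: differentiable_continuous.
split; first by near=> y; exact: df.
move=> v.
have := Cn_scale (Cn_cst j v s) (Cn_D (IH k.+2) (Cn_scale (W := R^o) (Cn_cst j (- k%:R : R) s) (IH k.+1))).
apply: Cn_ext; near=> y.
rewrite -[v in RHS]mulr1 -[v * 1]/(v *: 1) deriveZv //.
have dk := flat_is_derive k y; rewrite (@derive_val _ _ _ _ _ _ _ dk).
by rewrite scaleNr.
Unshelve. all: by end_near. Qed.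

Lemma flat0_homo : {homo flat 0 : u v / u <= v}.
Proof.
move=> u v uv; rewrite /flat; case: ifP => [u0|_]; last first.
  by have := flat_ge0 0 v; rewrite /flat.
have v0 := lt_le_trans u0 uv; rewrite v0 !expr0 !mul1r ler_expR lerN2.
by rewrite lef_pV2.
Qed.

Definition step (s : R) : R := flat 0 (s - 1) / (flat 0 (s - 1) + flat 0 (2 - s)).

Lemma step_den s : 0 < flat 0 (s - 1) + flat 0 (2 - s).
Proof.
have [s1|s1] := ltP 1 s.
  by rewrite ltr_wpDr ?flat_ge0 // flat_gt0 // subr_gt0.
by rewrite ltr_wpDl ?flat_ge0 // flat_gt0 // subr_gt0 (le_lt_trans s1) // ltr1n.
Qed.

Lemma step0 s : s <= 1 -> step s = 0.
Proof. by move=> s1; rewrite /step {1}/flat subr_gt0 ltNge s1 mul0r. Qed.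

Lemma step1 s : 2 <= s -> step s = 1.
Proof.
move=> s2; have := step_den s; rewrite /step.
have -> : flat 0 (2 - s) = 0 by rewrite /flat subr_gt0 ltNge s2.
by rewrite addr0 => d; rewrite divff // gt_eqF.
Qed.

Lemma step_ge0 s : 0 <= step s.
Proof. by rewrite divr_ge0 ?flat_ge0 // ltW // step_den. Qed.

Lemma step_le1 s : step s <= 1.
Proof. by rewrite ler_pdivrMr ?step_den // mul1r lerDl flat_ge0. Qed.

Lemma step_homo : {homo step : u v / u <= v}.
Proof.
move=> u v uv; rewrite /step ler_pdivrMr ?step_den // mulrAC ler_pdivlMr ?step_den //.
have A : flat 0 (u - 1) <= flat 0 (v - 1) by apply: flat0_homo; rewrite lerD2r.
have B : flat 0 (2 - v) <= flat 0 (2 - u) by apply: flat0_homo; rewrite lerD2l lerN2.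
have H := ler_pM (flat_ge0 0 _) (flat_ge0 0 _) A B.
by rewrite mulrDr [leRHS]mulrDr [X in _ <= X + _]mulrC lerD2l.
Qed.

Lemma sm_step (s : R) : sm step s.
Proof.
have s1 : sm (fun y : R => flat 0 (y - 1)) s.
  apply: (sm_comp (g := flat 0)); [exact: findimR| |exact: sm_flat].
  by apply: sm_sub; [exact: sm_id|exact: sm_cst].
apply: sm_div => //; last by rewrite gt_eqF // step_den.
apply: sm_add => //.
apply: (sm_comp (g := flat 0)); [exact: findimR| |exact: sm_flat].
by apply: sm_sub; [exact: sm_cst|exact: sm_id].
Qed.

Lemma step_primitive : exists G : R -> R,
  (forall s : R, is_derive s 1 G (step s)) /\ forall s, s <= 1 -> G s = 0.
Proof.
(* For [x < 0] the interval is empty and the integral is 0; this is still the primitive, because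
   [step] vanishes up to 1. *)
pose G (x : R) := (\int[@lebesgue_measure R]_(t in [set` `[(0:R), x]]) (step t))%R.
have G0 s : s <= 1 -> G s = 0.
  move=> s1; rewrite /G (@eq_Rintegral _ _ _ _ _ (cst 0)); last first.
    move=> t; rewrite inE /= in_itv /= => /andP[_ ts].
    by rewrite step0 // (le_trans ts).
  by rewrite /Rintegral /= integral0.
exists G; split => // s; have [s1|s1] := ltP s 1.
  have -> : step s = 0 by rewrite step0 // ltW.
  have n : \forall y \near s, y < 1 by apply: (@cvgr_lt R R (nbhs s) _ id s cvg_id).
  have E : \forall y \near s, 0 = G y by apply: filterS n => y y1; rewrite G0 // ltW.
  by apply: (@near_eq_is_derive _ R R (cst 0)) => //; exact: is_derive_cst.
have ss1 : s < s + 1 by rewrite ltrDl.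
have [] := @continuous_FTC1_closed R step 0 s (s + 1) ss1.
- apply: continuous_compact_integrable; first exact: segment_compact.
  by apply: continuous_subspaceT => y; apply: sm_cont; exact: sm_step.
- exact: lt_le_trans ltr01 s1.
- by apply: sm_cont; exact: sm_step.
move=> dG EG; apply: DeriveDef; first exact: dG.
by rewrite -derive1E; exact: EG.
Unshelve. all: by end_near. Qed.

(* [u, w |-> w * m (u / w)] is a smooth convex substitute for [max u w]. *)
Lemma smooth_max_profile : exists m : R -> R,
  [/\ forall s : R, sm m s,
      (forall s : R, s <= 1 -> m s = m 0) /\ (forall s, 2 <= s -> m s = s),
      forall s, 0 < m s /\ (s <= 2 -> m s <= 2),
      forall s : R, 0 <= s -> 0 <= 'D_1 m s /\ 0 <= m s - s * 'D_1 m s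
    & forall s : R, 0 <= 'D_1 (fun y => 'D_1 m y) s].
Proof.
have [G [dG G0]] := step_primitive.
(* The constant makes [m 2 = 2]; as the slope is 1 from 2 on, [m] is the identity there. *)
pose m s := G s + (2 - G 2).
have dm (s : R) : is_derive s 1 m (step s).
  by rewrite -[step s]addr0; apply: (is_deriveD (dG s)); exact: is_derive_cst.
have Dm : (fun y => 'D_1 m y) = step.
  by apply/funext => s; rewrite (@derive_val _ _ _ _ _ _ _ (dm s)).
have m2 : m 2 = 2 by rewrite /m addrC subrK.
(* The slope is at most 1, so [m] lies above the identity to the left of 2. In particular
   [m 1 >= 1], which makes [m] positive everywhere. *)
have mle s : s <= 2 -> s <= m s /\ m s <= 2.
  move=> s2; have [c _] := mvt_global dm s2.
  rewrite m2 => E; have := step_ge0 c; have := step_le1 c.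
  move: E s2; clear; nra.
have m1 s : s <= 1 -> m s = m 0 by move=> s1; rewrite /m (G0 s s1) (G0 0 ler01).
have m11 : 1 <= m 1 by apply: (mle 1 _).1; rewrite ler1n.
exists m; split.
- move=> s; case=> [|k].
    near=> y; apply: differentiable_continuous; apply/derivable1_diffP.
    by have [] := dm y.
  split; first by near=> y; apply/derivable1_diffP; have [] := dm y.
  move=> v; have := Cn_scale (Cn_cst k v s) (sm_step (s : R) k); apply: Cn_ext.
  near=> y; rewrite -[v in RHS]mulr1 -[v * 1]/(v *: 1) deriveZv.
    by rewrite (@derive_val _ _ _ _ _ _ _ (dm y)).
  by apply/derivable1_diffP; have [] := dm y.
- split => // s s2; have [c /andP[c2 _]] := mvt_global dm s2.
  by rewrite m2 step1 // mul1r; lra.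
- move=> s; split; last by move=> /mle[].
  have [s1|s1] := leP s 1; first by rewrite m1 // -(m1 1) // (lt_le_trans _ m11).
  have [c _] := mvt_global dm (ltW s1).
  have := step_ge0 c; move: s1 m11; clear; nra.
- move=> s s0; rewrite (congr1 (fun h => h s) Dm); split; first exact: step_ge0.
  have [s2|s2] := leP s 2.
    have [H _] := mle _ s2; have := step_le1 s; move: H s0; clear; nra.
  have [c /andP[c2 _]] := mvt_global dm (ltW s2).
  rewrite m2 (step1 c2) (step1 (ltW s2)); lra.
- move=> s; rewrite Dm; apply: nondecreasing_derive_ge0; first exact: step_homo.
  by apply/diff_derivable/sm_diff; exact: sm_step.
Unshelve. all: by end_near. Qed.

End Profile.

(** * Signature of a Lorentzian form *)

Section Index.
Context {R : realType} {n : nat}.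
Variable g : 'rV[R]_n -> 'rV[R]_n -> R.
Hypothesis gl : forall a u v x, g (a *: u + v) x = a * g u x + g v x.
Hypothesis gs : forall u v, g u v = g v u.

Let g0 x : g 0 x = 0.
Proof. by have := gl 1 0 0 x; rewrite scale1r addr0 mul1r => /eqP; rewrite addrC -subr_eq subrr => /eqP <-. Qed.

Let gZ a u x : g (a *: u) x = a * g u x.
Proof. by have := gl a u 0 x; rewrite addr0 g0 addr0. Qed.

Let gD u v x : g (u + v) x = g u x + g v x.
Proof. by have := gl 1 u v x; rewrite scale1r mul1r. Qed.

Let gsum k (F : 'I_k -> 'rV[R]_n) x : g (\sum_i F i) x = \sum_i g (F i) x.
Proof.
elim: k F => [|k IH] F; first by rewrite !big_ord0 g0.
by rewrite !big_ord_recr /= gD IH.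
Qed.

Lemma form_orthogonal_vector k (e : nat -> 'rV[R]_n) : (k < n)%N ->
  exists2 u, u != 0 & forall i, (i < k)%N -> g u (e i) = 0.
Proof.
move=> kn; pose B := \matrix_(a < n, i < k) g (delta_mx 0 a) (e i).
have K0 : kermx B != 0.
  rewrite -mxrank_eq0 mxrank_ker subn_eq0 -ltnNge.
  by apply: leq_ltn_trans kn; exact: rank_leq_col.
have /rowV0Pn[i /sub_kermxP uB u0] := K0.
exists i => // j jk; have := congr1 (fun M : 'rV_k => M 0 (Ordinal jk)) uB.
rewrite !mxE => <-; rewrite {1}(row_sum_delta i) gsum; apply: eq_bigr => a _.
by rewrite gZ !mxE.
Qed.

Definition lorentz_sign (i j : nat) : R :=
  if i != j then 0 else if i == 0%N then 1 else -1.

(** Orthonormalisation starting from [w]. Every non-zero vector orthogonal to the first one is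
    automatically negative, by negativity on the hyperplane [om = 0], so each further vector can be
    normalised to -1. *)
Lemma lorentz_index (om : 'rV[R]_n -> R) w :
  (0 < n)%N ->
  (forall a u v, om (a *: u + v) = a * om u + om v) ->
  (forall u, u != 0 -> om u = 0 -> g u u < 0) ->
  0 < g w w -> index_n_minus_1 g.
Proof.
move=> n0 oml gneg gw.
have om0 : om 0 = 0.
  by have := oml 1 0 0; rewrite scale1r addr0 mul1r => /eqP; rewrite addrC -subr_eq subrr => /eqP <-.
have omZ a u : om (a *: u) = a * om u by have := oml a u 0; rewrite addr0 om0 addr0.
have [e He] : exists e : nat -> 'rV[R]_n, forall i j, (i < n)%N -> (j < n)%N ->
    g (e i) (e j) = lorentz_sign i j.
  suff H k : (k < n)%N -> exists e : nat -> 'rV[R]_n,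
      forall i j, (i <= k)%N -> (j <= k)%N -> g (e i) (e j) = lorentz_sign i j.
    have [|e He] := H n.-1; first by rewrite prednK.
    by exists e => i j ilt jlt; apply: He; rewrite -ltnS prednK.
  elim: k => [|k IH] kn.
    exists (fun=> (Num.sqrt (g w w))^-1 *: w) => i j.
    rewrite !leqn0 => /eqP-> /eqP->.
    rewrite /lorentz_sign /= gZ gs gZ mulrA -invfM -expr2 sqr_sqrtr ?mulVf ?gt_eqF //.
    exact: ltW.
  have [e He] := IH (ltnW kn).
  have [u u0 Hu] := form_orthogonal_vector e kn.
  have e00 : g (e 0%N) (e 0%N) = 1 by rewrite He.
  have ue0 : g u (e 0%N) = 0 by rewrite Hu.
  have ome0 : om (e 0%N) != 0.
    apply/negP => /eqP o0; have ne0 : e 0%N != 0.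
      by apply/eqP => E; move: e00; rewrite E g0 => /eqP; rewrite eq_sym oner_eq0.
    by have := gneg _ ne0 o0; rewrite e00 ltNge ler01.
  have gu : g u u < 0.
    (* This combination lies in the kernel of [om], and [g x x] is a positive multiple of [g u u]
       plus a square. *)
    pose x := om (e 0%N) *: u - om u *: e 0%N.
    have omx : om x = 0.
      by rewrite /x oml -scaleNr omZ mulrC mulNr subrr.
    have gxe : g x (e 0%N) = - om u.
      by rewrite /x gD -scaleNr !gZ ue0 mulr0 add0r e00 mulr1.
    have gxu : g x u = om (e 0%N) * g u u.
      by rewrite /x gD -scaleNr !gZ [g (e _) u]gs ue0 mulr0 addr0.
    have gxx : g x x = om (e 0%N) ^+ 2 * g u u + om u ^+ 2.
      rewrite {1}/x gD -scaleNr !gZ [g u x]gs [g (e _) x]gs gxe gxu.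
      by rewrite mulrA -expr2 mulrNN -expr2.
    have xn0 : x != 0.
      apply/negP => /eqP x0; move: gxe; rewrite x0 g0 => /eqP.
      rewrite eq_sym oppr_eq0 => /eqP ou; move: x0.
      rewrite /x ou scale0r subr0 => /eqP; rewrite scaler_eq0 (negbTE ome0) /=.
      by rewrite (negbTE u0).
    have := gneg _ xn0 omx; rewrite gxx => H.
    have H2 : om (e 0%N) ^+ 2 * g u u < 0.
      by apply: le_lt_trans H; rewrite lerDl sqr_ge0.
    by rewrite -(pmulr_rlt0 _ (_ : 0 < om (e 0%N) ^+ 2)) // exprn_even_gt0.
  pose u' := (Num.sqrt (- g u u))^-1 *: u.
  have gu' : g u' u' = -1.
    rewrite /u' gZ gs gZ mulrA -invfM -expr2 sqr_sqrtr ?oppr_ge0 ?(ltW gu) //.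
    by rewrite invrN mulNr mulVf // lt_eqF.
  have gu'e i : (i <= k)%N -> g u' (e i) = 0.
    by move=> ik; rewrite /u' gZ Hu ?mulr0.
  exists (fun i => if (i <= k)%N then e i else u') => i j.
  rewrite [(i <= k.+1)%N]leq_eqVlt [(j <= k.+1)%N]leq_eqVlt !ltnS.
  move=> /orP[/eqP ->|ik] /orP[/eqP ->|jk].
  - by rewrite ltnn /lorentz_sign eqxx.
  - rewrite ltnn jk gu'e // /lorentz_sign ifT //.
    by apply/eqP => E; rewrite -E ltnn in jk.
  - rewrite ltnn ik gs gu'e // /lorentz_sign ifT //.
    by apply/eqP => E; rewrite E ltnn in ik.
  - by rewrite ik jk He.
pose E := \matrix_(i < n) e i.
exists E; last first.
  by move=> i j; rewrite !rowK He // /lorentz_sign.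
(* Pairing a vanishing combination of the rows with each row kills its coefficients. *)
rewrite -row_free_unit -kermx_eq0; apply/eqP/row_matrixP => a.
rewrite row0; set c := row a _.
have cE : c *m E = 0 by rewrite /c -row_mul mulmx_ker row0.
apply/rowP => j; rewrite [RHS]mxE.
have : g (c *m E) (e j) = 0 by rewrite cE g0.
rewrite mulmx_sum_row gsum (bigD1 j) //= big1 ?addr0; last first.
  move=> i ij; rewrite rowK gZ He // /lorentz_sign ifT ?mulr0 //.
rewrite rowK gZ He // /lorentz_sign eqxx /=.
by case: ifP => _; rewrite ?mulr1 // mulrN1 => /eqP; rewrite oppr_eq0 => /eqP.
Qed.

End Index.

(** * Convex cones *)

Section Cones.
Context {R : realType} {V : normedModType R}.
Implicit Types (A C : set V) (u v w z : V).

(* What is left of [is_cone] once the smooth structure is forgotten. *)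
Definition weak_cone C A : Prop :=
  [/\ open A, ~ A 0,
      forall u v (t : R), 0 <= t <= 1 -> A u -> A v -> A (t *: u + (1 - t) *: v),
      C = (closure A `\` A) `\ 0
    & [/\ forall v (a : R), C v -> 0 < a -> C (a *: v),
          forall v, C v -> ~ C (- v) & C !=set0]].

Lemma is_cone_weak C A : is_cone C A -> weak_cone C A.
Proof.
move=> [[C0 _] _ [Cs Ca] [oA A0 cA CE] _]; split => //.
  move=> u v t t01 Au Av.
  pose t' : {i01 R} := Itv01 (andP t01).1 (andP t01).2.
  have := cA u v t'; rewrite !inE => /(_ Au Av).
  by [].
by rewrite CE (interior_id _).1.
Qed.

Lemma nbhs_line x d (P : set V) : nbhs x P ->
  exists2 e : R, 0 < e & forall t : R, `|t| < e -> P (x + t *: d).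
Proof.
move=> xP; have c : {for (0 : R), continuous (fun t : R => x + t *: d)}.
  by apply: sm_cont; apply: sm_add; [exact: sm_cst|apply: sm_scale; [exact: sm_id|exact: sm_cst]].
have : \forall t \near (0 : R), P (x + t *: d) by apply: c; rewrite scale0r addr0.
move=> /nbhs_normP[e /= e0 H]; exists e => // t te.
by apply: H; rewrite /= sub0r normrN.
Qed.

(** The point is reached at the supremum of the times up to which the segment stays in [A]; openness
    keeps it out of [A]. *)
Lemma boundary_on_segment A x d : open A -> A x -> ~ A (x + d) ->
  exists t : R, [/\ 0 < t <= 1, ~ A (x + t *: d), closure A (x + t *: d)
    & forall s, 0 <= s < t -> A (x + s *: d)].
Proof.
move=> oA Ax NA.
pose T := [set t : R | 0 <= t /\ forall s, 0 <= s <= t -> A (x + s *: d)].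
have T0 : T 0.
  split=> // s; rewrite -eq_le => /eqP <-.
  by rewrite scale0r addr0.
have T1 : ubound T 1.
  move=> t [t0 Ht]; rewrite leNgt; apply/negP => t1; apply: NA.
  by rewrite -[d]scale1r; apply: Ht; rewrite ler01 ltW.
have hT : has_sup T by split; [exists 0|exists 1].
have s0 : 0 <= sup T by apply: ub_le_sup T0; exact: hT.2.
have s1 : sup T <= 1 by apply: ge_sup => //; exists 0.
have below s : 0 <= s < sup T -> A (x + s *: d).
  move=> /andP[s0' sT]; have [t [t0 Ht] st] := sup_gt hT.1 sT.
  by apply: Ht; rewrite s0' ltW.
have NAs : ~ A (x + sup T *: d).
  move=> As; have [e e0 He] := nbhs_line d (open_nbhs_nbhs (conj oA As)).
  have : T (sup T + e / 2).
    split; first by rewrite addr_ge0 // ltW // divr_gt0.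
    move=> s /andP[s0' se]; have [sT|sT] := ltP s (sup T).
      by apply: below; rewrite s0'.
    have -> : x + s *: d = x + sup T *: d + (s - sup T) *: d.
      by rewrite -addrA -scalerDl [sup T + _]addrC subrK.
    apply: He; rewrite ger0_norm ?subr_ge0 // ltrBlDl.
    by apply: le_lt_trans se _; rewrite ltrD2l ltr_pdivrMr // ltr_pMr // ltr1n.
  move=> /(ub_le_sup hT.2); rewrite gerDl leNgt divr_gt0 //.
have sp : 0 < sup T.
  rewrite lt_neqAle s0 andbT; apply/eqP => E; apply: NAs.
  by rewrite -E scale0r addr0.
exists (sup T); split => //; first by rewrite sp.
move=> B /(nbhs_line d)[e e0 He].
pose s := Num.max 0 (sup T - e / 2).
have sT : 0 <= s < sup T.
  by rewrite /s le_max lexx /= gt_max sp ltrBlDr ltrDl divr_gt0.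
exists (x + s *: d); split; first exact: below.
have -> : x + s *: d = x + sup T *: d + (s - sup T) *: d.
  by rewrite -addrA -scalerDl [sup T + _]addrC subrK.
apply: He; rewrite ltr0_norm ?subr_lt0; last by case/andP: sT.
have h : sup T - e / 2 <= s by rewrite /s le_max lexx orbT.
by rewrite opprB; move: e0 h; clear; lra.
Qed.

Section Weak.
Variables C A : set V.
Hypothesis wc : weak_cone C A.

Let oA : open A. Proof. by case: wc. Qed.
Let A0 : ~ A 0. Proof. by case: wc. Qed.
Let cA u v (t : R) : 0 <= t <= 1 -> A u -> A v -> A (t *: u + (1 - t) *: v).
Proof. by case: wc => _ _ + _ _; exact. Qed.
Let CE : C = (closure A `\` A) `\ 0. Proof. by case: wc. Qed.
Let Cs v (a : R) : C v -> 0 < a -> C (a *: v).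
Proof. by case: wc => _ _ _ _ [+ _ _]; exact. Qed.
Let Ca v : C v -> ~ C (- v). Proof. by case: wc => _ _ _ _ [_ + _]; exact. Qed.

Lemma weak_cone_C v : C v <-> [/\ closure A v, ~ A v & v <> 0].
Proof. by rewrite CE; split=> [[[]]|[]]. Qed.

Lemma weak_cone_open : open A. Proof. exact: oA. Qed.

(** Replace [c] by a nearby point of [A] and shift [a] to compensate; the shifted [a] stays in the
    open set [A]. *)
Lemma weak_cone_mix a c (t : R) : A a -> closure A c -> 0 < t <= 1 ->
  A (t *: a + (1 - t) *: c).
Proof.
move=> Aa Ac /andP[t0 t1].
have f : {for c, continuous (fun c' : V => a + ((1 - t) / t) *: (c - c'))}.
  apply: sm_cont; apply: sm_add; first exact: sm_cst.
  by apply: sm_scale; [exact: sm_cst|apply: sm_sub; [exact: sm_cst|exact: sm_id]].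
have n : \forall c' \near c, A (a + ((1 - t) / t) *: (c - c')).
  by apply: f; rewrite subrr scaler0 addr0; exact: open_nbhs_nbhs.
have [c' [Ac' Aa']] := Ac _ n.
have := cA (t := t) _ Aa' Ac'; rewrite (ltW t0) t1 => /(_ isT).
rewrite scalerDr scalerA mulrC divfK ?gt_eqF // scalerBr.
by rewrite addrA subrK.
Qed.

Lemma weak_cone_nonempty : A !=set0.
Proof.
have [c /weak_cone_C[cc _ _]] : C !=set0 by case: wc => _ _ _ _ [].
by have [a [Aa _]] := cc setT filterT; exists a.
Qed.

(** Prolong the segment from a point [a] of [A] slightly beyond [z]: its end is still in the
    closure, and [z] is a mixture of the two with positive weight on [a]. *)
Lemma weak_cone_interior z : nbhs z (closure A) -> A z.
Proof.
move=> nz; have [a Aa] := weak_cone_nonempty.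
have [e e0 He] := nbhs_line (z - a) nz.
pose s := e / 2; have s0 : 0 < s by rewrite divr_gt0.
have cz : closure A (z + s *: (z - a)).
  by apply: He; rewrite gtr0_norm // ltr_pdivrMr // ltr_pMr // ltr1n.
have p0 : 0 < 1 + s by rewrite addr_gt0.
have := weak_cone_mix (t := s / (1 + s)) Aa cz.
rewrite divr_gt0 //= ler_pdivrMr // mul1r lerDr ler01 => /(_ isT).
have -> : 1 - s / (1 + s) = (1 + s)^-1 by field; rewrite gt_eqF.
rewrite mulrC -scalerA -scalerDr [s *: a + _]addrC -addrA -scalerDr subrK.
by rewrite -{1}[z]scale1r -scalerDl scalerA mulVf ?scale1r // gt_eqF.
Qed.

(** Only [C] is assumed invariant under scaling. If [a *: v] were outside [A], the segment from [v]
    to it would meet the boundary at a positive multiple of [v], and scaling back would put [v] on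
    [C]. *)
Lemma weak_cone_scale v (a : R) : A v -> 0 < a -> A (a *: v).
Proof.
move=> Av a0; apply: contrapT => NA.
have v0 : v <> 0 by move=> v0; apply: A0; rewrite -v0.
have [|t [/andP[t0 t1] Nt ct _]] := @boundary_on_segment A v (a *: v - v) oA Av.
  by rewrite addrC subrK.
have E : v + t *: (a *: v - v) = (1 + t * (a - 1)) *: v.
  by rewrite scalerDl scale1r scalerBr scalerA mulrBr mulr1 scalerBl.
rewrite E in Nt ct.
have k0 : 0 < 1 + t * (a - 1).
  have -> : 1 + t * (a - 1) = t * a + (1 - t) by ring.
  by rewrite ltr_pwDl ?mulr_gt0 // subr_ge0.
have : C ((1 + t * (a - 1)) *: v).
  apply/weak_cone_C; split => //; apply/eqP; rewrite scaler_eq0 gt_eqF //=.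
  exact/eqP.
move=> /(Cs (a := (1 + t * (a - 1))^-1)); rewrite invr_gt0 => /(_ k0).
by rewrite scalerA mulVf ?gt_eqF // scale1r => /weak_cone_C[].
Qed.

Lemma weak_cone_add u v : A u -> closure A v -> A (u + v).
Proof.
move=> Au cv.
have h1 : 0 < 2^-1 :> R by rewrite invr_gt0.
have h2 : 2^-1 <= 1 :> R by rewrite invf_le1 // ler1n.
have := weak_cone_mix (t := 2^-1) Au cv; rewrite h1 h2 => /(_ isT) Am.
have := weak_cone_scale Am (ltr0n R 2).
rewrite scalerDr !scalerA mulfV // scale1r.
have -> : 2%:R * (1 - 2^-1) = 1 :> R by field.
by rewrite scale1r.
Qed.

Lemma weak_cone_closureP a z : A a ->
  closure A z <-> forall e : R, 0 < e -> A (z + e *: a).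
Proof.
move=> Aa; split=> [cz e e0|H B /(nbhs_line a)[e e0 He]].
  by rewrite addrC; apply: weak_cone_add => //; exact: weak_cone_scale.
have e2 : 0 < e / 2 by rewrite divr_gt0.
exists (z + (e / 2) *: a); split; first exact: H.
by apply: He; rewrite gtr0_norm // ltr_pdivrMr // ltr_pMr // ltr1n.
Qed.

Lemma weak_cone_closureD u v : closure A u -> closure A v -> closure A (u + v).
Proof.
have [a Aa] := weak_cone_nonempty.
move=> cu /(weak_cone_closureP _ Aa) cv; apply/(weak_cone_closureP _ Aa) => e e0.
by rewrite -addrA addrC; apply: weak_cone_add => //; exact: cv.
Qed.

Lemma weak_cone_closureZ v (a : R) : closure A v -> 0 < a -> closure A (a *: v).
Proof.
have [b Ab] := weak_cone_nonempty.
move=> /(weak_cone_closureP _ Ab) cv a0; apply/(weak_cone_closureP _ Ab) => e e0.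
have := weak_cone_scale (cv (e / a) (divr_gt0 e0 a0)) a0.
by rewrite scalerDr scalerA mulrC divfK // gt_eqF.
Qed.

Lemma weak_cone_opp v : A v -> ~ closure A (- v).
Proof. by move=> Av /(weak_cone_add Av); rewrite subrr. Qed.

Lemma weak_cone_pointed v : closure A v -> closure A (- v) -> v = 0.
Proof.
move=> cv cNv; apply: contrapT => v0.
have [Av|NAv] := pselect (A v); first exact: weak_cone_opp cNv.
have [ANv|NANv] := pselect (A (- v)).
  by apply: (weak_cone_opp ANv); rewrite opprK.
apply: (@Ca v); apply/weak_cone_C; split => //.
by move=> /eqP; rewrite oppr_eq0 => /eqP.
Qed.

(* Near a boundary point [c] there are points outside the closed cone, and their
   opposites stay near [- c], which is outside too. *)
Lemma weak_cone_transversal : exists u, ~ closure A u /\ ~ closure A (- u).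
Proof.
have [c Cc] : C !=set0 by case: wc => _ _ _ _ [].
have [cc NAc c0] := (weak_cone_C c).1 Cc.
have cNc : ~ closure A (- c) by move=> /(weak_cone_pointed cc).
have n : nbhs c [set u | ~ closure A (- u)].
  have on : open (~` closure A) by apply: closed_openC; exact: closed_closure.
  have f : {for c, continuous (fun u : V => - u)}.
    by apply: sm_cont; apply: sm_opp; exact: sm_id.
  exact: (f _ (open_nbhs_nbhs (conj on cNc))).
apply: contrapT => H; apply: NAc; apply: weak_cone_interior.
apply: filterS n => u Nu; apply: contrapT => Ncu; apply: H.
by exists u.
Qed.

Lemma weak_cone_exit v u : A v -> ~ closure A u ->
  exists s : R, [/\ 0 < s, closure A (v + s *: u) & ~ A (v + s *: u)].
Proof.
move=> Av Nu.
have [e e0 He] : exists2 e : R, 0 < e & ~ A (u + e *: v).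
  apply: contrapT => H; apply: Nu; apply/(weak_cone_closureP _ Av) => e e0.
  by apply: contrapT => NA; apply: H; exists e.
have NA : ~ A (v + e^-1 *: u).
  move=> /weak_cone_scale/(_ e0); rewrite scalerDr scalerA mulfV ?gt_eqF // scale1r.
  by rewrite addrC.
have [t [/andP[t0 t1] Nt ct _]] := boundary_on_segment oA Av NA.
by exists (t * e^-1); rewrite -scalerA; split; rewrite // mulr_gt0 // invr_gt0.
Qed.

Lemma weak_cone_exit_C v u : A v -> ~ closure A u -> ~ closure A (- u) ->
  exists2 s : R, 0 < s & C (v + s *: u).
Proof.
move=> Av Nu NNu; have [s [s0 cs Ns]] := weak_cone_exit Av Nu.
exists s => //; apply/weak_cone_C; split => // E; apply: NNu.
have -> : - u = s^-1 *: v.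
  have -> : v = - (s *: u) by apply/eqP; rewrite -addr_eq0 E.
  by rewrite scalerN scalerA mulVf ?scale1r // gt_eqF.
by apply: subset_closure; apply: weak_cone_scale; rewrite // invr_gt0.
Qed.

(** Far along [T] the line is inside, its direction from the origin being close to [T]; backwards it
    leaves, as [- T] is outside the closed cone. Since [A] plus its closure lies in [A], the line
    stays inside once it has entered. *)
Lemma weak_cone_line T v : A T -> (forall a : R, v <> a *: T) ->
  exists t : R, [/\ C (v + t *: T), forall s, A (v + s *: T) <-> t < s
    & forall s, closure A (v + s *: T) <-> t <= s].
Proof.
move=> AT vT.
have [e e0 He] := nbhs_line v (open_nbhs_nbhs (conj oA AT)).
have e2 : 0 < e / 2 by rewrite divr_gt0.
have As1 : A (v + (e / 2)^-1 *: T).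
  have -> : v + (e / 2)^-1 *: T = (e / 2)^-1 *: (T + (e / 2) *: v).
    by rewrite scalerDr scalerA mulVf ?scale1r ?gt_eqF // addrC.
  apply: weak_cone_scale; last by rewrite invr_gt0.
  by apply: He; rewrite gtr0_norm // ltr_pdivrMr // ltr_pMr // ltr1n.
have [s [s0 cs Ns]] := weak_cone_exit As1 (weak_cone_opp AT).
pose t := (e / 2)^-1 - s.
have E : v + (e / 2)^-1 *: T + s *: - T = v + t *: T.
  by rewrite /t scalerBl scalerN addrA.
rewrite E in cs Ns.
have up r : t < r -> A (v + r *: T).
  move=> tr; have -> : v + r *: T = (r - t) *: T + (v + t *: T).
    by rewrite addrCA -scalerDl subrK.
  by apply: weak_cone_add => //; apply: weak_cone_scale => //; rewrite subr_gt0.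
have dn r : closure A (v + r *: T) -> t <= r.
  move=> cr; rewrite leNgt; apply/negP => rt; apply: Ns.
  have -> : v + t *: T = (t - r) *: T + (v + r *: T).
    by rewrite addrCA -scalerDl subrK.
  by apply: weak_cone_add => //; apply: weak_cone_scale => //; rewrite subr_gt0.
exists t; split.
- apply/weak_cone_C; split => // E0; apply: (vT (- t)).
  by apply/eqP; rewrite scaleNr -addr_eq0 E0.
- move=> r; split; last exact: up.
  move=> Ar; rewrite lt_neqAle; apply/andP; split.
    by apply/eqP => tr; apply: Ns; rewrite tr.
  by apply: dn; exact: subset_closure.
- move=> r; split; first exact: dn.
  by rewrite le_eqVlt => /orP[/eqP <- //|/up]; exact: subset_closure.
Qed.

Lemma weak_cone_C_line T v : A T -> C v -> forall a : R, v <> a *: T.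
Proof.
move=> AT /weak_cone_C[cv Nv v0] a E; have [a0|a0|a0] := ltgtP a 0.
- apply: (weak_cone_opp (v := T)) => //.
  have -> : - T = (- a)^-1 *: v.
    by rewrite E scalerA invrN mulNr mulVf ?scaleN1r // lt_eqF.
  by apply: weak_cone_closureZ => //; rewrite invr_gt0 oppr_gt0.
- by apply: Nv; rewrite E; exact: weak_cone_scale.
- by apply: v0; rewrite E a0 scale0r.
Qed.

Lemma weak_cone_C_closure v : C v -> closure A v.
Proof. by move=> /weak_cone_C[]. Qed.

End Weak.

(** [C] lies in the closure of [A'], and along a direction that leaves the closed cone both ways
    every point of [A] is between two points of [C]. The lemma reconciles [cone_domain], which
    quantifies over interiors, with one chosen interior per fibre. *)
Lemma weak_cone_interior_unique C A A' : weak_cone C A -> weak_cone C A' -> A `<=` A'.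
Proof.
move=> wA wA' v Av.
have [u [Nu NNu]] := weak_cone_transversal wA.
have cv w : A w -> closure A' w.
  move=> Aw; have [s s0 Cs] := weak_cone_exit_C wA Aw Nu NNu.
  have NNNu : ~ closure A (- - u) by rewrite opprK.
  have [r r0 Cr] := weak_cone_exit_C wA Aw NNu NNNu.
  have sr : 0 < s + r by rewrite addr_gt0.
  have := weak_cone_closureD wA'
    (weak_cone_closureZ wA' (weak_cone_C_closure wA' Cs) (divr_gt0 r0 sr))
    (weak_cone_closureZ wA' (weak_cone_C_closure wA' Cr) (divr_gt0 s0 sr)).
  rewrite !scalerDr !scalerA scalerN addrACA -scalerDl -mulrDl [r + s]addrC.
  rewrite divff ?gt_eqF // scale1r [r / _ * s]mulrAC [s / _ * r]mulrAC [r * s]mulrC.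
  by rewrite subrr addr0.
apply: (weak_cone_interior wA'); have := open_nbhs_nbhs (conj (weak_cone_open wA) Av).
by apply: filterS => w; exact: cv.
Qed.

End Cones.

(** * Smooth fields of cones *)

Section Hypersurface.
Context {R : realType}.

Lemma linear_form_continuous {V : normedModType R} (l : {scalar V}) :
  findim V -> continuous (l : V -> R).
Proof.
move=> [k [b [c [lc cc cE]]]] x.
have E : (l : V -> R) = (fun y => \sum_(i < k) c i y * l (b i)).
  apply/funext => y; rewrite {1}(cE y) linear_sum; apply: eq_bigr => i _.
  by rewrite linearZ.
rewrite E; apply: (@cvg_sum_ord _ R^o _ _ _ k (fun i z => c i z * l (b i))
    (fun i => c i x * l (b i))) => i.
by apply: cvgMl; exact: cc.
Qed.

(** [phi] is the coordinate transverse to [S] in a slice chart. It varies in some direction; when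
    that direction is split into a vertical and a tangent part, only the vertical part can
    contribute. *)
Lemma hypersurface_equation {B V : normedModType R} (S : set (B * V)%type) z :
  findim B -> findim V -> embedded_hypersurface S -> S z ->
  (forall y : B * V, exists (w : V) (y' : B * V), tangent_at S z y' /\ y = (0, w) + y') ->
  exists phi : B * V -> R, [/\ sm phi z,
    \forall y \near z, S y <-> phi y = 0 & exists w : V, 'D_((0 : B), w) phi z <> 0].
Proof.
move=> B0 V0 hS Sz tS; have BV0 : findim (B * V)%type by exact: findim_prod.
have [N [N' [f [g [l [Nz [[oN oN'] [Nf Ng] [gf fg] sf sg] [u lu] SN]]]]]] := hS z Sz.
have smf : sm f z by exact: smooth_on_sm sf Nz.
have smg : sm g (f z) by apply: smooth_on_sm sg (Nf _ Nz).
have cl := linear_form_continuous (l := l) BV0.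
have sml y : sm (l : _ -> R) y.
  by apply: (@sm_lin R (B * V)%type R^o (l : _ -> R)) => // a v w; rewrite linearP.
have smphi : sm (fun y => l (f y)) z by apply: (sm_comp (g := l : _ -> R)).
exists (fun y => l (f y)); split => //.
  by near=> y; apply: SN; near: y; exact: open_nbhs_nbhs.
have Dl y v : 'D_v (l : _ -> R) y = l v.
  have -> : 'D_v (l : _ -> R) y = 'd (l : _ -> R) y v.
    by apply: deriveE; exact: sm_diff.
  have lc : linear_for *%R (l : _ -> R) by move=> a v' w'; rewrite linearP.
  pose L : {linear (B * V)%type -> R^o} :=
    HB.pack (l : _ -> R) (GRing.isLinear.Build R (B * V)%type R^o _ (l : _ -> R) lc).
  by rewrite (@diff_lin _ _ _ L).
have Dphi v : 'D_v (fun y => l (f y)) z = l ('D_v f z).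
  by rewrite (derive_chain (g := l : _ -> R) v (sm_diff smf) (sm_diff (sml _))) Dl.
have Dv : 'D_('D_u g (f z)) (fun y => l (f y)) z <> 0.
  rewrite Dphi; have gz : g (f z) = z by rewrite gf.
  have dfg : differentiable f (g (f z)) by rewrite gz; exact: sm_diff.
  have := derive_chain (g := f) u (sm_diff smg) dfg; rewrite gz => <-.
  have -> : 'D_u (fun y => f (g y)) (f z) = 'D_u id (f z).
    apply: near_eq_derive; near=> y; apply: fg; near: y.
    by apply: open_nbhs_nbhs; split => //; exact: Nf.
  by rewrite derive_id.
have Dt y : tangent_at S z y -> 'D_y (fun y => l (f y)) z = 0.
  move=> [e [c [e0 sc cS c0 c1]]].
  have b0 : ball (0 : R) e 0 by exact: ballxx.
  have smc : sm c 0 by apply: smooth_on_sm sc b0 => //; [exact: findimR|exact: ball_open].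
  have E : \forall t \near (0 : R), l (f (c t)) = 0.
    have n1 : \forall t \near (0 : R), N (c t).
      by apply: (sm_cont smc); rewrite c0; exact: open_nbhs_nbhs.
    have n2 : \forall t \near (0 : R), ball (0 : R) e t by exact: near_ball.
    by apply: filterS2 n1 n2 => t Nt /cS St; apply/(SN _ Nt).
  have d1 : 'D_(1 : R) (fun t : R => l (f (c t))) (0 : R) = 0.
    rewrite (@near_eq_derive _ _ _ _ (cst 0)) // derive_cst //.
  have dphi : differentiable (fun y => l (f y)) (c 0) by rewrite c0; exact: sm_diff.
  have := derive_chain (g := fun y => l (f y)) (1 : R) (sm_diff smc) dphi.
  by rewrite d1 c0 -derive1E c1.
have [w [y' [ty' E]]] := tS ('D_u g (f z)).
exists w => D0; apply: Dv.
rewrite E deriveDv; last exact: sm_diff.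
by rewrite D0 (Dt _ ty') addr0.
Unshelve. all: by end_near. Qed.

Lemma norm_pair0 {B V : normedModType R} (y : V) : `|((0 : B), y)| = `|y|.
Proof. by rewrite prod_normE /= normr0 max_r. Qed.

Lemma derive_pos_near {V : normedModType R} (f : V -> R) z d :
  differentiable f z -> f z = 0 -> 0 < 'D_d f z ->
  exists2 e : R, 0 < e & forall s, 0 < s < e -> 0 < f (z + s *: d).
Proof.
move=> df f0 Dp.
have dd : derivable f z d by exact: diff_derivable.
have /cvg_ex[l Hl] := dd.
have lE : 'D_d f z = l by apply/cvg_lim.
rewrite lE in Dp.
have n : \forall s \near (0 : R), s != 0 -> 0 < s^-1 *: (f (s *: d + z) - f z).
  exact: (@cvgr_gt R R _ _ _ l Hl 0 Dp).
have [e /= e0 He] := (nbhs_normP _ _).1 n; exists e => // s /andP[s0 se].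
have := He s; rewrite /= sub0r normrN gtr0_norm // => /(_ se).
rewrite gt_eqF // => /(_ isT); rewrite f0 subr0 addrC -[_ *: _]/(_ * _).
by rewrite pmulr_rgt0 // invr_gt0.
Qed.

End Hypersurface.

(** * Families of cones: openness of the interiors and smoothness of the height *)

Section ConeField.
Context {R : realType} {B V : normedModType R}.
Hypotheses (B0 : findim B) (V0 : findim V).
Variables (U : set B) (C A : set (B * V)).
Hypothesis oU : open U.
Hypothesis wc : forall x, U x -> weak_cone [set v | C (x, v)] [set v | A (x, v)].
Hypothesis Ceq : forall z, U z.1 -> C z ->
  exists phi : B * V -> R, [/\ sm phi z,
    \forall y \near z, C y <-> phi y = 0 & exists w : V, 'D_((0 : B), w) phi z <> 0].

Let BV0 : findim (B * V)%type. Proof. exact: findim_prod. Qed.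

Lemma ivt_segment (phi : B * V -> R) x p e (a b : R) : a <= b ->
  (forall r, a <= r <= b -> {for (x, p + r *: e), continuous phi}) ->
  (phi (x, p + a *: e) <= 0 <= phi (x, p + b *: e)) \/
  (phi (x, p + b *: e) <= 0 <= phi (x, p + a *: e)) ->
  exists2 r, a <= r <= b & phi (x, p + r *: e) = 0.
Proof.
move=> ab cphi sgn.
have cf : {within `[a, b], continuous (fun r : R => phi (x, p + r *: e))}.
  apply: continuous_in_subspaceT => r /[1!inE]; rewrite /= in_itv /= => rab.
  apply: (@continuous_comp _ _ _ (fun r : R => (x, p + r *: e)) phi); last exact: cphi.
  apply: sm_cont; apply: sm_pair; first exact: sm_cst.
  by apply: sm_add; [exact: sm_cst|apply: sm_scale; [exact: sm_id|exact: sm_cst]].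
have [|r] := @IVT R (fun r : R => phi (x, p + r *: e)) a b 0 ab cf.
  rewrite ge_min le_max; case: sgn => /andP[h1 h2].
    by rewrite h1 h2 orbT.
  by rewrite h1 h2 !orbT.
by rewrite in_itv /= => rab E; exists r.
Qed.

(* If [u] were tangent to the cone at [v], some point of the cone would lie near
   [v - s *: u], and [v] would be interior, being between it and a point near
   [v + rho *: u]. *)
Lemma interior_direction_transverse (phi : B * V -> R) x v u (rho : R) :
  U x -> C (x, v) -> sm phi (x, v) -> (\forall y \near (x, v), C y <-> phi y = 0) ->
  (exists w : V, 'D_((0 : B), w) phi (x, v) <> 0) ->
  A (x, v + rho *: u) -> 'D_((0 : B), u) phi (x, v) <> 0.
Proof.
move=> Ux Cv sphi Cphi [e0 De0] Au Du.
have wx := wc Ux.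
have dphi := sm_diff sphi.
have phi0 : phi (x, v) = 0 by apply/(nbhs_singleton Cphi).
wlog De : e0 De0 / 0 < 'D_((0 : B), e0) phi (x, v).
  move=> H; have [De|De|//] := ltgtP ('D_((0 : B), e0) phi (x, v)) 0; last exact: (H e0).
  have E : ((0 : B), - e0) = (-1 : R) *: ((0 : B), e0).
    by rewrite scale_pairE scaler0 scaleN1r.
  apply: (H (- e0)); rewrite E deriveZv // scaleN1r.
    by move/eqP; rewrite oppr_eq0 => /eqP.
  by rewrite oppr_gt0.
set k := 'D_((0 : B), e0) phi (x, v) in De De0.
have [eta eta0 Heta] := nbhs_line e0 (open_nbhs_nbhs (conj (weak_cone_open wx) Au)).
pose h := eta / 2; have h0 : 0 < h by rewrite divr_gt0.
have hh : h < eta by rewrite ltr_pdivrMr // ltr_pMr // ltr1n.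
(* Since ['D_u phi] is assumed to vanish, the derivative along [d c] is [c * k]: after a small move
   along [- rho *: u], corrections by [e0] of either sign give [phi] either sign. *)
pose d (c : R) : B * V := (0, (- rho) *: u + c *: e0).
have Dd c : 'D_(d c) phi (x, v) = c * k.
  have -> : d c = (- rho) *: ((0 : B), u) + c *: ((0 : B), e0).
    by rewrite !scale_pairE !scaler0 -[RHS]/(_ + _, _ + _) addr0.
  by rewrite deriveDv // !deriveZv // Du scaler0 add0r.
have [e1 e10 H1] : exists2 e : R, 0 < e & forall s, 0 < s < e -> 0 < phi ((x, v) + s *: d h).
  by apply: derive_pos_near => //; rewrite Dd mulr_gt0.
have [e2 e20 H2] : exists2 e : R, 0 < e & forall s, 0 < s < e -> 0 < - phi ((x, v) + s *: d (- h)).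
  have dN : differentiable (fun y => - phi y) (x, v) by exact: differentiableN.
  apply: (@derive_pos_near _ _ (fun y => - phi y)) => //; first by rewrite phi0 oppr0.
  have -> : 'D_(d (- h)) (fun y => - phi y) (x, v) = - 'D_(d (- h)) phi (x, v).
    by apply: deriveN; exact: diff_derivable.
  by rewrite Dd mulNr opprK mulr_gt0.
have : \forall y \near (x, v), {for y, continuous phi} /\ (C y <-> phi y = 0).
  by apply: filterI => //; exact: (sphi 0%N).
move=> /nbhs_normP[r /= r0 Hr].
pose q := `|rho| * `|u| + h * `|e0| + 1.
have q0 : 0 < q by rewrite ltr_wpDl // addr_ge0 // mulr_ge0 // ltW.
pose s := Num.min (Num.min e1 e2) (r / q) / 2.
have m0 : 0 < Num.min (Num.min e1 e2) (r / q) by rewrite !lt_min e10 e20 divr_gt0.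
have s0 : 0 < s by rewrite divr_gt0.
have sm' : s < Num.min (Num.min e1 e2) (r / q).
  by rewrite ltr_pdivrMr // ltr_pMr // ltr1n.
move: sm'; rewrite !lt_min => /andP[/andP[se1 se2] sr].
clearbody s.
have pE c : (x, v) + s *: d c = (x, (v - (s * rho) *: u) + (s * c) *: e0).
  rewrite scale_pairE scaler0 scalerDr !scalerA mulrN scaleNr.
  by rewrite -[LHS]/(_ + _, _ + _) addr0 addrA.
have insmall c : `|c| <= s * h -> `|(x, v) - (x, (v - (s * rho) *: u) + c *: e0)| < r.
  move=> ch; rewrite -[_ - _]/(_ - _, _ - _) subrr norm_pair0 /=.
  have -> : v - (v - (s * rho) *: u + c *: e0) = (s * rho) *: u - c *: e0.
    by rewrite -addrA opprD addrA subrr add0r opprD opprK.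
  have sq : s * q < r by rewrite -ltr_pdivlMr.
  apply: le_lt_trans (ler_normB _ _) (le_lt_trans _ sq).
  rewrite -scalerA !normrZ (gtr0_norm s0) /q 2!mulrDr mulr1.
  have : `|c| * `|e0| <= s * (h * `|e0|) by rewrite mulrA ler_wpM2r.
  by move: s0; lra.
have shh : - (s * h) <= s * h.
  by rewrite ge0_cp // mulr_ge0 // ltW.
have [c cI c0] : exists2 c : R, - (s * h) <= c <= s * h &
    phi (x, (v - (s * rho) *: u) + c *: e0) = 0.
  apply: (ivt_segment shh).
    move=> c cI; have ch : `|c| <= s * h by rewrite ler_norml.
    by have [] := Hr _ (insmall c ch).
  left; have := H1 s; have := H2 s; rewrite !pE s0 se1 se2 mulrN => /(_ isT).
  by rewrite oppr_gt0 => /ltW -> /(_ isT) /ltW ->.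
have ch : `|c| <= s * h by rewrite ler_norml.
have Cc : C (x, v - (s * rho) *: u + c *: e0) by apply/(Hr _ (insmall c ch)).2.
(* The interior point carries the opposite correction divided by [s], so that [s] times it plus the
   cone point is exactly [(1 + s) *: v]. *)
have At : A (x, v + rho *: u + (- (c / s)) *: e0).
  apply: Heta; rewrite normrN normrM normfV (gtr0_norm s0) ltr_pdivrMr //.
  by apply: le_lt_trans ch _; rewrite mulrC ltr_pM2r.
have := weak_cone_add wx (weak_cone_scale wx At s0) (weak_cone_C_closure wx Cc).
have -> : s *: (v + rho *: u + - (c / s) *: e0) + (v - (s * rho) *: u + c *: e0)
    = (1 + s) *: v.
  rewrite !scalerDr !scalerA mulrN mulrCA mulfV ?gt_eqF // mulr1 scaleNr.
  by rewrite addrACA addNr addr0 addrACA subrr addr0 addrC scalerDl scale1r.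
have s1 : 0 < 1 + s by rewrite addr_gt0.
have si : 0 < (1 + s)^-1 by rewrite invr_gt0.
move=> /(weak_cone_scale wx)/(_ si); rewrite scalerA mulVf ?gt_eqF // scale1r.
by have [_ + _] := (weak_cone_C wx v).1 Cv.
Qed.

(** [phi] has opposite signs on the two sides of [v] along [u]. This persists for nearby points and
    directions, and the intermediate value theorem gives a zero in between. *)
Lemma crossing x v u (phi : B * V -> R) e :
  C (x, v) -> sm phi (x, v) -> (\forall y \near (x, v), C y <-> phi y = 0) ->
  'D_((0 : B), u) phi (x, v) <> 0 -> 0 < e ->
  \forall y \near ((x, v), u),
    exists2 s : R, `|s| < e & C (y.1.1, y.1.2 + s *: y.2).
Proof.
move=> Cv sphi Cphi Du e0.
have dphi := sm_diff sphi.
have phi0 : phi (x, v) = 0 by apply/(nbhs_singleton Cphi).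
wlog Dp : phi sphi Cphi Du dphi phi0 / 0 < 'D_((0 : B), u) phi (x, v).
  move=> H; have [De|De|//] := ltgtP ('D_((0 : B), u) phi (x, v)) 0; last exact: (H phi).
  have DN : 'D_((0 : B), u) (fun y => - phi y) (x, v) = - 'D_((0 : B), u) phi (x, v).
    by apply: deriveN; exact: diff_derivable.
  have sN : sm (fun y => - phi y) (x, v) by exact: sm_opp.
  apply: (H (fun y => - phi y)) => //.
  - apply: filterS Cphi => y [H1 H2]; split => [/H1 ->|]; first by rewrite oppr0.
    by move=> /eqP; rewrite oppr_eq0 => /eqP/H2.
  - by rewrite DN => /eqP; rewrite oppr_eq0 => /eqP.
  - exact: sm_diff.
  - by rewrite phi0 oppr0.
  - by rewrite DN oppr_gt0.
have [e1 e10 H1] := derive_pos_near dphi phi0 Dp.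
have [e2 e20 H2] : exists2 e : R, 0 < e & forall s, 0 < s < e -> 0 < - phi ((x, v) + s *: ((0 : B), - u)).
  have sN : sm (fun y => - phi y) (x, v) by exact: sm_opp.
  apply: (@derive_pos_near _ _ (fun y => - phi y)) => //; first exact: sm_diff.
    by rewrite phi0 oppr0.
  have -> : 'D_((0 : B), - u) (fun y => - phi y) (x, v) = - 'D_((0 : B), - u) phi (x, v).
    by apply: deriveN; exact: diff_derivable.
  have -> : ((0 : B), - u) = (-1 : R) *: ((0 : B), u).
    by rewrite scale_pairE scaler0 scaleN1r.
  by rewrite deriveZv // scaleN1r opprK.
have : \forall y \near (x, v), {for y, continuous phi} /\ (C y <-> phi y = 0).
  by apply: filterI => //; exact: (sphi 0%N).
move=> /nbhs_normP[r /= r0 Hr].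
pose q := `|u| + 1.
have q0 : 0 < q by rewrite ltr_wpDl.
pose mm := Num.min (Num.min e1 e2) (Num.min e (r / 2 / q)).
have m0 : 0 < mm by rewrite !lt_min e10 e20 e0 !divr_gt0.
pose s := mm / 2.
have s0 : 0 < s by rewrite divr_gt0.
have sm' : s < mm by rewrite ltr_pdivrMr // ltr_pMr // ltr1n.
move: sm'; rewrite !lt_min => /andP[/andP[se1 se2] /andP[se sr]].
clearbody s.
have pE (c : R) : (x, v) + c *: ((0 : B), u) = (x, v + c *: u).
  by rewrite scale_pairE scaler0 -[LHS]/(_ + _, _ + _) addr0.
have sq : s * q < r / 2 by rewrite -ltr_pdivlMr.
have insmall c : `|c| <= s -> `|(x, v) - (x, v + c *: u)| < r.
  move=> cs; rewrite -[_ - _]/(_ - _, _ - _) subrr norm_pair0 /=.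
  rewrite opprD addrA subrr add0r normrN normrZ.
  have : `|c| * `|u| <= s * `|u| by rewrite ler_wpM2r.
  by move: sq s0 r0; rewrite /q mulrDr mulr1; lra.
pose P (c : R) (y : B * V * V) : B * V := (y.1.1, y.1.2 + c *: y.2).
have cP c y : {for y, continuous (P c)}.
  apply: sm_cont; apply: sm_pair.
    apply: (sm_comp (g := fun z : B * V => z.1)) => //; [exact: sm_fst|exact: sm_fst].
  apply: sm_add.
    apply: (sm_comp (g := fun z : B * V => z.2)) => //; [exact: sm_fst|exact: sm_snd].
  by apply: sm_scale; [exact: sm_cst|exact: sm_snd].
have n1 : \forall y \near (x, v, u), 0 < phi (P s y).
  have c1 : {for (x, v, u), continuous (fun y => phi (P s y))}.
    apply: continuous_comp; first exact: cP.
    by apply: (Hr _ (insmall s _)).1; rewrite gtr0_norm.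
  apply: (@cvgr_gt R _ _ _ _ _ c1); rewrite /P /= -pE.
  by apply: H1; rewrite s0.
have n2 : \forall y \near (x, v, u), phi (P (- s) y) < 0.
  have c1 : {for (x, v, u), continuous (fun y => phi (P (- s) y))}.
    apply: continuous_comp; first exact: cP.
    by apply: (Hr _ (insmall (- s) _)).1; rewrite normrN gtr0_norm.
  apply: (@cvgr_lt R _ _ _ _ _ c1); rewrite /P /= -pE -oppr_gt0.
  have -> : (- s) *: ((0 : B), u) = s *: ((0 : B), - u).
    by rewrite !scale_pairE !scaler0 scaleNr scalerN.
  by apply: H2; rewrite s0.
have n3 : \forall y \near (x, v, u), forall c, `|c| <= s -> `|(x, v) - P c y| < r.
  have c1 : {for (x, v, u), continuous (fun y : B * V * V => y.1)} by apply: sm_cont; exact: sm_fst.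
  have c2 : {for (x, v, u), continuous (fun y : B * V * V => s * `|y.2|)}.
    apply: cvgMr; apply: cvg_norm.
    by have := @sm_cont R _ _ _ _ (@sm_snd R (B * V)%type V (x, v, u)).
  have su : s * `|u| < r / 2.
    by apply: le_lt_trans sq; rewrite /q mulrDr lerDl mulr1 ltW.
  have r2 : 0 < r / 2 by rewrite divr_gt0.
  have m1 : \forall y \near (x, v, u), `|(x, v) - y.1| < r / 2.
    by have /cvgrPdist_lt/(_ _ r2) := c1.
  have m2 : \forall y \near (x, v, u), s * `|y.2| < r / 2.
    exact: (@cvgr_lt R _ _ _ _ _ c2 _ su).
  apply: filterS2 m1 m2 => -[[y1 y2] y3]; rewrite /P /=.
  rewrite -[_ - _]/(x - y1, v - y2) prod_normE gt_max /= => /andP[h1 h2] h3 c cs.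
  rewrite -[_ - _]/(_ - _, _ - _) prod_normE gt_max /=; apply/andP; split.
    by apply: lt_trans h1 _; rewrite ltr_pdivrMr // ltr_pMr // ltr1n.
  rewrite opprD addrA; apply: le_lt_trans (ler_normB _ _) _; rewrite normrZ.
  have : `|c| * `|y3| <= s * `|y3| by rewrite ler_wpM2r.
  by move: h2 h3; lra.
apply: filterS (filterI n1 (filterI n2 n3)) => y [p1 [p2 p3]].
have ss : - s <= s by rewrite ge0_cp // ltW.
have [c cI c0] : exists2 c, - s <= c <= s & phi (y.1.1, y.1.2 + c *: y.2) = 0.
  apply: ivt_segment => //.
    by move=> c cI; apply: (Hr _ (p3 c _)).1; rewrite ler_norml.
  by left; rewrite (ltW p1) (ltW p2).
have ch : `|c| <= s by rewrite ler_norml.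
exists c; first exact: le_lt_trans ch se.
by apply/(Hr _ (p3 c ch)).2.
Qed.


Lemma cone_line_unique x T v (s t : R) : U x -> A (x, T) ->
  C (x, v + s *: T) -> C (x, v + t *: T) -> s = t.
Proof.
move=> Ux AT Cs Ct; have wx := wc Ux.
wlog st : s t Cs Ct / s <= t.
  by move=> H; have [st|/ltW ts] := leP s t; [exact: H|apply/esym; exact: H].
apply/eqP; rewrite eq_le st leNgt; apply/negP => lt_st.
have [_ + _] := (weak_cone_C wx _).1 Ct; apply.
have -> : v + t *: T = (t - s) *: T + (v + s *: T).
  by rewrite addrCA -scalerDl subrK.
apply: (weak_cone_add wx); last exact: (weak_cone_C_closure wx Cs).
by apply: (weak_cone_scale wx) => //; rewrite subr_gt0.
Qed.

(** Openness is known only in each fibre. From an interior point, follow a direction that exits on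
    both sides: both exits persist nearby, so nearby points lie between two cone points, hence in
    the closed cone of their fibre. As this holds on a neighbourhood, they are interior. *)
Lemma cone_domain_open x v : U x -> A (x, v) -> \forall y \near (x, v), A y.
Proof.
move=> Ux Av; have wx := wc Ux.
have [u0 [Nu NNu]] := weak_cone_transversal wx.
have side u : ~ closure [set v | A (x, v)] u -> ~ closure [set v | A (x, v)] (- u) ->
    \forall y \near (x, v), exists2 s : R, 0 < s & C (y.1, y.2 + s *: u).
  move=> Hu HNu; have [s s0 Cs] := weak_cone_exit_C wx Av Hu HNu.
  have [phi [sphi Cphi De]] := Ceq (z := (x, v + s *: u)) Ux Cs.
  have Du : 'D_((0 : B), u) phi (x, v + s *: u) <> 0.
    apply: (interior_direction_transverse (rho := - s) Ux Cs sphi Cphi De).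
    by rewrite scaleNr addrK.
  pose P (y : B * V) : B * V * V := (y.1, y.2 + s *: u, u).
  have cP : {for (x, v), continuous P}.
    apply: sm_cont; apply: sm_pair; last exact: sm_cst.
    apply: sm_pair; first exact: sm_fst.
    by apply: sm_add; [exact: sm_snd|exact: sm_cst].
  have n : \forall y \near (x, v),
      exists2 t : R, `|t| < s & C (y.1, y.2 + s *: u + t *: u).
    exact: (cP _ (crossing Cs sphi Cphi Du s0)).
  apply: filterS n => y /= [t ts Ct].
  exists (s + t); last by rewrite scalerDl addrA.
  by rewrite -ltrBlDl sub0r; have := ltr_normlW (x := - t); rewrite normrN => /(_ _ ts); rewrite ltrNl.
have n1 := side u0 Nu NNu.
have n2 : \forall y \near (x, v), exists2 s : R, 0 < s & C (y.1, y.2 + s *: (- u0)).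
  by apply: side; rewrite ?opprK.
have n3 : \forall y \near (x, v), U y.1.
  by apply: (sm_cont (@sm_fst R B V (x, v))); exact: open_nbhs_nbhs.
have n4 : \forall y \near (x, v), closure [set v | A (y.1, v)] y.2.
  apply: filterS (filterI n1 (filterI n2 n3)) => -[y1 y2] /= [[s s0 Cs] [[t t0 Ct] Uy]].
  have wy := wc Uy; have st : 0 < s + t by rewrite addr_gt0.
  have := weak_cone_closureD wy
    (weak_cone_closureZ wy (weak_cone_C_closure wy Cs) (divr_gt0 t0 st))
    (weak_cone_closureZ wy (weak_cone_C_closure wy Ct) (divr_gt0 s0 st)).
  rewrite !scalerDr !scalerA scalerN addrACA -scalerDl -mulrDl [t + s]addrC.
  rewrite divff ?gt_eqF // scale1r [t / _ * s]mulrAC [s / _ * t]mulrAC [t * s]mulrC.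
  by rewrite subrr addr0.
have /near_join n5 := n4.
apply: filterS2 n3 n5 => -[y1 y2] /= Uy n6.
apply: (weak_cone_interior (wc Uy)).
have c : {for y2, continuous (fun w : V => (y1, w))}.
  by apply: sm_cont; apply: sm_pair; [exact: sm_cst|exact: sm_id].
by have := c _ n6.
Qed.

(** The implicit function theorem for [phi (x, v + s *: X x)] in the unknown [s]. The derivative in
    [s] is non-zero because [X] is interior, and [tau] is continuous because a crossing persists
    nearby and is unique on its line. *)
Lemma cone_graph_smooth (X : B -> V) (tau : B * V -> R) x0 v0 :
  U x0 -> A (x0, X x0) -> sm X x0 ->
  (\forall y \near (x0, v0), C (y.1, y.2 + tau y *: X y.1)) ->
  sm tau (x0, v0).
Proof.
move=> Ux AX sX Ctau.
have nfst (P : set B) : nbhs x0 P -> \forall y \near (x0, v0), P y.1.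
  by move=> nP; apply: (sm_cont (@sm_fst R B V (x0, v0))).
have nX : \forall y \near (x0, v0), differentiable X y.1.
  exact: (nfst _ (sm_diff_near sX)).
have nU : \forall y \near (x0, v0), U y.1.
  exact: (nfst _ (open_nbhs_nbhs (conj oU Ux))).
have sXf : sm (fun y : B * V => X y.1) (x0, v0).
  by apply: (sm_comp (g := X)) => //; exact: sm_fst.
have nA : \forall y \near (x0, v0), A (y.1, X y.1).
  have c : {for (x0, v0), continuous (fun y : B * V => (y.1, X y.1))}.
    by apply: sm_cont; apply: sm_pair; [exact: sm_fst|].
  by have := c _ (cone_domain_open Ux AX).
have CT (y : B * V) : U y.1 -> A (y.1, X y.1) -> C (y.1, y.2 + tau y *: X y.1) ->
    A (y.1, (y.2 + tau y *: X y.1) + 1 *: X y.1).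
  move=> Uy Ay Cy; rewrite scale1r addrC.
  by apply: (weak_cone_add (wc Uy)) => //; exact: (weak_cone_C_closure (wc Uy)).
have Ct0 : C (x0, v0 + tau (x0, v0) *: X x0) := nbhs_singleton Ctau.
have cont y : U y.1 -> A (y.1, X y.1) -> differentiable X y.1 ->
   (\forall y' \near y, [/\ C (y'.1, y'.2 + tau y' *: X y'.1), U y'.1 & A (y'.1, X y'.1)]) ->
   {for y, continuous tau}.
  move=> Uy Ay dX Cy; have [Cy0 _ _] := nbhs_singleton Cy.
  have [phi [sphi Cphi De]] := Ceq (z := (y.1, y.2 + tau y *: X y.1)) Uy Cy0.
  have Du := interior_direction_transverse Uy Cy0 sphi Cphi De (CT y Uy Ay Cy0).
  apply/cvgrPdist_lt => e e0.
  pose P (y' : B * V) : B * V * V := (y'.1, y'.2 + tau y *: X y'.1, X y'.1).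
  have dXf : differentiable (fun y' : B * V => X y'.1) y.
    apply: (differentiable_comp (f := fun y' : B * V => y'.1) (g := X)) => //.
    by apply: sm_diff; exact: sm_fst.
  have cP : {for y, continuous P}.
    apply: differentiable_continuous; apply: differentiable_pair => //.
    apply: differentiable_pair; first by apply: sm_diff; exact: sm_fst.
    apply: differentiableD; first by apply: sm_diff; exact: sm_snd.
    exact: differentiableZ.
  apply: filterS2 Cy (cP _ (crossing Cy0 sphi Cphi Du e0)) => -[y1 y2] /= [C1 U1 A1] [s se C2].
  rewrite -addrA -scalerDl in C2.
  rewrite -(cone_line_unique U1 A1 C2 C1) opprD addrA subrr add0r normrN.
  exact: se.
have [phi [sphi Cphi De]] := Ceq (z := (x0, v0 + tau (x0, v0) *: X x0)) Ux Ct0.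
have Du := interior_direction_transverse Ux Ct0 sphi Cphi De (CT (x0, v0) Ux AX Ct0).
pose Q (y : B * V * R) : B * V := (y.1.1, y.1.2 + y.2 *: X y.1.1).
have sQ : sm Q (x0, v0, tau (x0, v0)).
  have s1 : sm (fun y : B * V * R => y.1.1) (x0, v0, tau (x0, v0)).
    by apply: (sm_comp (g := fun z : B * V => z.1)) => //; exact: sm_fst.
  apply: sm_pair => //; apply: sm_add.
    by apply: (sm_comp (g := fun z : B * V => z.2)) => //; [exact: sm_fst|exact: sm_snd].
  by apply: sm_scale; [exact: sm_snd|apply: (sm_comp (g := X))].
have ctau : {for (x0, v0), continuous tau}.
  apply: cont => //; first exact: sm_diff.
  by apply: filterS (filterI Ctau (filterI nU nA)) => y [? []].
apply: (@ift_smooth _ _ (fun y => phi (Q y))) => //.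
- by apply: (sm_comp (g := phi)).
- have dQ := sm_diff sQ; have dphi := sm_diff sphi.
  rewrite (derive_chain (g := phi)) //; apply/eqP.
  have -> : 'D_(0, 1) Q (x0, v0, tau (x0, v0)) = ((0 : B), X x0); last exact: Du.
  have dl := @is_derive_line R _ _ Q (x0, v0, tau (x0, v0)) (0, 1) 0.
  have z0E : (x0, v0, tau (x0, v0)) + (0 : R) *: ((0, 1) : B * V * R) = (x0, v0, tau (x0, v0)).
    by rewrite scale0r addr0.
  rewrite z0E in dl; have {}dl := dl (diff_derivable dQ).
  rewrite -(@derive_val _ _ _ _ _ _ _ dl).
  have -> : (fun s : R => Q ((x0, v0, tau (x0, v0)) + s *: ((0, 1) : B * V * R)))
     = (fun s : R => (x0, v0 + tau (x0, v0) *: X x0) + s *: ((0 : B), X x0)).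
    apply/funext => s; rewrite scale_pairE scaler0 /Q.
    rewrite -[_ + _]/((x0, v0) + 0, tau (x0, v0) + s *: 1) /= addr0 /=.
    rewrite scale_pairE scaler0 -[RHS]/(_ + _, _ + _) addr0 /= scalerDl addrA.
    by rewrite [_%:A]mulr1 [x0 + 0]addr0.
  have dI : is_derive (0 : R) 1 (fun s : R => s *: ((0 : B), X x0)) ((0 : B), X x0).
    have dd : is_diff (0 : R) (fun s : R => s *: ((0 : B), X x0)) (fun s => s *: ((0 : B), X x0)).
      exact: is_diff_scalel.
    split; first by apply/derivable1_diffP; exact: ex_diff.
    by rewrite deriveE ?diff_val ?scale1r //; exact: ex_diff.
  have dA := is_deriveD (is_derive_cst (x0, v0 + tau (x0, v0) *: X x0) (0 : R) (1 : R)) dI.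
  by rewrite (@derive_val _ _ _ _ _ _ _ dA) add0r.
- have /near_join n1 := Ctau; have /near_join n2 := nU; have /near_join n3 := nA.
  apply: filterS (filterI nX (filterI n1 (filterI n2 n3))) => y [dX [m1 [m2 m3]]].
  apply: cont => //; [exact: nbhs_singleton m2|exact: nbhs_singleton m3|].
  by apply: filterS (filterI m1 (filterI m2 m3)) => y' [? []].
- have c : {for (x0, v0), continuous (fun y => Q (y, tau y))}.
    apply: (continuous_comp (f := fun y => (y, tau y))); last exact: (sm_cont sQ).
    apply: (@cvg_pair _ _ _ (nbhs (x0, v0)) (nbhs (x0, v0)) (nbhs (tau (x0, v0)))).
      exact: cvg_id.
    exact: ctau.
  by have := c _ Cphi; apply: filterS2 Ctau => y Cy [H _]; apply: H.
Qed.

End ConeField.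

Lemma quad_nonneg {R : realType} (x y : R) : 0 <= y ->
  (forall s, 0 <= s * (2 * x) + s ^+ 2 * y) -> x = 0.
Proof.
move=> y0 key; apply: contrapT => /eqP x0.
have p1 : 0 < y + 1 by rewrite ltr_wpDl.
(* The added 1 avoids a division by zero when [y = 0]. *)
pose s := - x / (y + 1).
have s0 : 0 < s ^+ 2.
  by rewrite exprn_even_gt0 //= mulf_neq0 ?oppr_eq0 // invr_eq0 gt_eqF.
have Ex : x = - (s * (y + 1)) by rewrite /s divfK ?opprK // gt_eqF.
have := key s; clearbody s; rewrite Ex.
have -> : s * (2 * - (s * (y + 1))) + s ^+ 2 * y = - (s ^+ 2 * (y + 2)) by ring.
rewrite oppr_ge0 leNgt mulr_gt0 //.
by rewrite ltr_wpDl.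
Qed.

(** * The height function of a strong cone *)

Section FibreCalculus.
Context {R : realType} {V : normedModType R}.
Hypothesis V0 : findim V.

Lemma sm_line (v u : V) (r : R) : sm (fun t : R => v + t *: u) r.
Proof. by apply: sm_add; [exact: sm_cst|apply: sm_scale; [exact: sm_id|exact: sm_cst]]. Qed.

Lemma derive_line (f : V -> R) v u (r : R) : differentiable f (v + r *: u) ->
  'D_1 (fun t : R => f (v + t *: u)) r = 'D_u f (v + r *: u).
Proof.
move=> df; have dl := is_derive_line (@diff_derivable _ _ _ _ _ u df).
by rewrite (@derive_val _ _ _ _ _ _ _ dl).
Qed.

Lemma derive_line2 (f : V -> R) v u : sm f v ->
  'D_1 (fun r : R => 'D_1 (fun t : R => f (v + t *: u)) r) 0 = 'D_u (fun y => 'D_u f y) v.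
Proof.
move=> sf; have v0 : v + (0 : R) *: u = v by rewrite scale0r addr0.
have sDf := sm_D u sf.
have -> : 'D_u (fun y => 'D_u f y) v = 'D_1 (fun t : R => 'D_u f (v + t *: u)) (0 : R).
  by rewrite (@derive_line (fun y => 'D_u f y) v u 0) v0 //; exact: sm_diff.
apply: near_eq_derive.
have n : \forall r \near (0 : R), differentiable f (v + r *: u).
  have H : \forall y \near (v + (0 : R) *: u), differentiable f y by rewrite v0; exact: sm_diff_near.
  exact: (sm_cont (sm_line v u 0) H).
by apply: filterS n => r; exact: derive_line.
Qed.

(** The case [a = 0] is included, so such a vector is non-zero. *)
Definition off_axis (T v : V) := forall a : R, v <> a *: T.

(** A coordinate that does not vanish on [T] gives a projection along [T]; off the axis means that
    the projection is non-zero, an open condition. *)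
Lemma off_axis_near T v : T <> 0 -> off_axis T v -> \forall y \near v, off_axis T y.
Proof.
move=> T0 vT; have [k [b [c [lc cc cE]]]] := V0.
have [i ci] : exists i, c i T <> 0.
  apply: contrapT => H; apply: T0; rewrite (cE T) big1 // => i _.
  rewrite (_ : c i T = 0) ?scale0r //; apply: contrapT => ci.
  by apply: H; exists i.
have sc : sm (c i) v by apply: (@sm_lin R V R^o (c i)); [exact: lc|exact: cc].
have cA a : c i (a *: T) = a * c i T.
  have c0 : c i 0 = 0.
    have := lc i 1 0 0; rewrite scale1r addr0 mul1r => /eqP.
    by rewrite addrC -subr_eq subrr => /eqP <-.
  by rewrite -[a *: T]addr0 lc c0 addr0.
pose f y := y - (c i y / c i T) *: T.
have cf : {for v, continuous f}.
  apply: sm_cont; apply: sm_sub; first exact: sm_id.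
  apply: sm_scale; last exact: sm_cst.
  by apply: sm_mul => //; exact: sm_cst.
have fv : f v != 0 by rewrite subr_eq0; apply/eqP; exact: vT.
have n : \forall y \near v, f y != 0 .
  exact: (@cvgr_neq0 R V V (nbhs v) _ f (f v) cf fv).
apply: filterS n => y /eqP fy a ya; apply: fy.
by rewrite /f ya cA mulfK ?subrr //; exact/eqP.
Qed.

Lemma off_axis_scale T v (a : R) : off_axis T v -> a != 0 -> off_axis T (a *: v).
Proof.
move=> vT a0 b E; apply: (vT (a^-1 * b)).
by rewrite -scalerA -E scalerA mulVf // scale1r.
Qed.

Lemma off_axis_add T v (a : R) : off_axis T v -> off_axis T (v + a *: T).
Proof.
by move=> vT b E; apply: (vT (b - a)); rewrite scalerBl -E addrK.
Qed.

Section Tau.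
Variables (C A : set V) (T : V) (tau : V -> R).
Hypothesis isc : is_cone C A.
Hypothesis AT : A T.
Hypothesis Ctau : forall v, off_axis T v -> C (v + tau v *: T).
Hypothesis stau : forall v, off_axis T v -> sm tau v.

Let wc : weak_cone C A. Proof. exact: is_cone_weak. Qed.

Lemma axis_neq0 : T <> 0.
Proof. by move=> T0; case: wc => _ + _ _ _; apply; rewrite -T0. Qed.

Let on v : off_axis T v -> \forall y \near v, off_axis T y.
Proof. by apply: off_axis_near; exact: axis_neq0. Qed.

Lemma C_off_axis v : C v -> off_axis T v.
Proof. by move=> Cv; exact: (weak_cone_C_line wc AT Cv). Qed.

Lemma tau_unique v (t : R) : C (v + t *: T) -> tau v = t.
Proof.
move=> Ct; have vT : off_axis T v.
  by have := off_axis_add (a := - t) (C_off_axis Ct); rewrite scaleNr addrK.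
wlog st : t Ct / True by move=> H; exact: H.
have [r [Cr Ar cr]] := weak_cone_line wc AT vT.
have H s : C (v + s *: T) -> s = r.
  move=> /(weak_cone_C wc)[/cr rs NA _]; apply/eqP; rewrite eq_le rs andbT.
  by rewrite leNgt; apply/negP => /Ar.
by rewrite (H t Ct) (H _ (Ctau vT)).
Qed.

Lemma tau_A v (s : R) : off_axis T v -> A (v + s *: T) <-> tau v < s.
Proof.
move=> vT; have [r [Cr Ar cr]] := weak_cone_line wc AT vT.
by rewrite (tau_unique Cr); exact: Ar.
Qed.

Lemma tau_closure v (s : R) : off_axis T v -> closure A (v + s *: T) <-> tau v <= s.
Proof.
move=> vT; have [r [Cr Ar cr]] := weak_cone_line wc AT vT.
by rewrite (tau_unique Cr); exact: cr.
Qed.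

Lemma tau_C v : C v -> tau v = 0.
Proof. by move=> Cv; apply: tau_unique; rewrite scale0r addr0. Qed.

Lemma tau_shift v (a : R) : off_axis T v -> tau (v + a *: T) = tau v - a.
Proof.
move=> vT; apply: tau_unique.
by rewrite -addrA -scalerDl addrCA subrr addr0; exact: Ctau.
Qed.

Lemma tau_scale v (a : R) : off_axis T v -> 0 < a -> tau (a *: v) = a * tau v.
Proof.
move=> vT a0; apply: tau_unique; rewrite -scalerA -scalerDr.
by case: wc => _ _ _ _ [+ _ _]; apply => //; exact: Ctau.
Qed.

Lemma tau_subadd u v : off_axis T u -> off_axis T v -> off_axis T (u + v) ->
  tau (u + v) <= tau u + tau v.
Proof.
move=> uT vT uvT; apply/(tau_closure _ uvT).
rewrite scalerDl addrACA; apply: (weak_cone_closureD wc).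
  by apply: (weak_cone_C_closure wc); exact: Ctau.
by apply: (weak_cone_C_closure wc); exact: Ctau.
Qed.

Lemma derive_tau_axis v : off_axis T v -> 'D_T tau v = -1.
Proof.
move=> vT; have d := sm_diff (stau vT).
have := @derive_line tau v T 0; rewrite scale0r addr0 => <- //.
have -> : (fun t : R => tau (v + t *: T)) = (fun t => tau v - t).
  by apply/funext => t; exact: tau_shift.
have dI := is_deriveB (is_derive_cst (tau v) (0 : R) (1 : R)) (is_derive_id (0 : R) (1 : R)).
by rewrite (@derive_val _ _ _ _ _ _ _ dI) sub0r.
Qed.

Lemma derive_tau_self v : off_axis T v -> 'D_v tau v = tau v.
Proof.
move=> vT; have d := sm_diff (stau vT).
have := @derive_line tau v v 0; rewrite scale0r addr0 => <- //.
have dI : is_derive (0 : R) 1 (fun t : R => (1 + t) * tau v) (tau v).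
  have dA := is_deriveD (is_derive_cst (1 : R) (0 : R) (1 : R)) (is_derive_id (0 : R) (1 : R)).
  have := is_deriveM dA (is_derive_cst (tau v) (0 : R) (1 : R)).
  by move/is_derive_eq; apply; rewrite /= scaler0 add0r add0r -[_ *: _]/(_ * _) mulr1.
rewrite -(@derive_val _ _ _ _ _ _ _ dI); apply: near_eq_derive.
have n : \forall t \near (0 : R), -1 < t.
  by apply: (@cvgr_gt R R (nbhs (0 : R)) _ id 0 cvg_id); rewrite ltrN10.
apply: filterS n => t t1; rewrite -[X in X + _ *: _]scale1r -scalerDl tau_scale //.
by rewrite -ltrBlDl sub0r.
Qed.

(** [C] lies in the zero set of [tau]. Conversely the line in the direction [u], pushed onto [C]
    along [T], has velocity [u + 'D_u tau v *: T], which is [u]. *)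
Lemma tangent_tau v u : C v -> tangent_at C v u <-> 'D_u tau v = 0.
Proof.
move=> Cv; have vT := C_off_axis Cv; have st := stau vT; split.
  move=> [e [c [e0 sc cC c0 c1]]].
  have smc : sm c 0.
    by apply: smooth_on_sm sc (ballxx _ e0); [exact: findimR|exact: V0|exact: ball_open].
  have E : \forall t \near (0 : R), cst 0 t = tau (c t).
    have n2 : \forall t \near (0 : R), ball (0 : R) e t by exact: near_ball.
    by apply: filterS n2 => t /cC Ct; rewrite tau_C.
  have dtau : differentiable tau (c 0) by rewrite c0; exact: sm_diff.
  have := derive_chain (g := tau) (1 : R) (sm_diff smc) dtau.
  by rewrite -(near_eq_derive _ E) derive_cst c0 -derive1E c1.
move=> Du; pose c (t : R) := (v + t *: u) + tau (v + t *: u) *: T.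
have : \forall t \near (0 : R), off_axis T (v + t *: u).
  by apply: (sm_cont (sm_line v u 0)); rewrite scale0r addr0; exact: on.
move=> /nbhs_ballP[e /= e0 He].
have sc t : off_axis T (v + t *: u) -> sm c t.
  move=> tT; apply: sm_add; first exact: sm_line.
  apply: sm_scale; last exact: sm_cst.
  by apply: (sm_comp (g := tau)) => //; [exact: sm_line|exact: stau].
exists e, c; split => //.
- by apply: sm_smooth_on => t /He; exact: sc.
- by move=> t /He tT; exact: Ctau.
- by rewrite /c scale0r addr0 tau_C // scale0r addr0.
- have d0 : differentiable tau (v + (0 : R) *: u) by rewrite scale0r addr0; exact: sm_diff.
  have dl := is_derive_line (@diff_derivable _ _ _ _ _ u d0).
  have dv : is_derive (0 : R) 1 (fun t : R => v + t *: u) u.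
    have := is_derive_line (@derivable_id _ _ (v + (0 : R) *: u) u).
    by rewrite derive_id.
  have dd : is_derive (0 : R) 1 (fun t : R => tau (v + t *: u) *: T) (0 *: T).
    have ds : differentiable (fun t : R => tau (v + t *: u)) (0 : R).
      by apply/derivable1_diffP; have [] := dl.
    have [dz Ez] := diff_scale (1 : R) ds (differentiable_cst T (0 : R)).
    apply: DeriveDef; first exact: diff_derivable.
    rewrite deriveE // Ez diff_cst scaler0 add0r -deriveE //.
    by rewrite (@derive_val _ _ _ _ _ _ _ dl) (scale0r u) addr0 Du.
  have dc := is_deriveD dv dd.
  by rewrite derive1E (@derive_val _ _ _ _ _ _ _ dc) scale0r addr0.
Qed.

Lemma hess_lin w v a u1 u2 : sm tau v ->
  'D_(a *: u1 + u2) (fun y => 'D_w tau y) v =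
  a * 'D_u1 (fun y => 'D_w tau y) v + 'D_u2 (fun y => 'D_w tau y) v.
Proof.
move=> st; have d := sm_diff (sm_D w st).
by rewrite deriveDv // deriveZv.
Qed.

(** For the tangent field [X] used below, ['D_u X] is [T] times the Hessian of [tau]. The
    differential of [tau] kills tangent vectors, so applying it to the Gauss formula compares this
    Hessian with [h]. *)
Lemma second_fundamental_form_tau v : C v -> exists (k : R) (h : V -> V -> R),
  [/\ 0 < k, forall u w, 'D_u tau v = 0 -> 'D_w tau v = 0 ->
      'D_u (fun y => 'D_w tau y) v = k * h u w,
      forall u, 'D_u tau v = 0 -> 0 <= h u u
    & forall u, 'D_u tau v = 0 -> (forall w, 'D_w tau v = 0 -> h u w = 0) ->
      exists a : R, u = a *: v].
Proof.
move=> Cv; have vT := C_off_axis Cv; have st := stau vT.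
case: isc => _ _ _ _ /(_ v Cv)[xi [h [[Nxi [e e0 He]] hS hpos hrad]]].
(* Positive because [tau] is negative in the interior, into which [xi] points. *)
exists (- 'D_xi tau v), h; split.
- have D0 : 'D_xi tau v <> 0 by move=> D0; apply: Nxi; apply/tangent_tau.
  rewrite oppr_gt0 lt_neqAle; apply/andP; split; first exact/eqP.
  rewrite leNgt; apply/negP => Dp.
  have [e1 e10 H1] := derive_pos_near (sm_diff st) (tau_C Cv) Dp.
  have : \forall t \near (0 : R), off_axis T (v + t *: xi).
    by apply: (sm_cont (sm_line v xi 0)); rewrite scale0r addr0; exact: on.
  move=> /nbhs_normP[e2 /= e20 H2].
  pose t := Num.min e (Num.min e1 e2) / 2.
  have m0 : 0 < Num.min e (Num.min e1 e2) by rewrite !lt_min e0 e10 e20.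
  have t0 : 0 < t by rewrite divr_gt0.
  have : t < Num.min e (Num.min e1 e2) by rewrite ltr_pdivrMr // ltr_pMr // ltr1n.
  rewrite !lt_min => /and3P[te te1 te2]; clearbody t.
  have tT : off_axis T (v + t *: xi) by apply: H2; rewrite /= sub0r normrN gtr0_norm.
  have At := He t; rewrite t0 te in At; have {At} := At isT.
  rewrite -[v + _]addr0 -(scale0r T) => /(tau_A 0 tT).
  by have := H1 t; rewrite t0 te1 => /(_ isT) /lt_trans H /H; rewrite ltxx.
- move=> u w Du Dw.
  pose N : set V := [set y | off_axis T y].
  have oN : open N by rewrite openE => y Ny; exact: on.
  (* The projection of [w] to the tangent spaces along [T], since ['D_T tau = -1]. *)
  pose X y := w + 'D_w tau y *: T.
  have sX y : N y -> sm X y.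
    move=> Ny; apply: sm_add; first exact: sm_cst.
    by apply: sm_scale; [apply: sm_D; exact: stau|exact: sm_cst].
  have tX y : N y -> C y -> tangent_at C y (X y).
    move=> Ny Cy; apply/(tangent_tau _ Cy).
    have d := sm_diff (stau Ny).
    by rewrite deriveDv // deriveZv // derive_tau_axis // scalerN [_%:A]mulr1 subrr.
  have Xv : X v = w by rewrite /X Dw scale0r addr0.
  have := hS N X oN vT (sm_smooth_on sX) tX u; rewrite Xv.
  move=> /(_ ((tangent_tau u Cv).2 Du)) /(tangent_tau _ Cv).
  have dD := sm_diff (sm_D w st).
  have -> : 'D_u X v = 'D_u (fun y => 'D_w tau y) v *: T.
    have [dz Ez] := diff_scale u dD (differentiable_cst T v).
    rewrite (@deriveD _ _ _ (cst w) (fun y => 'D_w tau y *: T)).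
    - by rewrite derive_cst add0r deriveE // Ez diff_cst scaler0 add0r -deriveE.
    - exact: derivable_cst.
    - exact: diff_derivable.
  have d := sm_diff st.
  rewrite -scaleNr deriveDv // !deriveZv // derive_tau_axis // -![_ *: _]/(_ * _).
  move=> /eqP; rewrite mulrN1 addrC subr_eq0 => /eqP <-.
  by rewrite mulNr mulrC mulNr.
- by move=> u Du; apply: hpos; apply/tangent_tau.
- move=> u Du H; apply/hrad; split; first exact/tangent_tau.
  by move=> w /(tangent_tau _ Cv); exact: H.
Qed.

(** A null vector of a positive semi-definite form belongs to its radical, and the radical is
    spanned by [v]. *)
Lemma hess_tau_C v u : C v -> 'D_u tau v = 0 ->
  0 <= 'D_u (fun y => 'D_u tau y) v /\
  ('D_u (fun y => 'D_u tau y) v = 0 -> exists a : R, u = a *: v).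
Proof.
move=> Cv Du; have vT := C_off_axis Cv; have st := stau vT.
have d := sm_diff st.
have [k [h [k0 hE hpos hrad]]] := second_fundamental_form_tau Cv.
have Dpos w : 'D_w tau v = 0 -> 0 <= 'D_w (fun y => 'D_w tau y) v.
  by move=> Dw; rewrite hE // mulr_ge0 ?hpos // ltW.
split=> [|Hu]; first exact: Dpos.
apply: hrad => // w Dw.
pose b u w := 'D_u (fun y => 'D_w tau y) v.
have bs x y : b x y = b y x by apply: derive_sym.
have bl a x y z : b (a *: x + y) z = a * b x z + b y z by exact: hess_lin.
have br a x y z : b z (a *: x + y) = a * b z x + b z y by rewrite bs bl !(bs z).
have bE : forall x y, 'D_x (fun z => 'D_y tau z) v = b x y := fun x y => erefl.
suff bw : b u w = 0.
  by apply: (mulfI (lt0r_neq0 k0)); rewrite mulr0 -hE.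
rewrite bE in Hu; have {}Dpos x : 'D_x tau v = 0 -> 0 <= b x x by exact: Dpos.
clearbody b.
apply: (@quad_nonneg _ (b u w) (b w w)); first exact: Dpos.
move=> s; have Ds : 'D_(s *: w + u) tau v = 0 by rewrite deriveDv // deriveZv // Dw Du scaler0 addr0.
have := Dpos _ Ds; rewrite bl !br (bs w u) Hu addr0.
move: (b u w) (b w w) => x y.
by have -> : s * (s * y + x) + s * x = s * (2 * x) + s ^+ 2 * y by ring.
Qed.

(* Along the axis [tau] is affine, so its Hessian may be computed on the cone. *)
Lemma hess_tau v u : off_axis T v ->
  0 <= 'D_u (fun y => 'D_u tau y) v /\
  ('D_u (fun y => 'D_u tau y) v = 0 -> exists a b : R, u = a *: v + b *: T).
Proof.
move=> vT; pose z := v + tau v *: T.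
have Cz : C z by exact: Ctau.
have zT := C_off_axis Cz; have sz := stau zT; have dz := sm_diff sz.
have D1 w y : off_axis T y -> 'D_w tau (y + tau v *: T) = 'D_w tau y.
  move=> yT; have yT' := off_axis_add (a := tau v) yT.
  have ds := derive_shiftE (@diff_derivable _ _ _ _ _ w (sm_diff (stau yT'))).
  rewrite -(@derive_val _ _ _ _ _ _ _ ds).
  have E : \forall x \near y, tau x - tau v = tau (x + tau v *: T).
    by apply: filterS (on yT) => x xT; rewrite tau_shift.
  rewrite -(near_eq_derive _ E).
  rewrite (@deriveB _ _ _ tau (cst (tau v))) ?derive_cst ?subr0 //.
  by apply: diff_derivable; apply: sm_diff; exact: stau.
have D2 x w : 'D_x (fun y => 'D_w tau y) z = 'D_x (fun y => 'D_w tau y) v.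
  have dD := sm_diff (sm_D w sz).
  have ds := derive_shiftE (@diff_derivable _ _ _ _ _ x dD).
  rewrite -(@derive_val _ _ _ _ _ _ _ ds); apply: near_eq_derive.
  by apply: filterS (on vT) => y yT; exact: D1.
pose b u w := 'D_u (fun y => 'D_w tau y) z.
have bs x y : b x y = b y x by apply: derive_sym.
have bl a x y w : b (a *: x + y) w = a * b x w + b y w by exact: hess_lin.
have br a x y w : b w (a *: x + y) = a * b w x + b w y by rewrite bs bl !(bs w).
have bT w : b w T = 0.
  rewrite /b; have -> : 'D_w (fun y => 'D_T tau y) z = 'D_w (cst (-1 : R)) z; last by rewrite derive_cst.
  apply: near_eq_derive; apply: filterS (on zT) => y yT.
  by rewrite derive_tau_axis.
have bE : forall x y, 'D_x (fun z' => 'D_y tau z') z = b x y := fun x y => erefl.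
clearbody b.
(* The projection of [u] to the tangent space at [z] along [T]; it has the same Hessian value
   because [T] lies in the radical of the Hessian. *)
pose u' := 'D_u tau z *: T + u.
have Du' : 'D_u' tau z = 0.
  by rewrite deriveDv // deriveZv // derive_tau_axis // scalerN [_%:A]mulr1 addNr.
have bu : b u' u' = 'D_u (fun y => 'D_u tau y) v.
  rewrite /u' bl !br [b T u]bs; move: ('D_u tau z) => k.
  by rewrite !(bT, mulr0, add0r) -D2 bE.
have [H1 H2] := hess_tau_C Cz Du'; rewrite bE bu in H1 H2; split => // /H2[a Ea].
exists a, (a * tau v - 'D_u tau z).
apply: (addrI ('D_u tau z *: T)); rewrite -/u' Ea /z.
by rewrite scalerDr scalerBl scalerA addrCA; congr (_ + _); rewrite addrC subrK.
Qed.

(** Sublinearity gives [tau (v + t u) <= tau v + t tau u] for [t > 0], which bounds the slope at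
    [v]. *)
Lemma derive_tau_le u v : off_axis T u -> off_axis T v -> 'D_u tau v <= tau u.
Proof.
move=> uT vT; rewrite leNgt; apply/negP => lt_u.
have d := sm_diff (stau vT).
have d0 : differentiable tau (v + (0 : R) *: u) by rewrite scale0r addr0.
have dl := is_derive_line (@diff_derivable _ _ _ _ _ u d0).
pose f (s : R) := tau (v + s *: u) - (tau v + s * tau u).
have dm : is_derive (0 : R) 1 (fun s : R => tau v + s * tau u) (tau u).
  have := is_deriveD (is_derive_cst (tau v) (0 : R) (1 : R))
    (is_deriveM (is_derive_id (0 : R) (1 : R)) (is_derive_cst (tau u) (0 : R) (1 : R))).
  by move/is_derive_eq; apply; rewrite /= scale0r !add0r -[_ *: _]/(_ * _) mulr1.
have df := is_deriveB dl dm.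
have Df : 0 < 'D_(1 : R) f (0 : R).
  by rewrite (@derive_val _ _ _ _ _ _ _ df) scale0r addr0 subr_gt0.
have dif : differentiable f (0 : R) by apply/derivable1_diffP; have [] := df.
have f0 : f 0 = 0 by rewrite /f scale0r addr0 mul0r addr0 subrr.
have [e1 e10 H1] := derive_pos_near dif f0 Df.
have : \forall t \near (0 : R), off_axis T (v + t *: u).
  by apply: (sm_cont (sm_line v u 0)); rewrite scale0r addr0; exact: on.
move=> /nbhs_normP[e2 /= e20 H2].
pose t := Num.min e1 e2 / 2.
have m0 : 0 < Num.min e1 e2 by rewrite !lt_min e10 e20.
have t0 : 0 < t by rewrite divr_gt0.
have : t < Num.min e1 e2 by rewrite ltr_pdivrMr // ltr_pMr // ltr1n.
rewrite !lt_min => /andP[te1 te2]; clearbody t.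
have tT : off_axis T (v + t *: u) by apply: H2; rewrite /= sub0r normrN gtr0_norm.
have := H1 t; rewrite t0 te1 => /(_ isT); rewrite [_%:A]mulr1 add0r /f subr_gt0.
apply/negP; rewrite -leNgt -tau_scale //.
by apply: tau_subadd => //; apply: off_axis_scale => //; rewrite gt_eqF.
Qed.

(* A supporting functional of the cone: minus half the sum of the differentials
   of [tau] at two opposite points, which are tangent to the cone along two
   different rays. *)
Definition support_form (e v : V) : R := - 2^-1 * ('D_v tau e + 'D_v tau (- e)).

Lemma support_form_lin e a u v : off_axis T e ->
  support_form e (a *: u + v) = a * support_form e u + support_form e v.
Proof.
move=> eT; have eN : off_axis T (- e) by rewrite -scaleN1r; apply: off_axis_scale => //; rewrite oppr_eq0 oner_eq0.
have d1 := sm_diff (stau eT); have d2 := sm_diff (stau eN).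
rewrite /support_form !deriveDv // !deriveZv // -![_ *: _]/(_ * _).
ring.
Qed.

Lemma support_form_axis e : off_axis T e -> support_form e T = 1.
Proof.
move=> eT; have eN : off_axis T (- e) by rewrite -scaleN1r; apply: off_axis_scale => //; rewrite oppr_eq0 oner_eq0.
by rewrite /support_form !derive_tau_axis //; lra.
Qed.

(** This is the equality case of [derive_tau_le]: close to [e], [tau] is constant on the ray from
    [e] along [u], bounded above by subadditivity and below by its differential at [e]. *)
Lemma derive2_flat_ray e u : off_axis T e -> off_axis T u -> tau u = 0 -> 'D_u tau e = 0 ->
  'D_u (fun y => 'D_u tau y) e = 0.
Proof.
move=> eT uT u0 Du; have st := stau eT; have d := sm_diff st.
have : \forall t \near (0 : R), off_axis T (e + t *: u).
  by apply: (sm_cont (sm_line e u 0)); rewrite scale0r addr0; exact: on.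
move=> /nbhs_normP[e2 /= e20 H2].
have off (s : R) : 0 <= s -> s < e2 -> off_axis T (e + s *: u).
  by move=> s0 se; apply: H2; rewrite /= sub0r normrN ger0_norm.
have const (s : R) : 0 < s -> s < e2 -> tau (e + s *: u) = tau e.
  move=> s0 se; have sT := off s (ltW s0) se; apply/eqP; rewrite eq_le; apply/andP; split.
    apply: le_trans (tau_subadd eT (off_axis_scale uT _) sT) _; first by rewrite gt_eqF.
    by rewrite tau_scale // u0 mulr0 addr0.
  have := derive_tau_le sT eT.
  by rewrite deriveDv // deriveZv // derive_tau_self // Du scaler0 addr0.
have Ds (s : R) : 0 < s -> s < e2 -> 'D_u tau (e + s *: u) = 0.
  move=> s0 se; have sT := off s (ltW s0) se.
  rewrite -derive_line; last exact: sm_diff (stau sT).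
  rewrite -(derive_cst (tau e) s (1 : R)); apply: near_eq_derive.
  have n1 : \forall t \near s, 0 < t by apply: (@cvgr_gt R R (nbhs s) _ id s cvg_id).
  have n2 : \forall t \near s, t < e2 by apply: (@cvgr_lt R R (nbhs s) _ id s cvg_id).
  by apply: filterS2 n1 n2 => t t0 te; exact: const.
have sD := sm_D u st.
apply/eqP; rewrite eq_le; apply/andP; split; rewrite leNgt; apply/negP => Dp.
  have [e1 e10 H1] := derive_pos_near (sm_diff sD) Du Dp.
  pose t := Num.min e1 e2 / 2.
  have m0 : 0 < Num.min e1 e2 by rewrite !lt_min e10 e20.
  have t0 : 0 < t by rewrite divr_gt0.
  have : t < Num.min e1 e2 by rewrite ltr_pdivrMr // ltr_pMr // ltr1n.
  rewrite !lt_min => /andP[te1 te2]; clearbody t.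
  by have := H1 t; rewrite t0 te1 => /(_ isT); rewrite Ds // ltxx.
have sN := sm_opp sD.
have DN : 0 < 'D_u (fun y => - 'D_u tau y) e.
  rewrite (_ : 'D_u _ e = - 'D_u (fun y => 'D_u tau y) e) ?oppr_gt0 //.
  by apply: deriveN; apply: diff_derivable; exact: sm_diff.
have N0 : - 'D_u tau e = 0 by rewrite Du oppr0.
have [e1 e10 H1] := derive_pos_near (f := fun y => - 'D_u tau y) (sm_diff sN) N0 DN.
pose t := Num.min e1 e2 / 2.
have m0 : 0 < Num.min e1 e2 by rewrite !lt_min e10 e20.
have t0 : 0 < t by rewrite divr_gt0.
have : t < Num.min e1 e2 by rewrite ltr_pdivrMr // ltr_pMr // ltr1n.
rewrite !lt_min => /andP[te1 te2]; clearbody t.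
by have := H1 t; rewrite t0 te1 => /(_ isT); rewrite Ds // oppr0 ltxx.
Qed.

(** Off the axis, both differentials are at most [tau u <= 0]. If both vanish on [u], so does the
    Hessian at [e], and [u] lies in the plane of [e] and [T]. Then [tau (- e) = - tau e]: the points
    of [C] on the lines through [e] and [- e] are opposite, which a cone excludes. *)
Lemma support_form_pos e u : off_axis T e -> closure A u -> u <> 0 -> 0 < support_form e u.
Proof.
move=> eT cu u0.
have eN : off_axis T (- e) by rewrite -scaleN1r; apply: off_axis_scale => //; rewrite oppr_eq0 oner_eq0.
have d1 := sm_diff (stau eT); have d2 := sm_diff (stau eN).
have [uT|] := pselect (off_axis T u); last first.
  move=> /existsNP[c /contrapT uE].
  have c0 : 0 < c.
    rewrite ltNge; apply/negP; rewrite le_eqVlt => /orP[/eqP c0|c0].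
      by apply: u0; rewrite uE c0 scale0r.
    apply: (weak_cone_opp wc AT).
    have -> : - T = (- c)^-1 *: u.
      by rewrite uE scalerA invrN mulNr mulVf ?scaleN1r // lt_eqF.
    by apply: (weak_cone_closureZ wc) => //; rewrite invr_gt0 oppr_gt0.
  have := support_form_lin c T 0 eT; rewrite addr0 -uE => ->.
  rewrite support_form_axis // mulr1 /support_form.
  by rewrite !(deriveE 0) // !linear0 addr0 mulr0 addr0.
have tu : tau u <= 0 by apply/(tau_closure 0 uT); rewrite scale0r addr0.
have l1 := derive_tau_le uT eT; have l2 := derive_tau_le uT eN.
rewrite /support_form lt_neqAle; apply/andP; split; last first.
  by rewrite mulNr oppr_ge0 pmulr_rle0 ?invr_gt0 //; move: l1 l2 tu; lra.
apply/negP => /eqP E; have {}E : 'D_u tau e + 'D_u tau (- e) = 0.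
  by move: E; lra.
have D1 : 'D_u tau e = 0 by move: E l1 l2 tu; lra.
have D2 : 'D_u tau (- e) = 0 by move: E l1 l2 tu; lra.
have t0 : tau u = 0 by move: l1 tu; rewrite D1; lra.
have [a [b Eu]] := (hess_tau u eT).2 (derive2_flat_ray eT uT t0 D1).
have E1 : a * tau e = b.
  move: D1; rewrite {1}Eu deriveDv // !deriveZv // derive_tau_self // derive_tau_axis //.
  by rewrite -![_ *: _]/(_ * _) mulrN1 => /eqP; rewrite subr_eq0 => /eqP.
have E2 : - (a * tau (- e)) = b.
  move: D2; rewrite {1}Eu deriveDv // !deriveZv // derive_tau_axis //.
  have -> : 'D_e tau (- e) = - tau (- e).
    have -> : e = (-1 : R) *: (- e) by rewrite scaleN1r opprK.
    by rewrite deriveZv // ?scaleN1r ?opprK // derive_tau_self.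
  by rewrite -![_ *: _]/(_ * _) mulrN1 mulrN => /eqP; rewrite subr_eq0 => /eqP.
have a0 : a <> 0.
  by move=> a0; apply: u0; rewrite Eu -E1 a0 mul0r !scale0r addr0.
have te : tau (- e) = - tau e.
  apply: (mulfI (introN eqP a0)); rewrite mulrN E1 -E2 opprK //.
have Ce := Ctau eT; have CNe := Ctau eN.
case: wc => _ _ _ _ [_ /(_ _ Ce) + _]; apply.
by rewrite opprD -scaleNr -te.
Qed.

End Tau.
End FibreCalculus.

(** * The Lorentz-Finsler metric on a fibre *)

Section DerivationRules.
Context {R : realType} {V : normedModType R}.

Lemma sm_is_derive (f : V -> R) x v : sm f x -> is_derive x v f ('D_v f x).
Proof. by move=> sf; apply: derivableP; apply: diff_derivable; exact: sm_diff. Qed.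

Lemma is_derive_mul (f g : V -> R) x v df dg :
  is_derive x v f df -> is_derive x v g dg ->
  is_derive x v (fun y => f y * g y) (f x * dg + g x * df).
Proof. by move=> hf hg; exact: (is_deriveM hf hg). Qed.

Lemma is_derive_add (f g : V -> R) x v df dg :
  is_derive x v f df -> is_derive x v g dg ->
  is_derive x v (fun y => f y + g y) (df + dg).
Proof. by move=> hf hg; exact: (is_deriveD hf hg). Qed.

Lemma is_derive_sub (f g : V -> R) x v df dg :
  is_derive x v f df -> is_derive x v g dg ->
  is_derive x v (fun y => f y - g y) (df - dg).
Proof. by move=> hf hg; exact: (is_deriveB hf hg). Qed.

Lemma is_derive_uniq (f : V -> R) x v a b :
  is_derive x v f a -> is_derive x v f b -> a = b.
Proof.
by move=> ha hb; rewrite -(@derive_val _ _ _ _ _ _ _ ha) (@derive_val _ _ _ _ _ _ _ hb).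
Qed.

Lemma is_derive_near (f g : V -> R) x v a :
  (\forall y \near x, f y = g y) -> is_derive x v f a -> is_derive x v g a.
Proof. exact: near_eq_is_derive. Qed.

End DerivationRules.

Lemma is_derive_comp1 {R : realType} (m s : R -> R) x dm ds :
  is_derive x (1 : R) s ds -> is_derive (s x) (1 : R) m dm ->
  is_derive x (1 : R) (fun y => m (s y)) (dm * ds).
Proof. by move=> hs hm; exact: (is_derive1_comp hm hs). Qed.

(** Obtained by differentiating [U / W * W = U]. *)
Lemma is_derive_quotient {R : realType} (U W : R -> R) x dU dW : W x != 0 ->
  is_derive x (1 : R) U dU -> is_derive x (1 : R) W dW ->
  is_derive x (1 : R) (fun y => U y / W y) ((dU - U x / W x * dW) / W x).
Proof.
move=> W0 hU hW.
have dU' : differentiable U x by apply/derivable1_diffP; have [] := hU.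
have dW' : differentiable W x by apply/derivable1_diffP; have [] := hW.
have dq : differentiable (fun y => U y / W y) x.
  apply: (@differentiableM _ _ U (fun y => (W y)^-1)) => //.
  exact: (@differentiableV _ _ W).
have hq : is_derive x (1 : R) (fun y => U y / W y) ('D_(1 : R) (fun y => U y / W y) x).
  by apply: derivableP; exact: diff_derivable.
have hp := is_derive_mul hq hW.
have E : \forall y \near x, U y / W y * W y = U y.
  have n : \forall y \near x, W y != 0.
    exact: (@cvgr_neq0 R R R (nbhs x) _ W (W x) (differentiable_continuous dW') W0).
  by apply: filterS n => y y0; rewrite divfK.
have EU := is_derive_uniq (is_derive_near E hp) hU.
by apply: (is_derive_eq hq); rewrite -EU addrC addKr mulrC mulKf.
Qed.

Section ConvexProfile.
Context {R : realType}.
Variable m : R -> R.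
Hypothesis sm_m : forall s, sm m s.
Hypothesis m_pos : forall s, 0 < m s.
Hypothesis dm_ge0 : forall s, 0 <= s -> 0 <= 'D_1 m s /\ 0 <= m s - s * 'D_1 m s.
Hypothesis ddm_ge0 : forall s, 0 <= 'D_1 (fun y => 'D_1 m y) s.

(* The second derivative is
   [m'' W s'^2 + m' U'' + (m - s m') W''] with [s = U / W]. *)
Lemma profile_convex (U W : R -> R) :
  sm U 0 -> sm W 0 -> 0 <= U 0 -> 0 < W 0 ->
  0 < 'D_1 (fun r => 'D_1 U r) 0 -> 0 < 'D_1 (fun r => 'D_1 W r) 0 ->
  0 < 'D_1 (fun r => 'D_1 (fun t => W t * m (U t / W t)) r) 0.
Proof.
move=> sU sW U0 W0 ddU ddW.
pose s (r : R) := U r / W r.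
pose mu (r : R) := 'D_1 m r.
pose k (r : R) := mu (s r) * 'D_1 U r + (m (s r) - s r * mu (s r)) * 'D_1 W r.
have nW : \forall r \near (0 : R), 0 < W r.
  exact: (@cvgr_gt R R (nbhs (0 : R)) _ W (W 0) (sm_cont sW) 0 W0).
have kE : \forall r \near (0 : R), k r = 'D_1 (fun t => W t * m (U t / W t)) r.
  apply: filterS (filterI nW (filterI (sm_diff_near sU) (sm_diff_near sW))) => r [Wr [dU dW]].
  have hU : is_derive r (1 : R) U ('D_(1 : R) U r) by apply: derivableP; exact: diff_derivable.
  have hW : is_derive r (1 : R) W ('D_(1 : R) W r) by apply: derivableP; exact: diff_derivable.
  have hs := is_derive_quotient (lt0r_neq0 Wr) hU hW.
  have hm := is_derive_comp1 hs (sm_is_derive (1 : R) (sm_m (s r))).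
  have hF := is_derive_mul hW hm.
  rewrite (@derive_val _ _ _ _ _ _ _ hF) /k -/(s r) -/(mu (s r)).
  rewrite [X in _ = W r * X + _]mulrA mulrC [W r * _]mulrC divfK; last exact: lt0r_neq0.
  move: (mu (s r)) (s r) (m (s r)) ('D_1 U r) ('D_1 W r) => a b c d e.
  ring.
rewrite -(near_eq_derive _ kE).
have hU : is_derive (0 : R) (1 : R) U ('D_(1 : R) U 0) by exact: sm_is_derive.
have hW : is_derive (0 : R) (1 : R) W ('D_(1 : R) W 0) by exact: sm_is_derive.
have hs := is_derive_quotient (lt0r_neq0 W0) hU hW.
have hm := is_derive_comp1 hs (sm_is_derive (1 : R) (sm_m (s 0))).
have hmu := is_derive_comp1 hs (sm_is_derive (1 : R) (sm_D (1 : R) (sm_m (s 0)))).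
have hDU := sm_is_derive (1 : R) (sm_D (1 : R) sU).
have hDW := sm_is_derive (1 : R) (sm_D (1 : R) sW).
have hk := is_derive_add (is_derive_mul hmu hDU)
  (is_derive_mul (is_derive_sub hm (is_derive_mul hs hmu)) hDW).
rewrite (@derive_val _ _ _ _ _ _ _ hk).
have s0 : 0 <= s 0 by rewrite divr_ge0 // ltW.
have [h1 h2] := dm_ge0 s0; have h3 := ddm_ge0 (s 0); have h4 := m_pos (s 0).
move: h1 h2 h3 h4 ddU ddW W0 s0; rewrite -/(s 0).
move: ('D_1 (fun y => 'D_1 m y) (s 0)) ('D_1 m (s 0)) (m (s 0)) => m2 m1 m0.
move: ('D_1 (fun r => 'D_1 U r) 0) ('D_1 (fun r => 'D_1 W r) 0) => U2 W2.
move: (s 0) ('D_1 U 0) ('D_1 W 0) (W 0) => s0 U1 W1 W0 {hU hW hs hm hmu hDU hDW hk nW kE k}.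
move=> h1 h2 h3 h4 U2p W2p W0p s0p.
(* The derivative of [U / W]; eliminating [U1] in its favour cancels all cross terms. *)
pose ds := (U1 - s0 * W1) / W0.
have dsE : U1 = ds * W0 + s0 * W1 by rewrite /ds divfK ?subrK // gt_eqF.
rewrite -/ds; clearbody ds; rewrite dsE.
have -> : m1 * U2 + (ds * W0 + s0 * W1) * (m2 * ds) +
   ((m0 - s0 * m1) * W2 + W1 * (m1 * ds - (s0 * (m2 * ds) + m1 * ds)))
  = m2 * W0 * ds ^+ 2 + m1 * U2 + (m0 - s0 * m1) * W2 by ring.
have t1 : 0 <= m2 * W0 * ds ^+ 2 by exact: (mulr_ge0 (mulr_ge0 h3 (ltW W0p)) (sqr_ge0 ds)).
(* Strictness: if [m1 = 0] the last term is [m0 * W2 > 0], otherwise [m1 * U2 > 0]. *)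
rewrite -addrA ltr_wpDl //; have [m10|m10] := eqVneq m1 0.
  by rewrite m10 mul0r add0r mulr0 subr0 mulr_gt0.
rewrite ltr_wpDr //; first by rewrite mulr_ge0 // ltW.
by rewrite mulr_gt0 // lt_neqAle eq_sym m10.
Qed.

End ConvexProfile.

(** * The translation-invariant gauge [tau + om] *)

Section Gauge.
Context {R : realType} {V : normedModType R}.
Hypothesis V0 : findim V.
Variables (C A : set V) (T : V) (tau om : V -> R).
Hypothesis isc : is_cone C A.
Hypothesis AT : A T.
Hypothesis Ctau : forall v, off_axis T v -> C (v + tau v *: T).
Hypothesis stau : forall v, off_axis T v -> sm tau v.
Hypothesis oml : forall a u v, om (a *: u + v) = a * om u + om v.
Hypothesis omT : om T = 1.
Hypothesis ompos : forall v, closure A v -> v <> 0 -> 0 < om v.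
Hypothesis som : forall v, sm om v.

Let wc : weak_cone C A. Proof. exact: is_cone_weak. Qed.

(** The values of [tau] on the axis are arbitrary, so 0 is prescribed there; the result descends to
    the quotient by the line of [T] and is positively homogeneous. *)
Definition gauge (v : V) : R := if `[< off_axis T v >] then tau v + om v else 0.

Let om0 : om 0 = 0.
Proof. by have := oml 1 0 0; rewrite scale1r addr0 mul1r => /eqP; rewrite addrC -subr_eq subrr => /eqP <-. Qed.
Let omZ a u : om (a *: u) = a * om u.
Proof. by have := oml a u 0; rewrite !addr0 om0 addr0. Qed.
Let omD u v : om (u + v) = om u + om v.
Proof. by have := oml 1 u v; rewrite scale1r mul1r. Qed.

Lemma gauge_off v : off_axis T v -> gauge v = tau v + om v.
Proof. by move=> vT; rewrite /gauge asboolT. Qed.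

Lemma gauge_axis (a : R) : gauge (a *: T) = 0.
Proof. by rewrite /gauge asboolF // => /(_ a). Qed.

Lemma off_axisP v : off_axis T v \/ exists a : R, v = a *: T.
Proof.
have [|/existsNP[a /contrapT ->]] := pselect (off_axis T v); first by left.
by right; exists a.
Qed.

Lemma gauge_gt0 v : off_axis T v -> 0 < gauge v.
Proof.
move=> vT; have Cz := Ctau vT; rewrite gauge_off //.
have H := ompos (weak_cone_C_closure wc Cz).
rewrite omD omZ omT mulr1 in H; rewrite addrC; apply: H.
by have [_ _] := (weak_cone_C wc _).1 Cz.
Qed.

Lemma gauge_ge0 v : 0 <= gauge v.
Proof.
by have [/gauge_gt0/ltW//|[a ->]] := off_axisP v; rewrite gauge_axis.
Qed.

Lemma gauge_shift v (a : R) : gauge (v + a *: T) = gauge v.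
Proof.
have [vT|[b ->]] := off_axisP v; last by rewrite -scalerDl !gauge_axis.
rewrite !gauge_off //; last exact: off_axis_add.
by rewrite (tau_shift isc AT Ctau) // omD omZ omT mulr1 addrA addrAC subrK.
Qed.

Lemma gauge_scale v (a : R) : 0 < a -> gauge (a *: v) = a * gauge v.
Proof.
move=> a0; have [vT|[b ->]] := off_axisP v; last by rewrite scalerA !gauge_axis mulr0.
rewrite !gauge_off //; last by apply: off_axis_scale => //; rewrite gt_eqF.
by rewrite (tau_scale isc AT Ctau) // omZ mulrDr.
Qed.

(** Holds on the axis too, where [gauge] may fail to be smooth; since [A] is open, it makes the
    sublevel sets open. *)
Lemma gauge_lt v (e : R) : 0 < e -> gauge v < e <-> A (v + (e - om v) *: T).
Proof.
move=> e0; have [vT|[b ->]] := off_axisP v.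
  rewrite gauge_off // -ltrBrDr; split=> H.
    exact/(tau_A isc AT Ctau).
  by apply/(tau_A isc AT Ctau).
rewrite gauge_axis omZ omT mulr1 -scalerDl addrC subrK; split => // _.
exact: (weak_cone_scale wc).
Qed.

Lemma gauge_C v : C v -> gauge v = om v.
Proof.
move=> Cv; rewrite gauge_off; last exact: (C_off_axis isc AT Cv).
by rewrite (tau_C isc AT Ctau) // add0r.
Qed.

Lemma gauge_A v : A v -> gauge v < om v.
Proof.
move=> Av; have v0 : v <> 0 by move=> v0; case: wc => _ + _ _ _; apply; rewrite -v0.
apply/gauge_lt; first by apply: ompos => //; exact: subset_closure.
by rewrite subrr scale0r addr0.
Qed.

Lemma sm_gauge v : off_axis T v -> sm gauge v.
Proof.
move=> vT; have s := sm_add (stau vT) (som v); apply: sm_ext s.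
by apply: filterS (off_axis_near V0 (axis_neq0 isc AT) vT) => y yT; rewrite gauge_off.
Qed.

Let derive_om v u : 'D_u om v = om u.
Proof.
have cE : (fun h : R => h^-1 *: (om (h *: u + v) - om v)) = (fun h => h^-1 * h * om u).
  apply/funext => h; rewrite oml -addrA subrr addr0.
  by rewrite -[_ *: _]/(_ * _) mulrA.
have dl := @is_derive_line R V _ om v u 0 (diff_derivable (sm_diff (som _))).
rewrite scale0r addr0 in dl; rewrite -(@derive_val _ _ _ _ _ _ _ dl).
have -> : (fun s : R => om (v + s *: u)) = (fun s => om v + s * om u).
  by apply/funext => s; rewrite omD omZ.
have dI := is_derive_add (is_derive_cst (om v) (0 : R) (1 : R))
  (is_derive_mul (is_derive_id (0 : R) (1 : R)) (is_derive_cst (om u) (0 : R) (1 : R))).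
by rewrite (@derive_val _ _ _ _ _ _ _ dI) mul0r !add0r mulr1.
Qed.

(** The second derivative is twice the sum of the squared slope and of [gauge] times its Hessian.
    Where the Hessian vanishes on [u], [u] is in the plane of [v] and [T]; as [om u = 0], the slope
    is then a non-zero multiple of [gauge v]. *)
Lemma gauge_sqr_convex v u : off_axis T v -> om u = 0 -> u <> 0 ->
  0 < 'D_u (fun y => 'D_u (fun z => gauge z ^+ 2) y) v.
Proof.
move=> vT ou u0; have sg := sm_gauge vT.
have on := off_axis_near V0 (axis_neq0 isc AT) vT.
have Dg y : off_axis T y -> 'D_u gauge y = 'D_u tau y + om u.
  move=> yT; have h := is_derive_add (sm_is_derive u (stau yT)) (sm_is_derive u (som y)).
  rewrite derive_om in h.
  rewrite -(@derive_val _ _ _ _ _ _ _ h); apply: near_eq_derive.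
  by apply: filterS (off_axis_near V0 (axis_neq0 isc AT) yT) => x xT; rewrite gauge_off.
have n1 : \forall y \near v, 2 * (gauge y * 'D_u gauge y) = 'D_u (fun z => gauge z ^+ 2) y.
  apply: filterS on => y yT.
  have h := sm_is_derive u (sm_gauge yT).
  by rewrite (@derive_val _ _ _ _ _ _ _ (is_derive_mul h h)) mulr_natl.
rewrite -(near_eq_derive _ n1).
have h1 := sm_is_derive u sg; have h2 := sm_is_derive u (sm_D u sg).
rewrite (@derive_val _ _ _ _ _ _ _ (is_derive_mul (is_derive_cst (2 : R) v u) (is_derive_mul h1 h2))).
have -> : 'D_u (fun y => 'D_u gauge y) v = 'D_u (fun y => 'D_u tau y) v.
  by apply: near_eq_derive; apply: filterS on => y yT; rewrite Dg // ou addr0.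
have [H1 H2] := hess_tau V0 isc AT Ctau stau u vT.
have gp := gauge_gt0 vT.
rewrite mulr0 addr0 pmulr_rgt0 //.
have [H0|H0] := eqVneq ('D_u (fun y => 'D_u tau y) v) 0; last first.
  rewrite ltr_wpDr //; first by rewrite -expr2 sqr_ge0.
  by rewrite mulr_gt0 // lt_neqAle eq_sym H0.
rewrite H0 mulr0 add0r -expr2 exprn_even_gt0 //=.
have [a [b Eu]] := H2 H0.
have dt := sm_diff (stau vT).
have ab : b = - (a * om v).
  move: ou; rewrite Eu oml omZ omT mulr1 => /eqP.
  by rewrite addrC addr_eq0 => /eqP.
have a0 : a != 0.
  by apply/negP => /eqP a0; apply: u0; rewrite Eu ab a0 mul0r oppr0 !scale0r addr0.
rewrite Dg // ou addr0 {1}Eu deriveDv // !deriveZv // (derive_tau_self isc AT Ctau stau) //.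
rewrite (derive_tau_axis isc AT Ctau stau) // -![_ *: _]/(_ * _) ab mulrN1 opprK -mulrDr.
by rewrite -gauge_off // mulf_neq0 // gt_eqF.
Qed.

End Gauge.

Section SecondDerivative.
Context {R : realType}.

Lemma dd_near_eq (f g : R -> R) x : (\forall y \near x, f y = g y) ->
  'D_1 (fun r => 'D_1 f r) x = 'D_1 (fun r => 'D_1 g r) x.
Proof.
move=> /near_join E; apply: near_eq_derive; apply: filterS E => y.
exact: near_eq_derive.
Qed.

Lemma dd_quadratic (a b c : R) :
  'D_1 (fun r => 'D_1 (fun t : R => a + t * b + t ^+ 2 * c) r) (0 : R) = 2 * c.
Proof.
have E1 : (fun r : R => 'D_(1 : R) (fun t : R => a + t * b + t ^+ 2 * c) r)
   = (fun r => b + r * (2 * c)).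
  apply/funext => r; have hi := is_derive_id r (1 : R).
  have h := is_derive_add (is_derive_add (is_derive_cst a r (1 : R))
     (is_derive_mul hi (is_derive_cst b r (1 : R))))
     (is_derive_mul (is_derive_mul hi hi) (is_derive_cst c r (1 : R))).
  rewrite (_ : (fun t : R => _) = (fun y => cst a y + id y * cst b y + id y * id y * cst c y)) //.
  by rewrite (@derive_val _ _ _ _ _ _ _ h) /=; ring.
rewrite E1; have hi := is_derive_id (0 : R) (1 : R).
have h := is_derive_add (is_derive_cst b (0 : R) (1 : R))
  (is_derive_mul hi (is_derive_cst (2 * c) (0 : R) (1 : R))).
by rewrite (@derive_val _ _ _ _ _ _ _ h) /=; ring.
Qed.

End SecondDerivative.

(** * Sign and Hessian of the metric on one fibre *)

Section Lorentz.
Context {R : realType} {V : normedModType R}.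
Hypothesis V0 : findim V.
Variables (C A : set V) (T : V) (tau om q : V -> R) (m : R -> R).
Hypothesis isc : is_cone C A.
Hypothesis AT : A T.
Hypothesis Ctau : forall v, off_axis T v -> C (v + tau v *: T).
Hypothesis stau : forall v, off_axis T v -> sm tau v.
Hypothesis oml : forall a u v, om (a *: u + v) = a * om u + om v.
Hypothesis omT : om T = 1.
Hypothesis ompos : forall v, closure A v -> v <> 0 -> 0 < om v.
Hypothesis som : forall v, sm om v.
Let F := gauge T tau om.
Hypothesis q_quad : forall v u, exists b : R, forall r : R,
  q (v + r *: u) = q v + r * b + r ^+ 2 * q u.
Hypothesis q_ge0 : forall v, 0 <= q v.
Hypothesis q_gt0 : forall v, om v = 0 -> v <> 0 -> 0 < q v.
Hypothesis q_le : forall v, 4 * q v <= F v ^+ 2.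
Hypothesis sq : forall v, sm q v.
Hypothesis sm_m : forall s, sm m s.
Hypothesis m_low : forall s, s <= 1 -> m s = m 0.
Hypothesis m_high : forall s, 2 <= s -> m s = s.
Hypothesis m_pos : forall s, 0 < m s.
Hypothesis m_le2 : forall s, s <= 2 -> m s <= 2.
Hypothesis dm_ge0 : forall s : R, 0 <= s -> 0 <= 'D_1 m s /\ 0 <= m s - s * 'D_1 m s.
Hypothesis ddm_ge0 : forall s : R, 0 <= 'D_1 (fun y => 'D_1 m y) s.

Let wc : weak_cone C A. Proof. exact: is_cone_weak. Qed.

(* [q] is a quadratic form dominated by the square of the gauge [F], and [wform]
   replaces that square near the axis, where it is not smooth. *)
Definition wform (v : V) : R := q v + om v ^+ 2 / 16.

Definition lorentz (v : V) : R := om v ^+ 2 - wform v * m (gauge T tau om v ^+ 2 / wform v).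

Let om0 : om 0 = 0.
Proof. by have := oml 1 0 0; rewrite scale1r addr0 mul1r => /eqP; rewrite addrC -subr_eq subrr => /eqP <-. Qed.
Let omZ a u : om (a *: u) = a * om u.
Proof. by have := oml a u 0; rewrite !addr0 om0 addr0. Qed.
Let omD u v : om (u + v) = om u + om v.
Proof. by have := oml 1 u v; rewrite scale1r mul1r. Qed.

Let F_ge0 v : 0 <= F v. Proof. exact: (gauge_ge0 isc Ctau oml omT ompos). Qed.

(** [q_quad] only describes [q] on lines. The bound by the gauge forces [q 0 = 0], and
    non-negativity kills the linear term at 0. *)
Lemma q_scale (a : R) v : q (a *: v) = a ^+ 2 * q v.
Proof.
have q0 : q 0 = 0.
  apply/eqP; rewrite eq_le q_ge0 andbT.
  have := q_le 0; rewrite /F -[X in gauge _ _ _ X](scale0r T) gauge_axis expr0n /=.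
  by rewrite pmulr_rle0.
have [b Hb] := q_quad 0 v.
have b0 : b = 0.
  have : b / 2 = 0.
    apply: (@quad_nonneg _ _ (q v)) => // s.
    have := q_ge0 (0 + s *: v); rewrite Hb q0 add0r.
    by rewrite [2 * _]mulrC divfK.
  by move=> /eqP; rewrite mulf_eq0 invr_eq0 pnatr_eq0 orbF => /eqP.
by have := Hb a; rewrite add0r q0 b0 mulr0 !add0r.
Qed.

Lemma wform_gt0 v : v <> 0 -> 0 < wform v.
Proof.
move=> v0; rewrite /wform; have [ov|ov] := eqVneq (om v) 0.
  by rewrite ov expr0n /= mul0r addr0 q_gt0.
by rewrite ltr_wpDl // divr_gt0 // exprn_even_gt0.
Qed.

Lemma wform_scale (a : R) v : wform (a *: v) = a ^+ 2 * wform v.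
Proof. by rewrite /wform q_scale omZ exprMn mulrDr mulrA. Qed.

Lemma lorentz_scale (a : R) v : 0 < a -> lorentz (a *: v) = a ^+ 2 * lorentz v.
Proof.
move=> a0; rewrite /lorentz wform_scale (gauge_scale isc AT Ctau oml) // omZ !exprMn.
rewrite -mulf_div divff ?mul1r; last by rewrite sqrf_eq0 gt_eqF.
by rewrite mulrBr; congr (_ - _); rewrite -mulrA.
Qed.

Let ratio v := F v ^+ 2 / wform v.

Let ratio_ge0 v : v <> 0 -> 0 <= ratio v.
Proof. by move=> v0; rewrite divr_ge0 ?sqr_ge0 // ltW // wform_gt0. Qed.

(** From [4 q <= F^2 <= 3 w] one gets [q <= 3 om^2 / 16], hence [om^2 >= 4 w]; as [m <= 3] on this
    range, at most [3 w] is subtracted. *)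
Lemma lorentz_pos v : v <> 0 -> ratio v <= 3 -> 0 < lorentz v.
Proof.
move=> v0 r3; have w0 := wform_gt0 v0; have r0 := ratio_ge0 v0.
have FE : F v ^+ 2 = ratio v * wform v by rewrite divfK // gt_eqF.
have qle := q_le v; rewrite /lorentz -/(F v) -/(ratio v).
have wE : wform v = q v + om v ^+ 2 / 16 by [].
have o0 : 0 <= om v ^+ 2 by rewrite sqr_ge0.
move: (ratio v) (wform v) (F v ^+ 2) (q v) (om v ^+ 2) FE wE qle w0 r0 r3 o0
  => r w f qv o FE wE qle w0 r0 r3 o0.
have w4 : w <= o / 4.
  have h : f <= 3 * w by rewrite FE ler_wpM2r // ltW.
  by move: h wE qle; lra.
have mw : w * m r <= w * 3.
  rewrite ler_wpM2l //; first exact: ltW.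
  have [r2|r2] := leP r 2; first by apply: le_trans (m_le2 r2) _; rewrite ler_nat.
  by rewrite m_high // ltW.
by move: mw w4 w0; lra.
Qed.

Lemma lorentz_high v : 2 <= ratio v -> v <> 0 -> lorentz v = om v ^+ 2 - F v ^+ 2.
Proof.
move=> r2 v0; rewrite /lorentz -/(F v) -/(ratio v) m_high // mulrC divfK //.
by rewrite gt_eqF // wform_gt0.
Qed.

(** On the cone [F = om], so [w <= om^2 / 4 + om^2 / 16] and the ratio exceeds 2: here [m] is the
    identity. *)
Lemma lorentz_C v : C v -> lorentz v = 0.
Proof.
move=> Cv; have [cv _ v0] := (weak_cone_C wc v).1 Cv.
have FE : F v = om v by exact: (gauge_C om isc AT Ctau Cv).
have op := ompos cv v0.
rewrite lorentz_high // ?FE ?subrr //.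
rewrite /ratio ler_pdivlMr ?wform_gt0 // /wform.
have := q_le v; rewrite FE; have : 0 < om v ^+ 2 by rewrite exprn_gt0.
by move: (om v ^+ 2) (q v) => o qv; lra.
Qed.

Lemma lorentz_A v : A v -> 0 < lorentz v.
Proof.
move=> Av; have v0 : v <> 0 by move=> v0; case: wc => _ + _ _ _; apply; rewrite -v0.
have [r3|r3] := leP (ratio v) 3; first exact: lorentz_pos.
rewrite lorentz_high //; last by apply: ltW; apply: lt_trans r3; rewrite ltr_nat.
have lt_F : F v < om v by exact: (gauge_A isc AT Ctau oml omT).
by rewrite subr_gt0 ltr_pXn2r // nnegrE // ltW // (le_lt_trans (F_ge0 v)).
Qed.

Let cwform v : {for v, continuous wform}.
Proof.
apply: sm_cont; apply: sm_add => //; apply: sm_mul; last exact: sm_cst.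
exact: sm_exp2.
Qed.

(** Upper semicontinuity, on the axis as well: by [gauge_lt], [F < e] is an open condition. *)
Lemma ratio_lt_near v (c : R) : v <> 0 -> 0 < c -> ratio v < c -> \forall y \near v, ratio y < c.
Proof.
move=> v0 c0 rc; have w0 := wform_gt0 v0.
have Fw : F v ^+ 2 < c * wform v by rewrite -ltr_pdivrMr.
have Fs : F v < Num.sqrt (c * wform v).
  rewrite -[F v]ger0_norm // -sqrtr_sqr ltr_sqrt //.
  by rewrite mulr_gt0.
(* Strictly between [F v] and the root, which leaves room for [F] and [wform] to vary separately. *)
pose e := (F v + Num.sqrt (c * wform v)) / 2.
have Fe : F v < e by rewrite /e; lra.
have es : e < Num.sqrt (c * wform v) by rewrite /e; lra.
have e0 : 0 < e by exact: le_lt_trans Fe.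
have e2 : e ^+ 2 < c * wform v.
  rewrite -[X in _ < X]sqr_sqrtr ?mulr_ge0 ?(ltW w0) ?(ltW c0) //.
  by rewrite ltr_pXn2r // nnegrE ?sqrtr_ge0 // ltW.
have n1 : \forall y \near v, F y < e.
  have Av : A (v + (e - om v) *: T) by apply/(gauge_lt isc AT Ctau oml omT).
  have c1 : {for v, continuous (fun y => y + (e - om y) *: T)}.
    apply: sm_cont; apply: sm_add; first exact: sm_id.
    by apply: sm_scale; [apply: sm_sub => //; exact: sm_cst|exact: sm_cst].
  have nA : \forall y \near v, A (y + (e - om y) *: T).
    exact: (c1 _ (open_nbhs_nbhs (conj (weak_cone_open wc) Av))).
  by apply: filterS nA => y Ay; apply/(gauge_lt isc AT Ctau oml omT).
have n2 : \forall y \near v, e ^+ 2 / c < wform y.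
  have h : e ^+ 2 / c < wform v by rewrite ltr_pdivrMr // mulrC.
  exact: (@cvgr_gt R V (nbhs v) _ wform (wform v) (@cwform v) _ h).
apply: filterS2 n1 n2 => y y1 y2; rewrite /ratio.
have wy : 0 < wform y by apply: le_lt_trans y2; rewrite divr_ge0 ?sqr_ge0 // ltW.
rewrite ltr_pdivrMr //; apply: (@le_lt_trans _ _ (e ^+ 2)).
  by rewrite ler_pXn2r ?nnegrE // ltW.
by rewrite mulrC -ltr_pdivrMr.
Qed.

Lemma ratio_off v : v <> 0 -> 0 < ratio v -> off_axis T v.
Proof.
move=> v0 r0 a E; move: r0; rewrite /ratio /F E gauge_axis expr0n /= mul0r.
by rewrite ltxx.
Qed.

Lemma ratio_gt_near v (c : R) : v <> 0 -> 0 <= c -> c < ratio v ->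
  \forall y \near v, c < ratio y.
Proof.
move=> v0 c0 rc; have vT := ratio_off v0 (le_lt_trans c0 rc).
have cr : {for v, continuous ratio}.
  apply: sm_cont; apply: sm_div.
  - by apply: sm_exp2; exact: (sm_gauge V0 isc AT).
  - apply: sm_add => //; apply: sm_mul; last exact: sm_cst.
    exact: sm_exp2.
  - by rewrite gt_eqF // wform_gt0.
exact: (@cvgr_gt R V (nbhs v) _ ratio (ratio v) cr _ rc).
Qed.

(* Off the axis, or where [m] is constant, [lorentz] is a smooth expression. *)
Lemma lorentz_hess_neg v u : v <> 0 -> sm lorentz v -> om u = 0 -> u <> 0 ->
  'D_u (fun y => 'D_u lorentz y) v < 0.
Proof.
move=> v0 sL ou u0; rewrite -derive_line2 //.
have qu := q_gt0 ou u0.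
have [b Hb] := q_quad v u.
have oE (r : R) : om (v + r *: u) = om v by rewrite omD omZ ou mulr0 addr0.
have wE (r : R) : wform (v + r *: u) = wform v + r * b + r ^+ 2 * q u.
  by rewrite /wform Hb oE; ring.
have v00 : v + (0 : R) *: u = v by rewrite scale0r addr0.
(* Below 1 [m] is constant nearby, and [lorentz] is a quadratic polynomial on the line; from 1 on,
   [v] is off the axis and [profile_convex] applies. *)
have [r1|r1] := ltP (ratio v) 1.
  have n : \forall r \near (0 : R),
     (om v ^+ 2 - wform v * m 0) + r * (- (b * m 0)) + r ^+ 2 * (- (q u * m 0))
      = lorentz (v + r *: u).
    have n0 : \forall y \near (v + (0 : R) *: u), ratio y < 1.
      by rewrite v00; exact: ratio_lt_near.
    have n1 : \forall r \near (0 : R), ratio (v + r *: u) < 1.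
      exact: (sm_cont (sm_line v u 0) n0).
    apply: filterS n1 => r rr.
    have -> : lorentz (v + r *: u) = om v ^+ 2 - wform (v + r *: u) * m 0.
      by rewrite /lorentz -/(F _) -/(ratio _) (m_low (ltW rr)) oE.
    by rewrite wE; ring.
  rewrite -(dd_near_eq n) dd_quadratic pmulr_rlt0 // oppr_lt0.
  exact: mulr_gt0.
have vT : off_axis T v by apply: ratio_off => //; exact: lt_le_trans r1.
pose U (r : R) := F (v + r *: u) ^+ 2.
pose W (r : R) := wform (v + r *: u).
have sF : sm (fun y => F y ^+ 2) v by apply: sm_exp2; exact: (sm_gauge V0 isc AT).
have sU : sm U 0.
  by apply: (sm_comp (g := fun y => F y ^+ 2)) => //; [exact: sm_line|rewrite v00].
have sW : sm W 0.
  apply: (sm_comp (g := wform)) => //; first exact: sm_line.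
  apply: sm_add => //; apply: sm_mul; last exact: sm_cst.
  exact: sm_exp2.
have U0 : 0 <= U 0 by rewrite sqr_ge0.
have W0 : 0 < W 0 by rewrite /W v00 wform_gt0.
have ddU : 0 < 'D_1 (fun r => 'D_1 U r) 0.
  rewrite /U (@derive_line2 _ _ (fun y => F y ^+ 2)) //.
  exact: (gauge_sqr_convex V0 isc AT Ctau stau oml omT).
have ddW : 0 < 'D_1 (fun r => 'D_1 W r) 0.
  have -> : W = (fun r => wform v + r * b + r ^+ 2 * q u) by apply/funext.
  by rewrite dd_quadratic mulr_gt0.
have H := profile_convex sm_m m_pos dm_ge0 ddm_ge0 sU sW U0 W0 ddU ddW.
pose M (t : R) := W t * m (U t / W t).
have E : (fun t : R => lorentz (v + t *: u)) = (fun t => cst (om v ^+ 2) t - M t).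
  by apply/funext => t; rewrite /lorentz oE.
have sM : sm M 0.
  apply: sm_mul => //.
  apply: (sm_comp (g := m)) => //; first exact: findimR.
  by apply: sm_div => //; rewrite gt_eqF.
rewrite E.
have n : \forall r \near (0 : R), - 'D_1 M r = 'D_1 (fun t => cst (om v ^+ 2) t - M t) r.
  apply: filterS (sm_diff_near sM) => r dM.
  have hM : is_derive r (1 : R) M ('D_(1 : R) M r) by apply: derivableP; exact: diff_derivable.
  have h := is_derive_sub (is_derive_cst (om v ^+ 2) r (1 : R)) hM.
  by rewrite (@derive_val _ _ _ _ _ _ _ h) sub0r.
rewrite -(near_eq_derive _ n).
have hD := sm_is_derive (1 : R) (sm_D (1 : R) sM).
have h := is_derive_sub (is_derive_cst (0 : R) (0 : R) (1 : R)) hD.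
have -> : (fun r => - 'D_1 M r) = (fun r : R => cst (0 : R) r - 'D_1 M r).
  by apply/funext => r; rewrite /= sub0r.
by rewrite (@derive_val _ _ _ _ _ _ _ h) sub0r oppr_lt0.
Qed.

(** Where [lorentz] is known to be positive, [v] itself serves, since homogeneity makes the second
    derivative [2 * lorentz v]. Elsewhere [lorentz = om^2 - F^2] nearby, and [T] serves, since [F]
    is invariant along [T]. *)
Lemma lorentz_hess_pos v : v <> 0 -> sm lorentz v ->
  exists w, 0 < 'D_w (fun y => 'D_w lorentz y) v.
Proof.
move=> v0 sL; have [r3|r3] := leP (ratio v) 3.
  exists v; rewrite -derive_line2 //.
  have n : \forall r \near (0 : R),
      lorentz v + r * (2 * lorentz v) + r ^+ 2 * lorentz v = lorentz (v + r *: v).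
    have n1 : \forall t \near (0 : R), -1 < t.
      by apply: (@cvgr_gt R R (nbhs (0 : R)) _ id 0 cvg_id); rewrite ltrN10.
    apply: filterS n1 => t t1; rewrite -[X in lorentz (X + _)]scale1r -scalerDl.
    rewrite lorentz_scale; first by ring.
    by rewrite -ltrBlDl sub0r.
  by rewrite -(dd_near_eq n) dd_quadratic mulr_gt0 // lorentz_pos.
exists T; rewrite -derive_line2 //.
have r2 : 2 < ratio v by apply: lt_trans r3; rewrite ltr_nat.
have v00 : v + (0 : R) *: T = v by rewrite scale0r addr0.
have n : \forall r \near (0 : R),
    (om v ^+ 2 - F v ^+ 2) + r * (2 * om v) + r ^+ 2 * 1 = lorentz (v + r *: T).
  have n0 : \forall y \near (v + (0 : R) *: T), 2 < ratio y /\ off_axis T y.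
    rewrite v00; apply: filterI; first exact: ratio_gt_near.
    apply: (off_axis_near V0 (axis_neq0 isc AT)); apply: ratio_off => //.
    exact: lt_trans r2.
  have n1 : \forall r \near (0 : R), 2 < ratio (v + r *: T) /\ off_axis T (v + r *: T).
    exact: (sm_cont (sm_line v T 0) n0).
  apply: filterS n1 => r [rr rT].
  rewrite lorentz_high ?(ltW rr) //; last first.
    by move=> E; apply: (rT 0); rewrite E scale0r.
  have -> : F (v + r *: T) = F v by exact: (gauge_shift isc AT Ctau oml omT).
  by rewrite omD omZ omT; ring.
by rewrite -(dd_near_eq n) dd_quadratic mulr1.
Qed.

End Lorentz.

Lemma hessian_index {R : realType} {n : nat} (f om : 'rV[R]_n -> R) v :
  (0 < n)%N -> sm f v ->
  (forall a u w, om (a *: u + w) = a * om u + om w) ->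
  (forall u, om u = 0 -> u <> 0 -> 'D_u (fun y => 'D_u f y) v < 0) ->
  (exists w, 0 < 'D_w (fun y => 'D_w f y) v) ->
  index_n_minus_1 (fun u w => 2^-1 * 'D_u (fun y => 'D_w f y) v).
Proof.
move=> n0 sf oml neg [w pos].
apply: (@lorentz_index R n _ _ _ om w).
- move=> a u1 u2 x; have d := sm_diff (sm_D x sf).
  by rewrite deriveDv // deriveZv // mulrDr mulrCA.
- by move=> u1 u2; rewrite (derive_sym u2 u1 sf).
- exact: n0.
- exact: oml.
- move=> u /eqP u0 ou; have := neg u ou u0.
  by move: ('D_u _ v) => d d0; rewrite pmulr_rlt0 // invr_gt0.
- by move: pos; move: ('D_w _ v) => d d0; rewrite mulr_gt0 // invr_gt0.
Qed.

(** * Gluing over a manifold *)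

Section RowVectors.
Context {R : realType}.

Lemma sm_sum_seq {V W : normedModType R} {I : Type} (s : seq I) (F : I -> V -> W) x :
  (forall i, sm (F i) x) -> sm (fun y => \sum_(i <- s) F i y) x.
Proof.
move=> sF; elim: s => [|i s IH].
  by apply: sm_ext (sm_cst (0 : W) x); near=> y; rewrite big_nil.
by apply: sm_ext (sm_add (sF i) IH); near=> y; rewrite big_cons.
Unshelve. all: by end_near. Qed.

Definition sqnorm {n} (v : 'rV[R]_n) : R := \sum_i v 0 i ^+ 2.

Lemma sm_coord n (i : 'I_n) (x : 'rV[R]_n) : sm (fun v : 'rV[R]_n => v 0 i) x.
Proof.
apply: (@sm_lin _ _ R^o (fun v : 'rV[R]_n => v 0 i)); last exact: coord_continuous.
by move=> a u v; rewrite !mxE.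
Qed.

Lemma sm_sqnorm n (x : 'rV[R]_n) : sm (@sqnorm n) x.
Proof. by apply: sm_sum_seq => i; apply: sm_exp2; exact: sm_coord. Qed.

Lemma sqnorm_ge0 n (v : 'rV[R]_n) : 0 <= sqnorm v.
Proof. by apply: sumr_ge0 => i _; rewrite sqr_ge0. Qed.

Lemma coord_le_sqnorm n (v : 'rV[R]_n) i : v 0 i ^+ 2 <= sqnorm v.
Proof. by rewrite /sqnorm (bigD1 i) //= lerDl sumr_ge0 // => j _; rewrite sqr_ge0. Qed.

Lemma sqnorm_gt0 n (v : 'rV[R]_n) : v <> 0 -> 0 < sqnorm v.
Proof.
move=> v0; rewrite lt_neqAle sqnorm_ge0 andbT; apply/negP => /eqP E; apply: v0.
apply/rowP => i; rewrite mxE; apply/eqP; rewrite -sqrf_eq0 eq_le sqr_ge0 andbT.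
by rewrite E coord_le_sqnorm.
Qed.

Lemma sqnormZ n (a : R) (v : 'rV[R]_n) : sqnorm (a *: v) = a ^+ 2 * sqnorm v.
Proof. by rewrite /sqnorm mulr_sumr; apply: eq_bigr => i _; rewrite mxE exprMn. Qed.

Lemma sqnorm_quad n (v u : 'rV[R]_n) : exists b : R, forall r : R,
  sqnorm (v + r *: u) = sqnorm v + r * b + r ^+ 2 * sqnorm u.
Proof.
exists (\sum_i 2 * (v 0 i * u 0 i)) => r.
rewrite /sqnorm !mulr_sumr -!big_split /=; apply: eq_bigr => i _.
by rewrite !mxE; ring.
Qed.

Lemma rV_norm_lt n (v : 'rV[R]_n) (r : R) : 0 < r -> (forall i, `|v 0 i| < r) -> `|v| < r.
Proof.
move=> r0 H; have [->//|v0] := eqVneq `|v| 0.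
have [[i j] /= E] := mx_norm_neq0 v0.
by change (mx_norm v < r); rewrite E (ord1 i).
Qed.

Lemma rV_box_compact n (x : 'rV[R]_n) (r : R) :
  compact [set v : 'rV[R]_n | forall i, `|v 0 i - x 0 i| <= r].
Proof.
have -> : [set v : 'rV[R]_n | forall i, `|v 0 i - x 0 i| <= r] =
    [set v : 'rV[R]_n | forall i, [set` `[x 0 i - r, x 0 i + r]] (v ord0 i)].
  apply/seteqP; split => v /= H i; have := H i; rewrite /= in_itv /= ler_distl //.
by apply: (@rV_compact R n (fun i => [set` `[x 0 i - r, x 0 i + r]])) => i; exact: segment_compact.
Qed.

End RowVectors.

Section Manifold.
Context {R : realType} {n : nat} {M : topologicalType}.
Variable At : smooth_atlas R n M.
Implicit Types (c : chart R n M) (p : M).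

Definition transition c c' := cmap c' \o cinv c.

Lemma near_chart c p : cdom c p -> \forall x \near cmap c p, ccod c x.
Proof.
by move=> cp; apply: open_nbhs_nbhs; split; [exact: ccod_open|exact: cmap_cod].
Qed.

Lemma near_cinv c x (P : set M) : ccod c x -> nbhs (cinv c x) P ->
  \forall y \near x, P (cinv c y).
Proof. by move=> cx; exact: (cinv_continuous cx). Qed.

Lemma near_cmap c p (P : set 'rV[R]_n) : cdom c p -> nbhs (cmap c p) P ->
  \forall q \near p, P (cmap c q).
Proof. by move=> cp; exact: (cmap_continuous cp). Qed.

Lemma near_cdom c p : cdom c p -> \forall q \near p, cdom c q.
Proof. by move=> cp; apply: open_nbhs_nbhs; split => //; exact: cdom_open. Qed.

Lemma sm_transition c c' x : atlas At c -> atlas At c' -> ccod c x -> cdom c' (cinv c x) ->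
  sm (transition c c') x.
Proof.
move=> Ac Ac' cx c'x.
apply: (@smooth_on_sm R _ _ (ccod c `&` cinv c @^-1` cdom c')) => //.
- exact: findim_rV.
- exact: findim_rV.
- rewrite openE => y [cy c'y]; apply: filterI.
    by apply: open_nbhs_nbhs; split => //; exact: ccod_open.
  by apply: (near_cinv cy); exact: near_cdom.
- exact: atlas_smooth Ac Ac'.
Qed.

Definition smM (f : M -> R) p := forall c, atlas At c -> cdom c p ->
  sm (f \o cinv c) (cmap c p).

Lemma smM_chart c f p : atlas At c -> cdom c p -> sm (f \o cinv c) (cmap c p) -> smM f p.
Proof.
move=> Ac cp sf c' Ac' c'p.
have c'x := cmap_cod c'p; have cx := cmap_cod cp.
have E : \forall x \near cmap c' p, (f \o cinv c) (transition c' c x) = (f \o cinv c') x.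
  have n1 : \forall x \near cmap c' p, cdom c (cinv c' x).
    by apply: (near_cinv c'x); rewrite cmapK //; exact: near_cdom.
  by apply: filterS n1 => x cdx; rewrite /transition /= cmapK.
apply: sm_ext E _; apply: (sm_comp (g := f \o cinv c)); first exact: findim_rV.
  by apply: sm_transition => //; rewrite cmapK.
by rewrite /transition /= cmapK.
Qed.

Lemma smM_ext f g p : (\forall q \near p, f q = g q) -> smM f p -> smM g p.
Proof.
move=> fg sf c Ac cp; apply: sm_ext (sf c Ac cp).
have H : \forall q \near cinv c (cmap c p), f q = g q by rewrite cmapK.
exact: (near_cinv (cmap_cod cp) H).
Qed.

Lemma smM_cst (a : R) p : smM (fun=> a) p.
Proof. by move=> c Ac cp; exact: sm_cst. Qed.

Lemma smM_sub f g p : smM f p -> smM g p -> smM (fun q => f q - g q) p.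
Proof. by move=> sf sg c Ac cp; apply: sm_sub; [exact: sf|exact: sg]. Qed.

(** Written in a chart and extended by 0. It vanishes off the image of a compact box, which is
    closed because [M] is Hausdorff, so the extension is smooth. *)
Lemma bump_function (p0 : M) (U : set M) : hausdorff_space M -> nbhs p0 U ->
  exists b : M -> R, [/\ forall p, smM b p, forall p, 0 <= b p <= 1,
    \forall p \near p0, b p = 1 & forall p, ~ U p -> \forall q \near p, b q = 0].
Proof.
move=> hM Up.
pose c := chart_at At p0; have Ac : atlas At c by exact: chart_at_atlas.
have cp0 : cdom c p0 by exact: chart_at_dom.
pose x0 := cmap c p0; have cx0 : ccod c x0 by exact: cmap_cod.
have : \forall x \near x0, ccod c x /\ U (cinv c x).
  apply: filterI; first exact: near_chart.
  by apply: (near_cinv cx0); rewrite cmapK.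
move=> /nbhs_normP[r0 /= r00 Hr].
pose r := r0 / 2; have rp : 0 < r by rewrite divr_gt0.
have rr0 : r < r0 by rewrite ltr_pdivrMr // ltr_pMr // ltr1n.
pose K := [set v : 'rV[R]_n | forall i, `|v 0 i - x0 0 i| <= r].
have KW x : K x -> ccod c x /\ U (cinv c x).
  move=> Kx; apply: Hr; rewrite /= distrC; apply: rV_norm_lt => // i.
  by rewrite !mxE; apply: le_lt_trans (Kx i) rr0.
pose S := cinv c @` K.
have clS : closed S.
  apply: compact_closed => //; apply: continuous_compact; last exact: rV_box_compact.
  apply: continuous_in_subspaceT => x; rewrite inE => /KW[cx _].
  exact: cinv_continuous.
(* [step] rises between 1 and 2; the factor 2 places these at squared distances [r ^+ 2 / 2] and
   [r ^+ 2]. *)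
pose b p := if `[< cdom c p >] then 1 - step (2 * sqnorm (cmap c p - x0) / r ^+ 2) else 0.
have r2 : 0 < r ^+ 2 by rewrite exprn_gt0.
have bS p : ~ S p -> b p = 0.
  move=> NS; rewrite /b; case: asboolP => // cp.
  rewrite step1 ?subrr // ler_pdivlMr // ler_pM2l //.
  have [i Hi] : exists i, r < `|cmap c p 0 i - x0 0 i|.
    apply: contrapT => H; apply: NS; exists (cmap c p); last by rewrite cmapK.
    by move=> i; rewrite leNgt; apply/negP => Hi; apply: H; exists i.
  apply: le_trans (coord_le_sqnorm _ i); rewrite !mxE -(real_normK (num_real (_ - _))).
  by rewrite ler_pXn2r ?nnegrE // ltW.
have nS p : ~ S p -> \forall q \near p, b q = 0.
  move=> NS; have nb : \forall q \near p, (~` S) q.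
    by apply: open_nbhs_nbhs; split => //; exact: closed_openC.
  by apply: filterS nb => q; exact: bS.
have sx x : sm (fun x => 1 - step (2 * sqnorm (x - x0) / r ^+ 2)) x.
  apply: sm_sub; first exact: sm_cst.
  apply: (sm_comp (g := step)); [exact: findimR| |exact: sm_step].
  apply: sm_mul; last exact: sm_cst.
  apply: sm_mul; first exact: sm_cst.
  apply: (sm_comp (g := @sqnorm R n)); [exact: findim_rV| |exact: sm_sqnorm].
  by apply: sm_sub; [exact: sm_id|exact: sm_cst].
exists b; split.
- move=> p; have [cp|Ncp] := pselect (cdom c p).
    apply: (smM_chart Ac cp); apply: sm_ext (sx (cmap c p)).
    apply: filterS (near_chart cp) => x cx.
    by rewrite /b /= asboolT ?cinvK //; exact: cinv_dom.
  apply: (@smM_ext (fun=> 0)); last exact: smM_cst.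
  have NS : ~ S p by move=> [x /KW[cx _] E]; apply: Ncp; rewrite -E; exact: cinv_dom.
  by apply: filterS (nS p NS) => q ->.
- move=> p; rewrite /b; case: asboolP => _; last by rewrite lexx ler01.
  by rewrite subr_ge0 step_le1 lerBlDr lerDl step_ge0.
- have n1 : \forall x \near x0, 2 * sqnorm (x - x0) / r ^+ 2 < 1.
    have s : sm (fun x => 2 * sqnorm (x - x0) / r ^+ 2) x0.
      apply: sm_mul; last exact: sm_cst.
      apply: sm_mul; first exact: sm_cst.
      apply: (sm_comp (g := @sqnorm R n)); [exact: findim_rV| |exact: sm_sqnorm].
      by apply: sm_sub; [exact: sm_id|exact: sm_cst].
    apply: (@cvgr_lt R _ (nbhs x0) _ _ _ (sm_cont s)).
    by rewrite subrr /sqnorm big1 ?mulr0 ?mul0r ?ltr01 // => i _; rewrite mxE expr0n.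
  apply: filterS2 (near_cdom cp0) (near_cmap cp0 n1) => q cq q1.
  by rewrite /b asboolT // step0 ?subr0 // ltW.
- move=> p NU; apply: nS => -[x /KW[_ Ux] E]; apply: NU.
  by rewrite -E.
Qed.

Section Glue.
Variable E : lmodType R.
Variable Sm : M -> (M -> E) -> Prop.
Variable K : M -> set E.
Hypothesis Sm_ext : forall p s s', (\forall q \near p, s q = s' q) -> Sm p s -> Sm p s'.
Hypothesis Sm_0 : forall p, Sm p (fun=> 0).
Hypothesis Sm_add : forall p s s', Sm p s -> Sm p s' -> Sm p (fun q => s q + s' q).
Hypothesis Sm_scale : forall p f s, smM f p -> Sm p s -> Sm p (fun q => f q *: s q).
Hypothesis K_convex : forall p x y (t : R), 0 <= t <= 1 -> K p x -> K p y ->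
  K p (t *: x + (1 - t) *: y).

(** Each [b m] mixes [s m] with all that follows, so a term with [b j = 1] hides the later ones and
    the weights sum to 1 without normalisation. *)
Fixpoint telescope (b : nat -> M -> R) (s : nat -> M -> E) (k m : nat) (p : M) : E :=
  if k is k'.+1 then
    b m p *: s m p + (1 - b m p) *: telescope b s k' m.+1 p
  else 0.

Lemma telescope_stable b s j k k' m p : b j p = 1 -> (m <= j)%N ->
  (j < m + k)%N -> (j < m + k')%N -> telescope b s k m p = telescope b s k' m p.
Proof.
move=> bj; elim: k k' m => [|k IH] [|k'] m mj jk jk' /=.
- by [].
- by move: jk; rewrite addn0 ltnNge mj.
- by move: jk'; rewrite addn0 ltnNge mj.
have [E1|ne] := eqVneq m j; first by rewrite E1 bj subrr !scale0r.
by rewrite (IH k') // ?addSnnS // ltn_neqAle ne.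
Qed.

(* With bump functions [b j], the infinite sum of
   [b j * (1 - b 0) * ... * (1 - b (j - 1))] is locally finite, and equal to 1. *)
Lemma glue_sections : hausdorff_space M -> @second_countable M ->
  (forall p0, exists s, \forall p \near p0, Sm p s /\ K p (s p)) ->
  exists s, forall p, Sm p s /\ K p (s p).
Proof.
move=> hM [BB cBB [oB bB]] loc.
have [sl Hsl] := choice loc.
have bex p0 := bump_function hM (Hsl p0).
have [bl Hbl] := choice bex.
have /countable_injP[ix ixinj] := cBB.
(* Reduction to countably many pieces: for each basic open set, a point is chosen whose bump
   function is 1 on it, if there is one. *)
pose good j p0 := exists O, [/\ BB O, ix O = j & forall q, O q -> bl p0 q = 1].
have gex j : exists o : option M, (exists2 p0, o = Some p0 & good j p0) \/
    (o = None /\ forall p0, ~ good j p0).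
  have [[p0 gp]|H] := pselect (exists p0, good j p0).
    by exists (Some p0); left; exists p0.
  by exists None; right; split => // p0 gp; apply: H; exists p0.
have [g Hg] := choice gex.
pose b j p := if g j is Some p0 then bl p0 p else 0.
pose s j p := if g j is Some p0 then sl p0 p else 0.
have sb j p : smM (b j) p.
  by rewrite /b; case: (g j) => [p0|]; [have [] := Hbl p0|exact: smM_cst].
have b01 j p : 0 <= b j p <= 1.
  by rewrite /b; case: (g j) => [p0|]; [have [_ +] := Hbl p0; exact|rewrite lexx ler01].
have supp j p : (\forall q \near p, b j q = 0) \/ (Sm p (s j) /\ K p (s j p)).
  rewrite /b /s; case: (g j) => [p0|]; last by left; near=> q.
  have [[S1 K1]|N1] := pselect (Sm p (sl p0) /\ K p (sl p0 p)); first by right.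
  by left; have [_ _ _] := Hbl p0; exact.
have cover p : exists j, \forall q \near p, b j q = 1.
  have [_ _ n1 _] := Hbl p.
  have [ O1 [BO Op] OP] := bB p _ n1.
  have gO : good (ix O1) p by exists O1; split.
  exists (ix O1); have [[p0 gE [ O2 [BO2 ixE HO2]]]|[_ /(_ p)//]] := Hg (ix O1).
  have EO : O2 = O1 by apply: ixinj => //; exact/mem_set.
  rewrite /b gE; have nO : \forall q \near p, O1 q.
    by apply: open_nbhs_nbhs; split => //; exact: oB.
  by apply: filterS nO => q Oq; apply: HO2; rewrite EO.
have [N HN] := choice cover.
have SmT k m p : Sm p (telescope b s k m).
  elim: k m => [|k IH] m /=; first exact: Sm_0.
  apply: Sm_add; last first.
    by apply: Sm_scale => //; apply: smM_sub; [exact: smM_cst|exact: sb].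
  have [z|[S1 _]] := supp m p; last exact: Sm_scale.
  by apply: Sm_ext (Sm_0 p); apply: filterS z => q ->; rewrite scale0r.
have KT k m p j : b j p = 1 -> (m <= j)%N -> (j < m + k)%N -> K p (telescope b s k m p).
  move=> bj; elim: k m => [|k IH] m mj jk /=.
    by move: jk; rewrite addn0 ltnNge mj.
  have [E0|ne] := eqVneq (b m p) 0.
    rewrite E0 scale0r add0r subr0 scale1r; apply: IH; last by rewrite addSnnS.
    rewrite ltn_neqAle mj andbT; apply/eqP => mE.
    by move: bj; rewrite -mE E0 => /eqP; rewrite eq_sym oner_eq0.
  have Ks : K p (s m p).
    by have [z|[_ //]] := supp m p; move: ne; rewrite (nbhs_singleton z) eqxx.
  have [E1|ne1] := eqVneq (b m p) 1.
    by rewrite E1 subrr scale0r addr0 scale1r.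
  apply: K_convex => //; apply: IH; last by rewrite addSnnS.
  rewrite ltn_neqAle mj andbT; apply/eqP => mE.
  by move: ne1; rewrite mE bj eqxx.
have NE p : b (N p) p = 1 := nbhs_singleton (HN p).
(* The number of terms depends on [p], but at [q] near [p] both [b (N p)] and [b (N q)] are 1, so
   [(N p).+1] and [(N q).+1] terms give the same value. *)
exists (fun p => telescope b s (N p).+1 0 p) => p; split; last by apply: (KT _ _ _ (N p)).
apply: Sm_ext (SmT (N p).+1 0%N p); apply: filterS (HN p) => q bq.
pose k := (maxn (N p) (N q)).+1.
rewrite (@telescope_stable b s (N p) _ k 0 q) //; last by rewrite ltnS leq_maxl.
by rewrite (@telescope_stable b s (N q) _ (N q).+1 0 q) // ltnS leq_maxr.
Unshelve. all: by end_near. Qed.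

End Glue.

End Manifold.

(** * Sections over the tangent bundle *)

Section WeakConePreimage.
Context {R : realType} {V : normedModType R}.

Lemma weak_cone_preimage (f g : {linear V -> V}) (C A : set V) :
  continuous f -> continuous g -> cancel f g -> cancel g f ->
  weak_cone C A -> weak_cone (f @^-1` C) (f @^-1` A).
Proof.
move=> cf cg fg gf [oA A0 cA CE [Cs Ca [c Cc]]].
have f0 v : f v = 0 <-> v = 0.
  by split=> [E|->]; [rewrite -(fg v) E linear0|rewrite linear0].
have clE v : closure (f @^-1` A) v <-> closure A (f v).
  split=> H B nB.
    have [u [Au Bu]] := H _ (cf v _ nB); by exists (f u).
  have nB' : nbhs (f v) (g @^-1` B) by apply: cg; rewrite fg.
  have [u [Au Bu]] := H _ nB'.
  by exists (g u); split => //=; rewrite gf.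
split.
- by apply: open_comp => // x _; exact: cf.
- by rewrite /= linear0.
- by move=> u v t t01 /= Au Av; rewrite linearD !linearZ /=; exact: cA.
- rewrite CE; apply/seteqP; split=> v /=.
    by move=> [[/clE cv Nv] v0]; split=> // E; apply: v0; apply/f0.
  by move=> [[/clE cv Nv] v0]; split=> // /f0.
- split.
  + by move=> v a /= Cv a0; rewrite linearZ; exact: Cs.
  + by move=> v /= Cv; rewrite linearN; exact: Ca.
  + by exists (g c) => /=; rewrite gf.
Qed.

Lemma off_axis_near_joint {B : normedModType R} (X : B -> V) x w :
  findim B -> findim V -> sm X x -> X x <> 0 -> off_axis (X x) w ->
  \forall z \near (x, w), off_axis (X z.1) z.2.
Proof.
move=> B0 V0 sX X0 wX; have [k [b [c [lc cc cE]]]] := V0.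
have [i ci] : exists i, c i (X x) <> 0.
  apply: contrapT => H; apply: X0; rewrite (cE (X x)) big1 // => i _.
  rewrite (_ : c i (X x) = 0) ?scale0r //; apply: contrapT => ci.
  by apply: H; exists i.
have sc v : sm (c i) v by apply: (@sm_lin R V R^o (c i)); [exact: lc|exact: cc].
have cA a v : c i (a *: v) = a * c i v.
  have c0 : c i 0 = 0.
    have := lc i 1 0 0; rewrite scale1r addr0 mul1r => /eqP.
    by rewrite addrC -subr_eq subrr => /eqP <-.
  by rewrite -[a *: v]addr0 lc c0 addr0.
have sXf : sm (fun z : B * V => X z.1) (x, w).
  by apply: (sm_comp (g := X)) => //; exact: sm_fst.
have s1 : sm (fun z : B * V => c i (X z.1)) (x, w).
  exact: (sm_comp (g := c i) V0 sXf (sc _)).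
have s2 : sm (fun z : B * V => c i z.2) (x, w).
  exact: (sm_comp (g := c i) V0 (sm_snd _) (sc _)).
pose f (z : B * V) := z.2 - (c i z.2 / c i (X z.1)) *: X z.1.
have cf : {for (x, w), continuous f}.
  apply: sm_cont; apply: sm_sub; first exact: sm_snd.
  by apply: sm_scale => //; apply: sm_div => //; exact/eqP.
have fv : f (x, w) != 0 by rewrite subr_eq0; apply/eqP; exact: wX.
have n1 : \forall y \near (x, w), f y != 0.
  exact: (@cvgr_neq0 R V (B * V)%type (nbhs (x, w)) _ f (f (x, w)) cf fv).
have n2 : \forall y \near (x, w), c i (X y.1) != 0.
  exact: (@cvgr_neq0 R R (B * V)%type (nbhs (x, w)) _ _ _ (sm_cont s1) (introN eqP ci)).
apply: filterS2 n1 n2 => y /eqP fy cy a ya; apply: fy.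
by rewrite /f ya cA mulfK ?subrr.
Qed.

End WeakConePreimage.

Lemma diff_chain_eq {R : realType} {U V W : normedModType R} (f : U -> V) (g : V -> W)
    (h : U -> W) x w :
  differentiable f x -> differentiable g (f x) -> differentiable h x ->
  (\forall y \near x, g (f y) = h y) -> 'd g (f x) ('d f x w) = 'd h x w.
Proof.
move=> df dg dh E; have H := diff_comp df dg.
have -> : 'd g (f x) ('d f x w) = 'd (g \o f) x w by rewrite H.
rewrite -(deriveE w (differentiable_comp df dg)) -(deriveE w dh).
exact: near_eq_derive.
Qed.

Section Bundle.
Context {R : realType} {n : nat} {M : topologicalType}.
Variable At : smooth_atlas R n M.
Implicit Types (c : chart R n M) (p : M).
Notation E := 'rV[R]_n.

Let E0 : findim E. Proof. exact: findim_rV. Qed.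
Let EE0 : findim (E * E)%type. Proof. by apply: findim_prod; exact: findim_rV. Qed.

(* The vector at [cinv c x] with coordinates [w] in the chart [c], read in the
   preferred chart at that point, as the model of the tangent bundle requires. *)
Definition tcoord c (x w : E) : E := 'd (transition c (chart_at At (cinv c x))) x w.

Lemma bundle_invE c x w : bundle_inv At c (x, w) = at_point At (cinv c x) (tcoord c x w).
Proof. by []. Qed.

Lemma transitionK c c' x : cdom c' (cinv c x) -> ccod c x ->
  transition c' c (transition c c' x) = x.
Proof. by move=> c'x cx; rewrite /transition /= cmapK // cinvK. Qed.

Lemma transition_dom c c' x : cdom c' (cinv c x) -> cinv c' (transition c c' x) = cinv c x.
Proof. by move=> c'x; rewrite /transition /= cmapK. Qed.

Lemma transition_cod c c' x : cdom c' (cinv c x) -> ccod c' (transition c c' x).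
Proof. by move=> c'x; exact: cmap_cod. Qed.

Lemma diff_transition_comp c c' c'' x w : atlas At c -> atlas At c' -> atlas At c'' ->
  ccod c x -> cdom c' (cinv c x) -> cdom c'' (cinv c x) ->
  'd (transition c' c'') (transition c c' x) ('d (transition c c') x w) =
  'd (transition c c'') x w.
Proof.
move=> Ac Ac' Ac'' cx c'x c''x.
have d1 : differentiable (transition c c') x by apply: sm_diff; exact: sm_transition Ac Ac' cx c'x.
have d2 : differentiable (transition c' c'') (transition c c' x).
  apply: sm_diff; apply: (sm_transition Ac' Ac''); first exact: transition_cod.
  by rewrite transition_dom.
have d3 : differentiable (transition c c'') x by apply: sm_diff; exact: sm_transition Ac Ac'' cx c''x.
apply: (diff_chain_eq w d1 d2 d3).
have n1 : \forall y \near x, cdom c' (cinv c y) by apply: (near_cinv cx); exact: near_cdom.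
by apply: filterS n1 => y c'y; rewrite /transition /= cmapK.
Qed.

Lemma diff_transition_id c x w : ccod c x -> 'd (transition c c) x w = w.
Proof.
move=> cx; have nE : \forall y \near x, id y = transition c c y.
  have n1 : \forall y \near x, ccod c y.
    by apply: open_nbhs_nbhs; split => //; exact: ccod_open.
  by apply: filterS n1 => y cy; rewrite /transition /= cinvK.
have dI : differentiable (transition c c) x.
  by apply: near_eq_differentiable nE _; apply: sm_diff; exact: sm_id.
by rewrite -deriveE // -(near_eq_derive _ nE) derive_id.
Qed.

Lemma bundle_inv_change c c' x w : atlas At c -> atlas At c' ->
  ccod c x -> cdom c' (cinv c x) ->
  bundle_inv At c (x, w) = bundle_inv At c' (transition c c' x, 'd (transition c c') x w).
Proof.
move=> Ac Ac' cx c'x; rewrite !bundle_invE transition_dom //; congr at_point.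
rewrite /tcoord transition_dom //.
exact: esym (@diff_transition_comp c c' _ x w Ac Ac' (chart_at_atlas _ _) cx c'x (chart_at_dom _ _)).
Qed.

Lemma tcoord_chart_at p w : tcoord (chart_at At p) (cmap (chart_at At p) p) w = w.
Proof.
rewrite /tcoord cmapK; last exact: chart_at_dom.
by apply: diff_transition_id; apply: cmap_cod; exact: chart_at_dom.
Qed.

(* Inverse to [tcoord c (cmap c p)]. *)
Definition tcoord_inv c p (v : E) : E :=
  'd (transition (chart_at At p) c) (cmap (chart_at At p) p) v.

Lemma tcoordK c x w : atlas At c -> ccod c x -> tcoord_inv c (cinv c x) (tcoord c x w) = w.
Proof.
move=> Ac cx; rewrite /tcoord_inv /tcoord.
have Acp := chart_at_atlas At (cinv c x).
have H := @diff_transition_comp c (chart_at At (cinv c x)) c x w Ac Acp Ac cx (chart_at_dom _ _) (cinv_dom cx).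
exact: etrans H (diff_transition_id w cx).
Qed.

Lemma tcoord_invK c x v : atlas At c -> ccod c x -> tcoord c x (tcoord_inv c (cinv c x) v) = v.
Proof.
move=> Ac cx; rewrite /tcoord_inv /tcoord; set p := cinv c x; set cp := chart_at At p.
have Acp : atlas At cp := chart_at_atlas At p.
have pp : cdom cp p := chart_at_dom At p.
have cpp : ccod cp (cmap cp p) by exact: cmap_cod.
have pc : cdom c (cinv cp (cmap cp p)) by rewrite cmapK //; exact: cinv_dom.
have pcp : cdom cp (cinv cp (cmap cp p)) by rewrite cmapK.
have H := @diff_transition_comp cp c cp (cmap cp p) v Acp Ac Acp cpp pc pcp.
have E : transition cp c (cmap cp p) = x by rewrite /transition /= cmapK // /p cinvK.
rewrite E in H; exact: etrans H (diff_transition_id v cpp).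
Qed.

Lemma tcoordZ c x (a : R) u : tcoord c x (a *: u) = a *: tcoord c x u.
Proof. by rewrite /tcoord linearZ. Qed.

Lemma tcoordD c x u v : tcoord c x (u + v) = tcoord c x u + tcoord c x v.
Proof. by rewrite /tcoord linearD. Qed.

Lemma sm_bundle_change c c' (z : E * E) : atlas At c -> atlas At c' -> ccod c z.1 ->
  cdom c' (cinv c z.1) ->
  sm (fun y : E * E => (transition c c' y.1, 'd (transition c c') (y.1) (y.2))) z.
Proof.
move=> Ac Ac' cz c'z; have st := sm_transition Ac Ac' cz c'z.
apply: sm_pair; first by apply: (sm_comp (g := transition c c')) => //; exact: sm_fst.
have sd : sm (fun y : E * E => 'D_(y.2) (transition c c') y.1) z.
  by apply: sm_diff2 => //; [exact: sm_fst|exact: sm_snd].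
apply: sm_ext sd.
have n1 : \forall y \near z, differentiable (transition c c') y.1.
  exact: (sm_cont (sm_fst z) (sm_diff_near st)).
by apply: filterS n1 => y dy; rewrite deriveE.
Qed.

Lemma near_chart_fst c (z : E * E) : ccod c z.1 -> \forall y \near z, ccod c y.1.
Proof.
move=> cz; have n1 : \forall x \near z.1, ccod c x.
  by apply: open_nbhs_nbhs; split => //; exact: ccod_open.
exact: (sm_cont (sm_fst z) n1).
Qed.

Lemma near_cinv_fst c (z : E * E) (P : set M) : ccod c z.1 -> nbhs (cinv c z.1) P ->
  \forall y \near z, P (cinv c y.1).
Proof. by move=> cz nP; exact: (sm_cont (sm_fst z) (near_cinv cz nP)). Qed.

Definition in_coord (s : M -> E -> R) c (z : E * E) : R := s (cinv c z.1) (tcoord c z.1 z.2).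

Lemma sm_in_coord_change s c c' (z : E * E) : atlas At c -> atlas At c' -> ccod c z.1 ->
  cdom c' (cinv c z.1) ->
  sm (in_coord s c') (transition c c' z.1, 'd (transition c c') (z.1) (z.2)) ->
  sm (in_coord s c) z.
Proof.
move=> Ac Ac' cz c'z ss.
have S := sm_comp (g := in_coord s c') EE0 (sm_bundle_change Ac Ac' cz c'z) ss.
apply: sm_ext S.
have n1 := near_chart_fst cz.
have n2 : \forall y \near z, cdom c' (cinv c y.1) by apply: near_cinv_fst => //; exact: near_cdom.
apply: filterS2 n1 n2 => -[y1 y2] /= cy c'y.
have := bundle_inv_change y2 Ac Ac' cy c'y; rewrite !bundle_invE => E1.
rewrite /in_coord /=.
exact: (f_equal2 s (esym (congr1 (@foot _ _ _ _) E1)) (esym (congr1 (@tvec _ _ _ _) E1))).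
Qed.

(* Smoothness near [p], in the charts of TM, of a function on TM and, below, of a
   vector field. *)
Definition SmF p (s : M -> E -> R) := forall c, atlas At c -> cdom c p ->
  forall w, sm (in_coord s c) (cmap c p, w).

Lemma SmF_chart c p s : atlas At c -> cdom c p ->
  (forall w, sm (in_coord s c) (cmap c p, w)) -> SmF p s.
Proof.
move=> Ac cp ss c' Ac' c'p w.
have c'x := cmap_cod c'p.
apply: (@sm_in_coord_change s c' c) => //=; rewrite ?cmapK //.
by rewrite /transition /= cmapK.
Qed.

Lemma SmF_ext p s s' : (\forall q \near p, s q = s' q) -> SmF p s -> SmF p s'.
Proof.
move=> ss' S c Ac cp w; apply: sm_ext (S c Ac cp w).
have cx := cmap_cod cp.
have H : \forall q \near cinv c (cmap c p, w).1, s q = s' q by rewrite /= cmapK.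
have := near_cinv_fst (z := (cmap c p, w)) cx H.
by apply: filterS => y; rewrite /in_coord => ->.
Qed.

Lemma SmF_0 p : SmF p (fun=> 0).
Proof. by move=> c Ac cp w; exact: sm_cst. Qed.

Lemma SmF_add p s s' : SmF p s -> SmF p s' -> SmF p (fun q => s q + s' q).
Proof. by move=> S S' c Ac cp w; apply: sm_add; [exact: S|exact: S']. Qed.

Lemma SmF_scale p f s : smM At f p -> SmF p s -> SmF p (fun q => f q *: s q).
Proof.
move=> sf S c Ac cp w; apply: sm_mul; last exact: S.
apply: (sm_comp (g := f \o cinv c)) => //; first exact: sm_fst.
exact: sf.
Qed.

(** The values of [X] are coordinates in preferred charts, which may jump from point to point;
    smoothness is therefore asked of the components [Xc] in a single chart. *)
Definition SmV p (X : M -> E) := forall c, atlas At c -> cdom c p ->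
  exists Xc : E -> E, sm Xc (cmap c p) /\
    \forall x \near cmap c p, tcoord c x (Xc x) = X (cinv c x).

(** The components in another chart are given by the differential of the transition map. *)
Lemma SmV_chart c p X Xc : atlas At c -> cdom c p -> sm Xc (cmap c p) ->
  (\forall x \near cmap c p, tcoord c x (Xc x) = X (cinv c x)) -> SmV p X.
Proof.
move=> Ac cp sX HX c' Ac' c'p.
have c'x := cmap_cod c'p; have cx := cmap_cod cp.
have cdx : cdom c (cinv c' (cmap c' p)) by rewrite cmapK.
have st : sm (transition c' c) (cmap c' p) by exact: sm_transition Ac' Ac c'x cdx.
have tE : transition c' c (cmap c' p) = cmap c p by rewrite /transition /= cmapK.
have c'dx : cdom c' (cinv c (cmap c p)) by rewrite cmapK.
have st' : sm (transition c c') (transition c' c (cmap c' p)).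
  by rewrite tE; exact: sm_transition Ac Ac' cx c'dx.
have sXt : sm (fun x => Xc (transition c' c x)) (cmap c' p).
  by apply: (sm_comp (g := Xc)) => //; rewrite tE.
exists (fun x => 'D_(Xc (transition c' c x)) (transition c c') (transition c' c x)).
split; first exact: sm_diff2.
have n1 : \forall x \near cmap c' p, ccod c' x by exact: near_chart.
have n2 : \forall x \near cmap c' p, cdom c (cinv c' x).
  by apply: (near_cinv c'x); rewrite cmapK //; exact: near_cdom.
have n3 : \forall x \near cmap c' p,
    tcoord c (transition c' c x) (Xc (transition c' c x)) = X (cinv c (transition c' c x)).
  have H : \forall y \near transition c' c (cmap c' p), tcoord c y (Xc y) = X (cinv c y).
    by rewrite tE.
  exact: (sm_cont st H).
apply: filterS (filterI n1 (filterI n2 n3)) => x [c'x' [cdx' E1]].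
have cy := transition_cod cdx'.
have cE := transition_dom cdx'.
have c'y : cdom c' (cinv c (transition c' c x)) by rewrite cE; exact: cinv_dom.
rewrite deriveE; last by apply: sm_diff; exact: sm_transition Ac Ac' cy c'y.
have := bundle_inv_change (Xc (transition c' c x)) Ac Ac' cy c'y.
rewrite transitionK // !bundle_invE => E2.
have := congr1 (@tvec _ _ _ _) E2; rewrite /= => <-.
by rewrite E1 cE.
Qed.

Lemma SmV_ext p s s' : (\forall q \near p, s q = s' q) -> SmV p s -> SmV p s'.
Proof.
move=> ss' S c Ac cp; have [Xc [sX HX]] := S c Ac cp; exists Xc; split => //.
have H : \forall q \near cinv c (cmap c p), s q = s' q by rewrite cmapK.
by apply: filterS2 HX (near_cinv (cmap_cod cp) H) => x -> ->.
Qed.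

Lemma SmV_0 p : SmV p (fun=> 0).
Proof.
move=> c Ac cp; exists (fun=> 0); split; first exact: sm_cst.
by apply: filterS (near_chart cp) => x _; rewrite /tcoord linear0.
Qed.

Lemma SmV_add p s s' : SmV p s -> SmV p s' -> SmV p (fun q => s q + s' q).
Proof.
move=> S S' c Ac cp; have [X [sX HX]] := S c Ac cp; have [Y [sY HY]] := S' c Ac cp.
exists (fun x => X x + Y x); split; first exact: sm_add.
by apply: filterS2 HX HY => x <- <-; rewrite tcoordD.
Qed.

Lemma SmV_scale p f s : smM At f p -> SmV p s -> SmV p (fun q => f q *: s q).
Proof.
move=> sf S c Ac cp; have [X [sX HX]] := S c Ac cp.
exists (fun x => f (cinv c x) *: X x); split.
  by apply: sm_scale => //; exact: sf.
by apply: filterS HX => x <-; rewrite tcoordZ.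
Qed.

(** Over [p], the coordinates in the preferred chart at [p] are the vector itself. *)
Lemma sm_fibre s p v : sm (in_coord s (chart_at At p)) (cmap (chart_at At p) p, v) ->
  sm (s p) v.
Proof.
move=> S.
have sp : sm (fun w : E => (cmap (chart_at At p) p, w)) v.
  by apply: sm_pair; [exact: sm_cst|exact: sm_id].
apply: sm_ext (sm_comp (g := in_coord s (chart_at At p)) EE0 sp S).
near=> w; rewrite /in_coord /= tcoord_chart_at cmapK //; exact: chart_at_dom.
Unshelve. all: by end_near. Qed.

Lemma SmF_fibre p s v : SmF p s -> sm (s p) v.
Proof. by move=> ss; apply: sm_fibre; apply: ss; [exact: chart_at_atlas|exact: chart_at_dom]. Qed.

End Bundle.

(** * Lorentz-Finsler metrics of a cone structure *)

Section ConeStructure.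
Context {R : realType} {n : nat} {M : topologicalType}.
Variable At : smooth_atlas R n M.
Variable C : set (tangent_bundle At).
Notation E := 'rV[R]_n.
Hypothesis hM : hausdorff_space M.
Hypothesis scM : @second_countable M.
Hypothesis csC : cone_structure C.
Variable Ai : M -> set E.
Hypothesis isc : forall p, is_cone (fibre C p) (Ai p).

Let E0 : findim E. Proof. exact: findim_rV. Qed.
Let EE0 : findim (E * E)%type. Proof. by apply: findim_prod; exact: findim_rV. Qed.
Let wc p : weak_cone (fibre C p) (Ai p). Proof. exact: is_cone_weak. Qed.

Definition interior_in_chart (c : chart R n M) : set (E * E) :=
  [set z | ccod c z.1 /\ Ai (cinv c z.1) (tcoord At c z.1 z.2)].

Lemma weak_cone_chart c x : atlas At c -> ccod c x ->
  weak_cone [set v | in_chart C c (x, v)] [set v | interior_in_chart c (x, v)].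
Proof.
move=> Ac cx.
have dx : differentiable (transition c (chart_at At (cinv c x))) x.
  apply: sm_diff; apply: (sm_transition Ac (chart_at_atlas _ _) cx).
  exact: chart_at_dom.
have dy : differentiable (transition (chart_at At (cinv c x)) c)
    (cmap (chart_at At (cinv c x)) (cinv c x)).
  apply: sm_diff; apply: (sm_transition (chart_at_atlas _ _) Ac).
    by apply: cmap_cod; exact: chart_at_dom.
  by rewrite cmapK; [exact: cinv_dom|exact: chart_at_dom].
have := weak_cone_preimage (diff_continuous dx) (diff_continuous dy)
  (fun w => tcoordK w Ac cx) (fun w => tcoord_invK w Ac cx) (wc (cinv c x)).
have fE : (fun w => tcoord At c x w) @^-1` (fibre C (cinv c x)) = [set v | in_chart C c (x, v)].
  by apply/seteqP; split => v; [move=> H; split|case].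
have aE : (fun w => tcoord At c x w) @^-1` (Ai (cinv c x)) =
    [set v | interior_in_chart c (x, v)].
  by apply/seteqP; split => v; [move=> H; split|case].
by rewrite -fE -aE.
Qed.

Lemma chart_equation c z : atlas At c -> ccod c z.1 -> in_chart C c z ->
  exists phi : E * E -> R, [/\ sm phi z,
    \forall y \near z, in_chart C c y <-> phi y = 0 &
    exists w : E, 'D_((0 : E), w) phi z <> 0].
Proof.
move=> Ac cz Cz; have [cs1 _ cs3] := csC.
by apply: hypersurface_equation => //; [exact: cs1|exact: cs3].
Qed.

Lemma interior_in_chart_open c x v : atlas At c -> ccod c x ->
  Ai (cinv c x) (tcoord At c x v) -> \forall y \near (x, v), interior_in_chart c y.
Proof.
move=> Ac cx Av.
apply: (cone_domain_open E0 E0 (@ccod_open _ _ _ c)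
  (fun x cx => weak_cone_chart Ac cx) (fun z cz Cz => chart_equation Ac cz Cz) cx).
by split.
Qed.

(** Locally a vector with constant components in a chart serves: it remains interior because the
    interiors form an open set in the chart. *)
Lemma axis_field : exists T : M -> E, forall p, SmV At p T /\ Ai p (T p).
Proof.
apply: (@glue_sections R n M At E (SmV At) Ai) => //.
- by move=> p s s'; exact: SmV_ext.
- exact: SmV_0.
- by move=> p s s'; exact: SmV_add.
- by move=> p f s; exact: SmV_scale.
- by move=> p x y t t01 Ax Ay; have [_ _ cA _ _] := wc p; exact: cA.
move=> p0; have [T0 AT0] := weak_cone_nonempty (wc p0).
pose c := chart_at At p0; have Ac : atlas At c by exact: chart_at_atlas.
have cp0 : cdom c p0 by exact: chart_at_dom.
exists (fun p => tcoord At c (cmap c p) T0).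
have n1 : \forall y \near (cmap c p0, T0), interior_in_chart c y.
  apply: interior_in_chart_open => //; first exact: cmap_cod.
  by rewrite tcoord_chart_at cmapK.
have sp : sm (fun x : E => (x, T0)) (cmap c p0).
  by apply: sm_pair; [exact: sm_id|exact: sm_cst].
have n2 : \forall x \near cmap c p0, interior_in_chart c (x, T0) := sm_cont sp n1.
apply: filterS2 (near_cdom cp0) (near_cmap cp0 n2) => p cp [_ /=].
rewrite cmapK // => Ap; split => //.
apply: (SmV_chart Ac cp (sm_cst T0 _)).
by apply: filterS (near_chart cp) => x cx; rewrite cinvK.
Qed.

Lemma off_axis_tcoord c x u w : atlas At c -> ccod c x ->
  off_axis (tcoord At c x u) (tcoord At c x w) <-> off_axis u w.
Proof.
move=> Ac cx; split=> H a Ea; apply: (H a); first by rewrite Ea tcoordZ.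
by rewrite -(tcoordK w Ac cx) Ea -tcoordZ tcoordK.
Qed.

Section Axis.
Variable T : M -> E.
Hypothesis sT : forall p, SmV At p T.
Hypothesis AT : forall p, Ai p (T p).

Lemma cone_height : exists tau : M -> E -> R, forall p v, off_axis (T p) v ->
  fibre C p (v + tau p v *: T p).
Proof.
have H (z : M * E) : exists t : R, off_axis (T z.1) z.2 ->
    fibre C z.1 (z.2 + t *: T z.1).
  have [oz|Nz] := pselect (off_axis (T z.1) z.2); last by exists 0.
  by have [t [Ct _ _]] := weak_cone_line (wc z.1) (AT z.1) oz; exists t.
have [tau Htau] := choice H.
by exists (fun p v => tau (p, v)) => p v; exact: (Htau (p, v)).
Qed.

Lemma axis_chart c x : atlas At c -> ccod c x -> exists Xc : E -> E,
  [/\ sm Xc x, \forall y \near x, tcoord At c y (Xc y) = T (cinv c y) & Xc x <> 0].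
Proof.
move=> Ac cx; have cp := cinv_dom cx.
have [Xc [sX HX]] := sT Ac cp; rewrite cinvK // in sX HX.
exists Xc; split => // X0; apply: (axis_neq0 (isc (cinv c x)) (AT _)).
by rewrite -(nbhs_singleton HX) X0 /tcoord linear0.
Qed.

Lemma off_axis_near_chart c x w : atlas At c -> ccod c x ->
  off_axis (T (cinv c x)) (tcoord At c x w) ->
  \forall z \near (x, w), ccod c z.1 /\ off_axis (T (cinv c z.1)) (tcoord At c z.1 z.2).
Proof.
move=> Ac cx oxw; have [Xc [sX HX X0]] := axis_chart Ac cx.
have ow : off_axis (Xc x) w.
  by apply/(off_axis_tcoord _ _ Ac cx); rewrite (nbhs_singleton HX).
have n1 := off_axis_near_joint E0 E0 sX X0 ow.
have n2 := near_chart_fst (z := (x, w)) cx.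
have n3 : \forall z \near (x, w), tcoord At c z.1 (Xc z.1) = T (cinv c z.1).
  exact: (sm_cont (sm_fst (x, w)) HX).
apply: filterS (filterI n1 (filterI n2 n3)) => z [oz [cz Ez]]; split => //.
by rewrite -Ez; apply/(off_axis_tcoord _ _ Ac cz).
Qed.

Variable tau : M -> E -> R.
Hypothesis Ctau : forall p v, off_axis (T p) v -> fibre C p (v + tau p v *: T p).

Lemma sm_height c x w : atlas At c -> ccod c x ->
  off_axis (T (cinv c x)) (tcoord At c x w) -> sm (in_coord At tau c) (x, w).
Proof.
move=> Ac cx oxw; have [Xc [sX HX X0]] := axis_chart Ac cx.
have n1 := off_axis_near_chart Ac cx oxw.
have n3 : \forall z \near (x, w), tcoord At c z.1 (Xc z.1) = T (cinv c z.1).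
  exact: (sm_cont (sm_fst (x, w)) HX).
apply: (cone_graph_smooth E0 E0 (@ccod_open _ _ _ c)
  (fun x cx => weak_cone_chart Ac cx) (fun z cz Cz => chart_equation Ac cz Cz) cx _ sX).
  by split => //=; rewrite (nbhs_singleton HX).
apply: filterS2 n1 n3 => -[y1 y2] [/= cy oy] Ey; split => //=.
rewrite bundle_invE tcoordD tcoordZ Ey; exact: Ctau.
Qed.

Lemma sm_height_fibre p v : off_axis (T p) v -> sm (tau p) v.
Proof.
move=> ov; apply: (sm_fibre (At := At)); apply: sm_height.
- exact: chart_at_atlas.
- by apply: cmap_cod; exact: chart_at_dom.
- by rewrite tcoord_chart_at cmapK //; exact: chart_at_dom.
Qed.

(** Turns fibre derivatives, which define [support_form], into derivatives of a function on a chart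
    of TM, where smooth dependence on the base point is available. *)
Lemma derive_height c x e w : atlas At c -> ccod c x ->
  off_axis (T (cinv c x)) (tcoord At c x e) ->
  'D_(tcoord At c x w) (tau (cinv c x)) (tcoord At c x e) =
  'D_((0 : E), w) (in_coord At tau c) (x, e).
Proof.
move=> Ac cx oe.
have d1 : differentiable (tau (cinv c x)) (tcoord At c x e + (0 : R) *: tcoord At c x w).
  by rewrite scale0r addr0; apply: sm_diff; exact: sm_height_fibre.
have d2 : differentiable (in_coord At tau c) ((x, e) + (0 : R) *: ((0 : E), w)).
  by rewrite scale0r addr0; apply: sm_diff; exact: sm_height.
have := derive_line d1; rewrite scale0r addr0 => <-.
have := derive_line d2; rewrite scale0r addr0 => <-.
congr ('D_1 _ (0 : R)); apply/funext => t.
rewrite scale_pairE -[(x, e) + _]/(_ + _, _ + _) scaler0 addr0.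
by rewrite /in_coord /= tcoordD tcoordZ.
Qed.

Definition support_space p (om : E -> R) :=
  [/\ forall a u v, om (a *: u + v) = a * om u + om v, om (T p) = 1 &
      forall v, closure (Ai p) v -> v <> 0 -> 0 < om v].

(** Locally [om] is the [support_form] at a vector [e0] with constant components, taken on the cone
    over [p0]. Linearity, normalisation and positivity pass to convex combinations. *)
Lemma support_field : exists om : M -> E -> R, forall p,
  SmF At p om /\ support_space p (om p).
Proof.
apply: (@glue_sections R n M At (E -> R) (SmF At) support_space) => //.
- by move=> p s s'; exact: SmF_ext.
- exact: SmF_0.
- by move=> p s s'; exact: SmF_add.
- by move=> p f s; exact: SmF_scale.
- move=> p f g t /andP[t0 t1] [fl fT fp] [gl gT gp]; split.
  + move=> a u v.
    change (t * f (a *: u + v) + (1 - t) * g (a *: u + v) =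
      a * (t * f u + (1 - t) * g u) + (t * f v + (1 - t) * g v)).
    by rewrite fl gl; ring.
  + by change (t * f (T p) + (1 - t) * g (T p) = 1); rewrite fT gT; ring.
  + move=> v cv v0; change (0 < t * f v + (1 - t) * g v).
    have := fp v cv v0; have := gp v cv v0 => g0 f0.
    have [->|t0'] := eqVneq t 0; first by rewrite mul0r add0r subr0 mul1r.
    apply: ltr_pwDl; first by rewrite mulr_gt0 // lt_neqAle eq_sym t0'.
    by rewrite mulr_ge0 ?subr_ge0 // ltW.
move=> p0; pose c := chart_at At p0; have Ac : atlas At c by exact: chart_at_atlas.
have cp0 : cdom c p0 by exact: chart_at_dom.
have [_ _ _ _ [_ _ [e0 Ce0]]] := wc p0.
have oe0 : off_axis (T p0) e0 := weak_cone_C_line (wc p0) (AT p0) Ce0.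
pose s p := support_form (tau p) (tcoord At c (cmap c p) e0).
exists s.
have n1 : \forall z \near (cmap c p0, e0),
    ccod c z.1 /\ off_axis (T (cinv c z.1)) (tcoord At c z.1 z.2).
  apply: off_axis_near_chart => //; first exact: cmap_cod.
  by rewrite tcoord_chart_at cmapK.
have sp (x : E) : sm (fun x : E => (x, e0)) x.
  by apply: sm_pair; [exact: sm_id|exact: sm_cst].
have n2 : \forall x \near cmap c p0,
    ccod c x /\ off_axis (T (cinv c x)) (tcoord At c x e0) := sm_cont (sp _) n1.
apply: filterS2 (near_cdom cp0) (near_cmap cp0 n2) => p cp [cx].
rewrite cmapK // => op.
have oN q u : off_axis (T q) u -> off_axis (T q) (- u).
  by move=> H; rewrite -scaleN1r; apply: off_axis_scale => //; rewrite oppr_eq0 oner_eq0.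
have st q := fun v => @sm_height_fibre q v.
split; last first.
  split.
  - by move=> a u v; apply: (support_form_lin (T := T p)) => //; exact: st.
  - exact: (support_form_axis (isc p) (AT p) (@Ctau p) (@st p) op).
  - by move=> v cv v0; exact: (support_form_pos E0 (isc p) (AT p) (@Ctau p) (@st p) op cv v0).
apply: (SmF_chart Ac cp) => w.
have oz : off_axis (T (cinv c (cmap c p))) (tcoord At c (cmap c p) e0) by rewrite cmapK.
have tcN x : tcoord At c x (- e0) = - tcoord At c x e0 by rewrite /tcoord linearN.
have ozN : off_axis (T (cinv c (cmap c p))) (tcoord At c (cmap c p) (- e0)).
  by rewrite tcN; exact: oN.
have S e : off_axis (T (cinv c (cmap c p))) (tcoord At c (cmap c p) e) ->
    sm (fun y : E * E => 'D_((0 : E), y.2) (in_coord At tau c) (y.1, e)) (cmap c p, w).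
  move=> oe; apply: sm_diff2 => //; last exact: sm_height.
    by apply: sm_pair; [exact: sm_fst|exact: sm_cst].
  by apply: sm_pair; [exact: sm_cst|exact: sm_snd].
have SS := sm_mul (sm_cst (- 2^-1 : R) _) (sm_add (S _ oz) (S _ ozN)).
apply: sm_ext SS.
have n3 : \forall x \near cmap c p,
    ccod c x /\ off_axis (T (cinv c x)) (tcoord At c x e0).
  exact: (sm_cont (sp _) (off_axis_near_chart Ac cx oz)).
have n4 : \forall y \near (cmap c p, w),
    ccod c y.1 /\ off_axis (T (cinv c y.1)) (tcoord At c y.1 e0).
  exact: (sm_cont (sm_fst (cmap c p, w)) n3).
apply: filterS n4 => -[y1 y2] [/= cy oy].
rewrite /in_coord /s /support_form /= cinvK //.
have oyN : off_axis (T (cinv c y1)) (tcoord At c y1 (- e0)).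
  by rewrite tcN; exact: oN.
by rewrite -(derive_height _ Ac cy oy) -(derive_height _ Ac cy oyN) tcN.
Qed.

End Axis.

End ConeStructure.

(** * The metric over the whole manifold *)

Section LorentzField.
Context {R : realType} {n : nat} {M : topologicalType}.
Variable At : smooth_atlas R n M.
Variable C : set (tangent_bundle At).
Notation E := 'rV[R]_n.
Hypothesis hM : hausdorff_space M.
Hypothesis scM : @second_countable M.
Hypothesis csC : cone_structure C.
Variable Ai : M -> set E.
Hypothesis isc : forall p, is_cone (fibre C p) (Ai p).
Variables (T : M -> E) (tau om : M -> E -> R).
Hypothesis sT : forall p, SmV At p T.
Hypothesis AT : forall p, Ai p (T p).
Hypothesis Ctau : forall p v, off_axis (T p) v -> fibre C p (v + tau p v *: T p).
Hypothesis som : forall p, SmF At p om.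
Hypothesis omP : forall p, support_space Ai T p (om p).

Let E0 : findim E. Proof. exact: findim_rV. Qed.
Let EE0 : findim (E * E)%type. Proof. by apply: findim_prod; exact: findim_rV. Qed.
Let stau p v : off_axis (T p) v -> sm (tau p) v.
Proof. by move=> ov; exact: (sm_height_fibre csC isc sT AT Ctau ov). Qed.
Let oml p a u v : om p (a *: u + v) = a * om p u + om p v.
Proof. by have [H _ _] := omP p; exact: H. Qed.
Let omT p : om p (T p) = 1. Proof. by have [] := omP p. Qed.
Let ompos p v : closure (Ai p) v -> v <> 0 -> 0 < om p v.
Proof. by have [_ _ H] := omP p; exact: H. Qed.
Let om0 p : om p 0 = 0.
Proof.
have := oml p 1 0 0; rewrite scale1r addr0 mul1r => /eqP.
by rewrite addrC -subr_eq subrr => /eqP <-.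
Qed.
Let omZ p a u : om p (a *: u) = a * om p u.
Proof. by rewrite -[a *: u]addr0 oml om0 addr0. Qed.

Let sm_chartF (s : M -> E -> R) c x w : (forall p, SmF At p s) -> atlas At c -> ccod c x ->
  sm (in_coord At s c) (x, w).
Proof.
by move=> ss Ac cx; have := ss _ _ Ac (cinv_dom cx) w; rewrite cinvK.
Qed.

Definition gauge_field p v := gauge (T p) (tau p) (om p) v.

(** Upper semicontinuity of the gauge on TM, axis included, from the openness of the interiors in a
    chart. *)
Lemma gauge_field_lt_near c x w (e : R) : atlas At c -> ccod c x -> 0 < e ->
  gauge_field (cinv c x) (tcoord At c x w) < e ->
  \forall z \near (x, w), gauge_field (cinv c z.1) (tcoord At c z.1 z.2) < e.
Proof.
move=> Ac cx e0 ge; have [Xc [sX HX X0]] := axis_chart isc sT AT Ac cx.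
have glt p v := gauge_lt (isc p) (AT p) (@Ctau p) (oml p) (omT p) v e0.
pose h (z : E * E) := z.2 + (e - in_coord At om c z) *: Xc z.1.
have A0 : Ai (cinv c x) (tcoord At c x (h (x, w))).
  by rewrite /h tcoordD tcoordZ (nbhs_singleton HX); exact/glt.
have n1 := interior_in_chart_open csC isc Ac cx A0.
have sh : sm (fun z : E * E => (z.1, h z)) (x, w).
  apply: sm_pair; first exact: sm_fst.
  apply: sm_add; first exact: sm_snd.
  apply: sm_scale.
    by apply: sm_sub; [exact: sm_cst|exact: sm_chartF].
  by apply: (sm_comp (g := Xc)) => //; exact: sm_fst.
have n2 : \forall z \near (x, w), interior_in_chart At Ai c (z.1, h z) := sm_cont sh n1.
have n3 : \forall z \near (x, w), tcoord At c z.1 (Xc z.1) = T (cinv c z.1).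
  exact: (sm_cont (sm_fst (x, w)) HX).
apply: filterS2 n2 n3 => z [_ /= Az] Ez; apply/glt.
by move: Az; rewrite /h tcoordD tcoordZ Ez.
Qed.

Lemma sm_gauge_field c x w : atlas At c -> ccod c x ->
  off_axis (T (cinv c x)) (tcoord At c x w) -> sm (in_coord At gauge_field c) (x, w).
Proof.
move=> Ac cx oxw.
have st := sm_height csC isc sT AT Ctau Ac cx oxw.
have so : sm (in_coord At om c) (x, w) by exact: sm_chartF.
apply: sm_ext (sm_add st so).
have n1 := off_axis_near_chart isc sT AT Ac cx oxw.
by apply: filterS n1 => z [_ oz]; rewrite /in_coord /gauge_field gauge_off.
Qed.

Lemma kernel_off_axis p v : om p v = 0 -> v <> 0 -> off_axis (T p) v.
Proof.
move=> ov v0 a va; apply: v0; move: ov; rewrite va omZ omT mulr1 => ->.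
by rewrite scale0r.
Qed.

(** On the unit sphere of a chart the gauge is positive wherever [om] vanishes. Compactness gives
    one constant for all nearby fibres, and homogeneity extends the bound to all vectors. *)
Lemma kernel_gauge_bound p0 (c := chart_at At p0) : exists2 k : R, 0 < k &
  \forall x \near cmap c p0, forall u : E, om (cinv c x) (tcoord At c x u) = 0 ->
    4 * (k * sqnorm u) <= gauge_field (cinv c x) (tcoord At c x u) ^+ 2.
Proof.
have Ac : atlas At c by exact: chart_at_atlas.
have cp0 : cdom c p0 by exact: chart_at_dom.
have cx0 : ccod c (cmap c p0) by exact: cmap_cod.
pose x0 := cmap c p0.
pose S := [set u : E | sqnorm u = 1].
have cS : compact S.
  apply: (subclosed_compact _ (@rV_box_compact R n 0 1)).
    rewrite (_ : S = (@sqnorm R n) @^-1` [set 1]); last by apply/seteqP; split.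
    apply: closed_comp; last exact: closed_eq.
    by move=> u _; exact: (sm_cont (sm_sqnorm u)).
  move=> u /= u1 i; rewrite mxE subr0 -[leRHS](sqrtr1 R) -sqrtr_sqr ler_wsqrtr //.
  by rewrite -u1 coord_le_sqnorm.
(* The constant is a parameter near 0, alongside the base point: at 0 the inequality is strict on
   the kernel of [om], so it persists for small positive constants. *)
pose P (i : R * E) (u : E) := om (cinv c i.2) (tcoord At c i.2 u) = 0 ->
  4 * (i.1 * sqnorm u) <= gauge_field (cinv c i.2) (tcoord At c i.2 u) ^+ 2.
have nS : \forall i \near nbhs ((0 : R), x0), S `<=` P i.
  move/compact_near_coveringP : cS; apply => u Su.
  pose r (z : E * (R * E)) := (z.2.2, z.1).
  have sr : sm r (u, ((0 : R), x0)).
    apply: sm_pair; last exact: sm_fst.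
    apply: (sm_comp (g := snd)); [|exact: sm_snd|exact: sm_snd].
    by apply: findim_prod => //; exact: findimR.
  suff H : \forall z \near (u, ((0 : R), x0)), P z.2 z.1 by exact: H.
  (* Near a vector with [om] non-zero the implication is vacuous. *)
  have [om0u|omu] := eqVneq (om (cinv c x0) (tcoord At c x0 u)) 0; last first.
    have so : sm (fun z => in_coord At om c (r z)) (u, ((0 : R), x0)).
      by apply: (sm_comp (g := in_coord At om c)) => //; exact: sm_chartF.
    have n1 : \forall z \near (u, ((0 : R), x0)), in_coord At om c (r z) != 0.
      exact: (@cvgr_neq0 R R _ (nbhs (u, ((0 : R), x0))) _ _ _ (sm_cont so) omu).
    by apply: filterS n1 => z oz Ez; move: oz; rewrite /in_coord /= Ez eqxx.
  have u0 : u <> 0.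
    by move=> u0; move: Su; rewrite /S /= u0 /sqnorm big1 => [/eqP|i _];
      rewrite ?mxE ?expr0n // eq_sym oner_eq0.
  have v0 : tcoord At c x0 u <> 0.
    move=> v0; apply: u0; rewrite -(tcoordK u Ac cx0) -/x0 v0.
    by rewrite /tcoord_inv linear0.
  have ou := kernel_off_axis om0u v0.
  have sg : sm (fun z => in_coord At gauge_field c (r z)) (u, ((0 : R), x0)).
    by apply: (sm_comp (g := in_coord At gauge_field c)) => //; exact: sm_gauge_field.
  have sk : sm (fun z : E * (R * E) => in_coord At gauge_field c (r z) ^+ 2 -
      4 * (z.2.1 * sqnorm z.1)) (u, ((0 : R), x0)).
    apply: sm_sub; first exact: sm_exp2.
    apply: sm_mul; first exact: sm_cst.
    apply: sm_mul.
      apply: (sm_comp (g := fst)); [|exact: sm_snd|exact: sm_fst].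
      by apply: findim_prod => //; exact: findimR.
    by apply: (sm_comp (g := @sqnorm R n)) => //; [exact: sm_fst|exact: sm_sqnorm].
  have g0 : 0 < gauge_field (cinv c x0) (tcoord At c x0 u).
    exact: (gauge_gt0 (isc _) (@Ctau _) (oml _) (omT _) (@ompos _) ou).
  have k0 : 0 < in_coord At gauge_field c (r (u, ((0 : R), x0))) ^+ 2 -
      4 * (0 * sqnorm u).
    by rewrite mul0r mulr0 subr0 exprn_gt0.
  have n1 : \forall z \near (u, ((0 : R), x0)),
      0 < in_coord At gauge_field c (r z) ^+ 2 - 4 * (z.2.1 * sqnorm z.1).
    exact: (@cvgr_gt R _ (nbhs (u, ((0 : R), x0))) _ _ _ (sm_cont sk) _ k0).
  by apply: filterS n1 => z; rewrite subr_gt0 => /ltW H _; exact: H.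
have [[Q1 Q2] /= [q1 q2] HQ] := nS.
have [e e0 He] := nbhs_line (1 : R) q1.
have e2 : 0 < e / 2 by rewrite divr_gt0.
exists (e / 2) => //.
have Qe : Q1 (e / 2).
  have := He (e / 2); rewrite add0r /= scaler1; apply.
  by rewrite gtr0_norm // ltr_pdivrMr // ltr_pMr // ltr1n.
apply: filterS2 (near_chart cp0) q2 => x cx Qx u omu.
have [->|/eqP u0] := eqVneq u 0.
  by rewrite {1}/sqnorm big1 ?mulr0 ?sqr_ge0 // => i _; rewrite mxE expr0n.
have N0 := sqnorm_gt0 u0; pose a := Num.sqrt (sqnorm u).
have a0 : 0 < a by rewrite sqrtr_gt0.
have a2 : a ^+ 2 = sqnorm u by rewrite sqr_sqrtr // ltW.
pose u' := a^-1 *: u.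
have uE : u = a *: u' by rewrite scalerA divff ?scale1r // gt_eqF.
have Su' : S u'.
  by rewrite /S /= sqnormZ exprVn a2 mulVf // gt_eqF.
have omu' : om (cinv c x) (tcoord At c x u') = 0.
  by rewrite tcoordZ omZ omu mulr0.
have := HQ (e / 2, x) (conj Qe Qx) u' Su' omu'; rewrite /= Su' mulr1 => H.
have gE : gauge_field (cinv c x) (tcoord At c x u) = a * gauge_field (cinv c x) (tcoord At c x u').
  rewrite {1}uE tcoordZ; exact: (gauge_scale (isc _) (AT _) (@Ctau _) (oml _)).
rewrite gE exprMn a2 (_ : 4 * (e / 2 * sqnorm u) = sqnorm u * (4 * (e / 2))); last by ring.
by apply: ler_wpM2l => //; exact: ltW.
Qed.

(** Being quadratic is stated along lines: this passes to convex combinations and is the form from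
    which second derivatives are computed. *)
Definition quadratic_space p (q : E -> R) :=
  [/\ forall v u, exists b : R, forall r : R, q (v + r *: u) = q v + r * b + r ^+ 2 * q u,
      forall v, 0 <= q v, forall v, om p v = 0 -> v <> 0 -> 0 < q v &
      forall v, 4 * q v <= gauge_field p v ^+ 2].

Lemma quadratic_field : exists q : M -> E -> R, forall p,
  SmF At p q /\ quadratic_space p (q p).
Proof.
apply: (@glue_sections R n M At (E -> R) (SmF At) quadratic_space) => //.
- by move=> p s s'; exact: SmF_ext.
- exact: SmF_0.
- by move=> p s s'; exact: SmF_add.
- by move=> p f s; exact: SmF_scale.
- move=> p f g t /andP[t0 t1] [fq f0 fp fg] [gq g0 gp gg].
  have t1' : 0 <= 1 - t by rewrite subr_ge0.
  split.
  + move=> v u; have [b Hb] := fq v u; have [b' Hb'] := gq v u.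
    exists (t * b + (1 - t) * b') => r.
    change (t * f (v + r *: u) + (1 - t) * g (v + r *: u) =
      t * f v + (1 - t) * g v + r * (t * b + (1 - t) * b') +
      r ^+ 2 * (t * f u + (1 - t) * g u)).
    by rewrite Hb Hb'; ring.
  + move=> v; change (0 <= t * f v + (1 - t) * g v).
    by rewrite addr_ge0 // mulr_ge0.
  + move=> v ov v0; change (0 < t * f v + (1 - t) * g v).
    have fv := fp v ov v0; have gv := gp v ov v0.
    have [->|t0'] := eqVneq t 0; first by rewrite mul0r add0r subr0 mul1r.
    apply: ltr_pwDl; first by rewrite mulr_gt0 // lt_neqAle eq_sym t0'.
    by rewrite mulr_ge0 // ltW.
  + move=> v; change (4 * (t * f v + (1 - t) * g v) <= gauge_field p v ^+ 2).
    have Hf := ler_wpM2l t0 (fg v); have Hg := ler_wpM2l t1' (gg v).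
    have tE (y : R) : t * y + (1 - t) * y = y by ring.
    have := lerD Hf Hg; rewrite tE; apply: le_trans.
    by rewrite le_eqVlt; apply/orP; left; apply/eqP; ring.
move=> p0; pose c := chart_at At p0; have Ac : atlas At c by exact: chart_at_atlas.
have cp0 : cdom c p0 by exact: chart_at_dom.
have [k k0 Hk] := kernel_gauge_bound p0.
(* The vector is first projected to the kernel of [om] along [T]; the gauge is invariant along [T],
   so the bound on the kernel gives the bound everywhere. *)
exists (fun p v => k * sqnorm (tcoord_inv At c p (v - om p v *: T p))).
apply: filterS2 (near_cdom cp0) (near_cmap cp0 Hk) => p cp; rewrite -/c cmapK // => Hp.
have cx := cmap_cod cp.
have tK v : tcoord At c (cmap c p) (tcoord_inv At c p v) = v.
  by have := tcoord_invK v Ac cx; rewrite cmapK.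
split; last first.
  split.
  - move=> v u; have [b Hb] := sqnorm_quad (tcoord_inv At c p (v - om p v *: T p))
      (tcoord_inv At c p (u - om p u *: T p)).
    exists (k * b) => r.
    have -> : v + r *: u - om p (v + r *: u) *: T p =
        v - om p v *: T p + r *: (u - om p u *: T p).
      rewrite addrC -{2}[v]scale1r addrC; rewrite scale1r [v + _]addrC oml scalerDl.
      rewrite scalerBr scalerA opprD addrACA addrC; congr (_ + _).
    have -> (y z : E) : tcoord_inv At c p (y + r *: z) =
        tcoord_inv At c p y + r *: tcoord_inv At c p z.
      by rewrite /tcoord_inv linearD linearZ.
    by rewrite Hb; ring.
  - by move=> v; rewrite mulr_ge0 ?sqnorm_ge0 // ltW.
  - move=> v ov v0; rewrite mulr_gt0 //; apply: sqnorm_gt0.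
    rewrite ov scale0r subr0 => E1; apply: v0.
    by rewrite -(tK v) E1 /tcoord linear0.
  - move=> v; have vE : v - om p v *: T p = (- om p v) *: T p + v.
      by rewrite scaleNr addrC.
    have H := Hp (tcoord_inv At c p (v - om p v *: T p)); rewrite tK in H.
    have oE : om p (v - om p v *: T p) = 0 by rewrite vE oml omT mulr1 addNr.
    have gE : gauge_field p (v - om p v *: T p) = gauge_field p v.
      rewrite vE addrC.
      exact: (gauge_shift (isc p) (AT p) (@Ctau p) (oml p) (omT p)).
    by have := H oE; rewrite gE.
apply: (SmF_chart Ac cp) => w.
have [Xc [sX HX X0]] := axis_chart isc sT AT Ac cx.
have so : sm (in_coord At om c) (cmap c p, w) by exact: sm_chartF.
have S : sm (fun z : E * E => k * sqnorm (z.2 - in_coord At om c z *: Xc z.1)) (cmap c p, w).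
  apply: sm_mul; first exact: sm_cst.
  apply: (sm_comp (g := @sqnorm R n)) => //; last exact: sm_sqnorm.
  apply: sm_sub; first exact: sm_snd.
  apply: sm_scale => //.
  by apply: (sm_comp (g := Xc)) => //; exact: sm_fst.
apply: sm_ext S.
have n2 := near_chart_fst (z := (cmap c p, w)) cx.
have n3 : \forall z \near (cmap c p, w), tcoord At c z.1 (Xc z.1) = T (cinv c z.1).
  exact: (sm_cont (sm_fst (cmap c p, w)) HX).
apply: filterS2 n2 n3 => -[y1 y2] /= cy Ey; rewrite /in_coord /= -Ey.
have tN u v : tcoord At c y1 (u - v) = tcoord At c y1 u - tcoord At c y1 v.
  by rewrite /tcoord linearB.
by rewrite -tcoordZ -tN tcoordK.
Qed.

Section Metric.
Variable q : M -> E -> R.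
Hypothesis sq : forall p, SmF At p q.
Hypothesis qP : forall p, quadratic_space p (q p).
Variable m : R -> R.
Hypothesis sm_m : forall s, sm m s.
Hypothesis m_low : forall s, s <= 1 -> m s = m 0.

Definition lorentz_field p v := lorentz (T p) (tau p) (om p) (q p) m v.

Let q_ge0 p v : 0 <= q p v. Proof. by have [_ H _ _] := qP p; exact: H. Qed.
Let q_gt0 p v : om p v = 0 -> v <> 0 -> 0 < q p v.
Proof. by have [_ _ H _] := qP p; exact: H. Qed.

Lemma sm_lorentz_field c x w : atlas At c -> ccod c x -> w <> 0 ->
  sm (in_coord At lorentz_field c) (x, w).
Proof.
move=> Ac cx w0; set p := cinv c x; set v := tcoord At c x w.
have v0 : v <> 0.
  by move=> v0; apply: w0; rewrite -(tcoordK w Ac cx) -/v v0 /tcoord_inv linear0.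
have sOm : sm (in_coord At om c) (x, w) by exact: sm_chartF.
have sQ : sm (in_coord At q c) (x, w) by exact: sm_chartF.
pose W (z : E * E) := wform (om (cinv c z.1)) (q (cinv c z.1)) (tcoord At c z.1 z.2).
have sW : sm W (x, w).
  have S := sm_add sQ (sm_mul (sm_exp2 sOm) (sm_cst (16^-1 : R) _)).
  by apply: sm_ext S; near=> z.
have W0 : 0 < W (x, w) by exact: (wform_gt0 (@q_ge0 _) (@q_gt0 _) v0).
have F0 : 0 <= gauge_field p v.
  exact: (gauge_ge0 (isc p) (@Ctau p) (oml p) (omT p) (@ompos p)).
have [lt1|ge1] := ltP (gauge_field p v ^+ 2) (W (x, w)).
  (* A threshold strictly between the two: the gauge below [e] and [W] above [e ^+ 2] are open
     conditions, which together keep the ratio below 1, where [m] is constant. *)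
  pose b := (gauge_field p v ^+ 2 + W (x, w)) / 2.
  have b0 : 0 < b by rewrite divr_gt0 // ltr_wpDl // sqr_ge0.
  pose e := Num.sqrt b.
  have e0 : 0 < e by rewrite sqrtr_gt0.
  have e2 : e ^+ 2 = b by rewrite sqr_sqrtr // ltW.
  have Fe : gauge_field p v < e.
    rewrite -(@ltr_pXn2r _ 2) ?nnegrE ?(ltW e0) // e2 /b ltr_pdivlMr //; lra.
  have We : e ^+ 2 < W (x, w) by rewrite e2 /b ltr_pdivrMr //; lra.
  have n1 := gauge_field_lt_near Ac cx e0 Fe.
  have n2 : \forall z \near (x, w), e ^+ 2 < W z.
    exact: (@cvgr_gt R _ (nbhs (x, w)) _ _ _ (sm_cont sW) _ We).
  have S := sm_sub (sm_exp2 sOm) (sm_mul sW (sm_cst (m 0) _)).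
  apply: sm_ext S; apply: filterS2 n1 n2 => z Fz Wz.
  rewrite /in_coord /lorentz_field /lorentz -/(W z); congr (_ - _ * _).
  apply/esym/m_low; rewrite ler_pdivrMr; last first.
    by apply: le_lt_trans Wz; rewrite sqr_ge0.
  rewrite mul1r; apply/ltW/(lt_trans _ Wz).
  rewrite ltr_pXn2r ?nnegrE // ?(ltW e0) //.
  exact: (gauge_ge0 (isc _) (@Ctau _) (oml _) (omT _) (@ompos _)).
have ov : off_axis (T p) v.
  apply: (ratio_off (tau := tau p) (om := om p) (q := q p)) => //=.
  rewrite divr_gt0 //; exact: lt_le_trans ge1.
have sF : sm (in_coord At gauge_field c) (x, w) by exact: sm_gauge_field.
have sR : sm (fun z => in_coord At gauge_field c z ^+ 2 / W z) (x, w).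
  by apply: sm_div => //; [exact: sm_exp2|rewrite gt_eqF].
have S := sm_sub (sm_exp2 sOm) (sm_mul sW (sm_comp (g := m) (@findimR R) sR (sm_m _))).
by apply: sm_ext S; near=> z.
Unshelve. all: by end_near. Qed.

End Metric.

End LorentzField.

Lemma fundamental_tensorE {R : realType} {n : nat} {M : topologicalType}
    (At : smooth_atlas R n M) (L : tangent_bundle At -> R) p v u w :
  sm (fun v => L (at_point At p v)) v ->
  fundamental_tensor L p v u w =
  2^-1 * 'D_u (fun y => 'D_w (fun v => L (at_point At p v)) y) v.
Proof.
move=> sL; set f := fun v => L (at_point At p v).
apply: (congr1 (fun y : R => 2^-1 * y)).
have d1 : differentiable (fun y => 'D_w f y) (v + (0 : R) *: u).
  by rewrite scale0r addr0; apply: sm_diff; exact: sm_D.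
have := derive_line d1; rewrite scale0r addr0 => <-; rewrite derive1E.
apply: near_eq_derive.
have n0 : \forall y \near v + (0 : R) *: u, differentiable f y.
  by rewrite scale0r addr0; exact: sm_diff_near.
have n1 : \forall r \near (0 : R), differentiable f (v + r *: u).
  exact: (sm_cont (sm_line v u 0) n0).
apply: filterS n1 => r dr; rewrite derive1E.
have d2 : differentiable f (v + r *: u + (0 : R) *: w) by rewrite scale0r addr0.
by have := derive_line d2; rewrite scale0r addr0.
Qed.

Theorem corollary5p8 (R : realType) (n : nat) (M : topologicalType)
    (A : smooth_atlas R n M) (C : set (tangent_bundle A)) :
  (2 <= n)%N ->
  hausdorff_space M ->
  @second_countable M ->
  cone_structure C ->
  exists L : tangent_bundle A -> R,
    [/\ pos_homogeneous2 L,
        smooth_off_zero L,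
        forall (p : M) (v : 'rV[R]_n), v <> 0 ->
          index_n_minus_1 (fundamental_tensor L p v),
        forall v, cone_domain C v -> 0 < L v
      & forall v, C v -> L v = 0].
Proof.
move=> n2 hM scM csC.
have [_ cones _] := csC; have [Ai isc] := choice cones.
have [T HT] := axis_field hM scM csC isc.
have sT p := (HT p).1; have AT p := (HT p).2.
have [tau Ctau] := cone_height isc AT.
have [om Hom] := support_field hM scM csC isc sT AT Ctau.
have som p := (Hom p).1; have omP p := (Hom p).2.
have [q Hq] := quadratic_field hM scM csC isc sT AT Ctau som omP.
have sq p := (Hq p).1; have qP p := (Hq p).2.
have [m [sm_m [m_low m_high] m2 dm ddm]] := @smooth_max_profile R.
have m_pos s := (m2 s).1; have m_le2 s := (m2 s).2.
have sL := sm_lorentz_field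
  csC isc sT AT Ctau som omP sq qP sm_m m_low.
pose Lf := lorentz_field T tau om q m.
have stau p v (ov : off_axis (T p) v) : sm (tau p) v.
  exact: (sm_height_fibre csC isc sT AT Ctau ov).
exists (fun v => Lf (foot v) (tvec v)); split.
- move=> p v a a0; have [oml _ _] := omP p; have [q1 q2 _ q4] := qP p.
  exact: (lorentz_scale m (isc p) (AT p) (@Ctau p) oml q1 q2 q4).
- move=> c Ac; apply: sm_smooth_on => -[x w] [/= cx w0].
  exact: (sL c x w Ac cx w0).
- move=> p v v0; have [oml omT ompos] := omP p; have [q1 q2 q3 q4] := qP p.
  have sLp : sm (Lf p) v.
    apply: (sm_fibre (At := A)); apply: sL => //; first exact: chart_at_atlas.
    by apply: cmap_cod; exact: chart_at_dom.
  have somp u := SmF_fibre u (som p); have sqp u := SmF_fibre u (sq p).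
  have H := hessian_index (ltnW n2) sLp oml
    (fun u => lorentz_hess_neg (findim_rV n) (isc p) (AT p) (@Ctau p) (@stau p) oml omT
      ompos somp q1 q2 q3 sqp sm_m m_low m_pos dm ddm v0 sLp)
    (lorentz_hess_pos (findim_rV n) (isc p) (AT p) (@Ctau p) (@stau p) oml omT
      somp q1 q2 q3 q4 sqp m_high m_le2 v0 sLp).
  have [e eu He] := H; exists e; first exact: eu.
  move=> i j; pose L (z : tangent_bundle A) := Lf (foot z) (tvec z).
  exact: etrans (fundamental_tensorE (L := L) (row i e) (row j e) sLp) (He i j).
- move=> [p v] [A0 iA Av] /=; have [oml omT ompos] := omP p; have [q1 q2 q3 q4] := qP p.
  apply: (lorentz_A (isc p) (AT p) (@Ctau p) oml omT ompos q2 q3 q4 m_high m_le2).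
  (* [A0] is an arbitrary interior of the fibre cone; uniqueness moves [v] to the chosen one. *)
  exact: (weak_cone_interior_unique (is_cone_weak iA) (is_cone_weak (isc p)) Av).
- move=> [p v] Cv /=; have [oml omT ompos] := omP p; have [q1 q2 q3 q4] := qP p.
  exact: (lorentz_C (isc p) (AT p) (@Ctau p) ompos q2 q3 q4 m_high Cv).
Qed.
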